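(* Let $-1 < p < 0$ and let $\xi_1, \xi_2, \dots$ be i.i.d. Steinhaus random variables. Then the best constant $A_p$ in the inequality $A_p\|S\|_2 \le \|S\|_p$ over all Steinhaus sums $S$, that is $$A_p = \inf\left\{ \Big\|\sum_{j=1}^n a_j\xi_j\Big\|_p \;:\; n \ge 1,\ a_1,\dots,a_n > 0,\ \sum_{j=1}^n a_j^2 = 1\right\},$$ is given by $$A_p = \left\|\frac{\xi_1+\xi_2}{\sqrt{2}}\right\|_p .$$
   Context: A Steinhaus random variable is a random variable uniformly distributed on the unit circle $\{z \in \mathbb{C} : |z| = 1\}$ in the complex plane. For a complex-valued random variable $S$ and $p \ne 0$, $\|S\|_p = (\mathbb{E}|S|^p)^{1/p}$. A Steinhaus sum is a finite sum $S = \sum_{j=1}^n a_j\xi_j$ with $n\ge 1$, $a_1,\dots,a_n>0$ and $\xi_1,\dots,\xi_n$ i.i.d. Steinhaus; for such sums $\|S\|_2 = (\sum_{j=1}^n a_j^2)^{1/2}$, and $\mathbb{E}|S|^p<\infty$ for every $p>-1$. *)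

(* Defs.v *)
From HB Require Import structures.
From mathcomp Require Import all_boot all_order all_algebra.
From mathcomp Require Import finmap complex.
From mathcomp Require Import all_classical all_reals all_analysis.

Set Implicit Arguments.
Unset Strict Implicit.
Unset Printing Implicit Defensive.

Import Order.TTheory GRing.Theory Num.Theory.
Import numFieldNormedType.Exports.

Local Open Scope classical_set_scope.
Local Open Scope ring_scope.
Local Open Scope complex_scope.

(* The complex numbers with their Borel sigma-algebra. R[i]^o is R[i] with the topology of the
   modulus; the carrier is convertible to R[i]. *)
Definition borelC (R : realType) := g_sigma_algebraType (@open (R[i])^o).

Definition expi (R : realType) (t : R) : R[i] := cos t +i* sin t.

Lemma pi2_gt0 (R : realType) : 0 < pi *+ 2 :> R.
Proof. by rewrite mulrn_wgt0 // pi_gt0. Qed.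

(* The law of X is the normalized arc length on the unit circle, i.e. the image
   under t |-> e^(it) of the uniform probability on [0, 2 pi]. *)
Definition steinhaus d (T : measurableType d) (R : realType)
    (P : probability T R) (X : {RV P >-> borelC R}) : Prop :=
  forall B : set (borelC R), measurable B ->
    distribution P X B = uniform_prob (@pi2_gt0 R) (@expi R @^-1` B).

Definition mutually_independent d d' (T : measurableType d)
    (T' : measurableType d') (R : realType) (P : probability T R)
    (I : choiceType) (X : I -> {RV P >-> T'}) : Prop :=
  forall (J : {fset I}) (B : I -> set T'),
    (forall i, i \in J -> measurable (B i)) ->
    P (\bigcap_(i in [set` J]) X i @^-1` B i) =
    (\prod_(i <- J) P (X i @^-1` B i))%E.

(* x^r for x in [0, +oo], with 0^r = +oo and (+oo)^r = 0 when r < 0; the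
   library's poweR gives 0 and +oo respectively in these two cases. *)
Definition xpow (R : realType) (x : \bar R) (r : R) : \bar R :=
  if r < 0 then ((x `^ (- r))^-1)%E else (x `^ r)%E.

(* ||S||_p = (E |S|^p)^(1/p), meaningful for p != 0. The exponent p may be
   negative, which rules out the library's Lnorm (see xpow). *)
Definition pnorm d (T : measurableType d) (R : realType) (P : probability T R)
    (p : R) (S : T -> R[i]) : \bar R :=
  xpow (\int[P]_w xpow (ComplexField.Normc.normc (S w))%:E p)%E p^-1.

Definition wsum (T : Type) (R : realType) (xi : nat -> T -> R[i])
    (n : nat) (a : 'I_n -> R) : T -> R[i] :=
  fun w => \sum_(j < n) (a j)%:C * xi j w.

(* Best constant A in A * ||S||_2 <= ||S||_p over Steinhaus sums S, normalized by
   ||S||_2 = 1. The sum a_1 xi_1 + ... + a_n xi_n uses xi 0, ..., xi n.-1. *)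
Definition khinchin_const d (T : measurableType d) (R : realType)
    (P : probability T R) (xi : nat -> T -> R[i]) (p : R) : \bar R :=
  ereal_inf [set x | exists (n : nat) (a : 'I_n -> R),
    [/\ (1 <= n)%N, forall j, 0 < a j, \sum_(j < n) a j ^+ 2 = 1
      & x = pnorm P p (wsum xi a)]].

(* Main.v *)
(* Put q = -p, so that E|S|^(-q) has to be maximised.

   If some a_j >= 1/sqrt 2, condition on the other variables: the mean over the
   circle of |y + a_j e^(it)|^(-q) is largest for |y| = a_j, hence
   E|S|^(-q) <= a_j^(-q) E|xi_0 + xi_1|^(-q).

   Otherwise, integrating l^(q-1) / sqrt(1 + l^2 |S|^2) over l > 0 and writing
   1 / sqrt(1 + r^2) as the mean of 1 / (1 + r^2 cos^2 t), with
   1 / (1 + u^2) = int_0^oo e^(-x) cos(x u) dx, gives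
   E|S|^(-q) = c_q int_0^oo prod_j J0(a_j x) x^(q-1) dx. By the weighted AM-GM
   inequality prod_j |J0(a_j x)| <= sum_j a_j^2 |J0(a_j x)|^(1/a_j^2), so it
   suffices that s^(q/2) int_0^oo |J0|^s x^(q-1) dx is, for s >= 2, largest at
   s = 2. For s <= 11/4 this follows from the concave bound on z^(s-2) and an
   integral inequality for J0^2 (1 - |J0|); for s >= 7/2 from the Gaussian bound
   J0 <= exp(-x^2/4) before the first zero and |J0| <= 21/50 beyond; in between
   by convexity of z^s in s. Both integral inequalities are obtained by adding an
   explicit derivative that makes the integrands comparable pointwise. *)

Require Import Defs.
From HB Require Import structures.
From mathcomp Require Import all_boot all_order all_algebra.
From mathcomp Require Import finmap complex.
From mathcomp Require Import all_classical all_reals all_analysis.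
From mathcomp Require Import measurable_realfun ring lra.

Set Implicit Arguments.
Unset Strict Implicit.

Import Order.TTheory GRing.Theory Num.Theory.
Import numFieldNormedType.Exports.

Local Open Scope classical_set_scope.
Local Open Scope ring_scope.

(** * Calculus preliminaries *)

(** The inequalities for powers of [J0] must hold for every [0 < q < 1] at once. The antiderivatives
    therefore carry a factor [x ^ q], and on [(0, x0]], just short of the first zero of [J0],
    polynomial primitives are taken with the weight frozen at [x0 ^ q]; a sign condition on the
    integrands makes this replacement harmless. All boundary terms are then multiples of [x0 ^ q],
    and a numerical inequality free of [q] remains. Beyond [x0], quadratic forms in [J0] and [J1]
    with powers of [1 / x] as coefficients take over, by means of the Bessel equation.

    The threshold [1 / sqrt 2] is where the exponents [1 / a_j ^ 2] reach 2. On either side of it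
    the bound is attained by the same two-term sum, so that no constant has to be evaluated.

    The products of [J0] are signed and need not be integrable against [x ^ (q - 1)]. Every exchange
    of integrals is therefore made for [1 + cos], which is nonnegative, and the 1 is cancelled at
    fixed [l]; only nonnegative majorants are integrated over the half-line afterwards. *)

Section calculus_rules.
Variable R : realType.
Implicit Types (f g : R -> R) (x c df dg : R).

Lemma cont_cst c : continuous (fun _ : R => c).
Proof. by move=> x; exact: cvg_cst. Qed.

Lemma cont_id : continuous (fun x : R => x).
Proof. by move=> x; exact: cvg_id. Qed.

Lemma contD f g : continuous f -> continuous g -> continuous (fun x => f x + g x).
Proof. by move=> cf cg x; exact: (cvgD (cf x) (cg x)). Qed.

Lemma contN f : continuous f -> continuous (fun x => - f x).
Proof. by move=> cf x; exact: (cvgN (cf x)). Qed.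

Lemma contM f g : continuous f -> continuous g -> continuous (fun x => f x * g x).
Proof. by move=> cf cg x; exact: (cvgM (cf x) (cg x)). Qed.

Lemma contX f n : continuous f -> continuous (fun x => f x ^+ n).
Proof.
move=> cf; elim: n => [|n IH]; first exact: cont_cst.
rewrite (_ : (fun x => f x ^+ n.+1) = fun x => f x * f x ^+ n); last first.
  by apply/funext => x; rewrite exprS.
exact: contM.
Qed.

Lemma contV f : (forall x, f x != 0) -> continuous f -> continuous (fun x => (f x)^-1).
Proof. by move=> f0 cf x; exact: (cvgV (f0 x) (cf x)). Qed.

Lemma cont_comp (h : R -> R) f :
  continuous h -> continuous f -> continuous (fun x => h (f x)).
Proof. by move=> ch cf x; apply: (@continuous_comp _ _ _ f h); [exact: cf|exact: ch]. Qed.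

Lemma cont_cos f : continuous f -> continuous (fun x => cos (f x)).
Proof. by apply: cont_comp; exact: continuous_cos. Qed.

Lemma cont_sin f : continuous f -> continuous (fun x => sin (f x)).
Proof. by apply: cont_comp; exact: continuous_sin. Qed.

Lemma cont_expR f : continuous f -> continuous (fun x => expR (f x)).
Proof. by apply: cont_comp; exact: continuous_expR. Qed.

Lemma cont_norm f : continuous f -> continuous (fun x => `|f x|).
Proof. by move=> cf x; exact: (cvg_norm (cf x)). Qed.

(** With the derivative as a plain argument, [der] can match the shape of the function and leave the
    derivative as an existential variable, to be compared afterwards through [der_eq]. *)
Definition hder (x : R) (f : R -> R) (df : R) : Prop := is_derive x 1 f df.

Lemma der_cst x c : hder x (fun _ : R => c) 0.
Proof. exact: is_derive_cst. Qed.

Lemma der_id x : hder x (fun y : R => y) 1.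
Proof. exact: is_derive_id. Qed.

Lemma derD x f g df dg : hder x f df -> hder x g dg ->
  hder x (fun y => f y + g y) (df + dg).
Proof. exact: is_deriveD. Qed.

Lemma derN x f df : hder x f df -> hder x (fun y => - f y) (- df).
Proof. exact: is_deriveN. Qed.

Lemma derM x f g df dg : hder x f df -> hder x g dg ->
  hder x (fun y => f y * g y) (df * g x + f x * dg).
Proof.
move=> hf hg; apply: (@is_derive_eq _ _ _ _ _ _ _ _ (@is_deriveM _ _ f g x 1 df dg hf hg)).
by rewrite /GRing.scale /= addrC (mulrC (g x)).
Qed.

Lemma derX x f df n : hder x f df ->
  hder x (fun y => f y ^+ n) (n%:R * f x ^+ n.-1 * df).
Proof.
move=> hf; elim: n => [|n IH].
  by rewrite !mul0r; exact: der_cst.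
have := derM hf IH.
rewrite (_ : (fun y => f y * f y ^+ n) = (fun y => f y ^+ n.+1)); last first.
  by apply/funext => y; rewrite exprS.
move=> h; apply: (is_derive_eq h) => /=.
case: n {IH h} => [|n]; first by rewrite expr0; ring.
by rewrite /= !exprS -!natr1; ring.
Qed.

Lemma der_comp x (h : R -> R) f df dh :
  hder (f x) h dh -> hder x f df ->
  hder x (fun y => h (f y)) (dh * df).
Proof. by move=> hh hf; exact: is_derive1_comp. Qed.

Lemma derV x f df : f x != 0 -> hder x f df ->
  hder x (fun y => (f y)^-1) (- df / f x ^+ 2).
Proof.
move=> f0 hf; apply: (is_derive_eq (is_deriveV f0 hf)).
by rewrite /GRing.scale /=; field.
Qed.

Lemma der_cos x f df : hder x f df ->
  hder x (fun y => cos (f y)) (- sin (f x) * df).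
Proof. by apply: der_comp; exact: is_derive_cos. Qed.

Lemma der_sin x f df : hder x f df ->
  hder x (fun y => sin (f y)) (cos (f x) * df).
Proof. by apply: der_comp; exact: is_derive_sin. Qed.

Lemma der_expR x f df : hder x f df ->
  hder x (fun y => expR (f y)) (expR (f x) * df).
Proof. by apply: der_comp; exact: is_derive_expR. Qed.

Lemma der_powR x f df (a : R) : 0 < f x -> hder x f df ->
  hder x (fun y => f y `^ a) (a * f x `^ (a - 1) * df).
Proof.
move=> f0; have fI : f x \in `]0, +oo[ by rewrite in_itv/= f0.
apply: (@der_comp _ (fun y => y `^ a)); apply: DeriveDef.
  exact: (@derivable_powR _ 1 a _ fI).
by rewrite -derive1E (powR_derive1 a fI).
Qed.

Lemma der_eq x f (df df' : R) : hder x f df -> df = df' ->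
  hder x f df'.
Proof. by move=> ? <-. Qed.

Lemma der_continuous x f df : hder x f df -> {for x, continuous f}.
Proof. by case=> df1 _; exact/differentiable_continuous/derivable1_diffP. Qed.

Lemma der_nincr f (df' : R -> R) (a b : R) : a <= b ->
  (forall x, a <= x <= b -> hder x f (df' x)) ->
  (forall x, a <= x <= b -> df' x <= 0) -> f b <= f a.
Proof.
rewrite le_eqVlt => /predU1P[->//|ab] hf hd.
have [| |c + E] := @MVT _ f df' a b ab.
- by move=> x /[!in_itv]/= /andP[ax xb]; apply: hf; rewrite !ltW.
- apply: continuous_in_subspaceT => x /[!inE]/= /[!in_itv]/= xab.
  exact: der_continuous (hf x xab).
- rewrite in_itv/= => /andP[ac cb]; rewrite -subr_le0 E pmulr_lle0 ?subr_gt0//.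
  by apply: hd; rewrite !ltW.
Qed.

Lemma der_ndecr f (df' : R -> R) (a b : R) : a <= b ->
  (forall x, a <= x <= b -> hder x f (df' x)) ->
  (forall x, a <= x <= b -> 0 <= df' x) -> f a <= f b.
Proof.
move=> ab hf hd; rewrite -lerN2.
apply: (@der_nincr (fun x => - f x) (fun x => - df' x) a b ab) => x xab.
  exact/derN/hf.
by rewrite oppr_le0 hd.
Qed.

End calculus_rules.

Ltac cont := repeat lazymatch goal with
  | |- continuous (fun _ => ?c) => exact: cont_cst
  | |- continuous (fun x => x) => exact: cont_id
  | |- continuous (fun x => (@?f x) + (@?g x)) => apply: (@contD _ f g)
  | |- continuous (fun x => - (@?f x)) => apply: (@contN _ f)
  | |- continuous (fun x => (@?f x) * (@?g x)) => apply: (@contM _ f g)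
  | |- continuous (fun x => (@?f x) ^+ ?n) => apply: (@contX _ f n)
  | |- continuous (fun x => cos (@?f x)) => apply: (@cont_cos _ f)
  | |- continuous (fun x => sin (@?f x)) => apply: (@cont_sin _ f)
  | |- continuous (fun x => expR (@?f x)) => apply: (@cont_expR _ f)
  | |- continuous (fun x => `|@?f x|) => apply: (@cont_norm _ f)
  | |- continuous (@cos _) => exact: continuous_cos
  | |- continuous (@sin _) => exact: continuous_sin
  | |- continuous _ => assumption
  end.

Ltac der := repeat lazymatch goal with
  | |- hder _ (fun _ => ?c) _ => exact: der_cst
  | |- hder _ (fun x => x) _ => exact: der_id
  | |- hder _ (fun x => (@?f x) + (@?g x)) _ => apply: (@derD _ _ f g)
  | |- hder _ (fun x => - (@?f x)) _ => apply: (@derN _ _ f)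
  | |- hder _ (fun x => (@?f x) * (@?g x)) _ => apply: (@derM _ _ f g)
  | |- hder _ (fun x => (@?f x) ^+ ?n) _ => apply: (@derX _ _ f _ n)
  | |- hder _ (fun x => cos (@?f x)) _ => apply: (@der_cos _ _ f)
  | |- hder _ (fun x => sin (@?f x)) _ => apply: (@der_sin _ _ f)
  | |- hder _ (fun x => expR (@?f x)) _ => apply: (@der_expR _ _ f)
  | |- hder _ _ _ => eassumption
  end.

(** * Means over the circle *)

Section circle_average.
Variable R : realType.
Implicit Types f g F : R -> R.

Definition cavg f : R :=
  (pi *+ 2)^-1 * (\int[lebesgue_measure]_(x in `[0, pi *+ 2]) f x)%R.

Lemma circle_integrable f : continuous f ->
  lebesgue_measure.-integrable `[0, pi *+ 2] (EFin \o f).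
Proof.
move=> cf; apply: continuous_compact_integrable; first exact: segment_compact.
exact: continuous_subspaceT.
Qed.

Lemma cavg_cst (c : R) : cavg (fun=> c) = c.
Proof.
rewrite /cavg Rintegral_cst//= lebesgue_measure_itv/= lte_fin pi2_gt0/=.
by rewrite subr0 mulrCA mulVf ?mulr1 // gt_eqF // pi2_gt0.
Qed.

Lemma cavgD f g : continuous f -> continuous g ->
  cavg (fun t => f t + g t) = cavg f + cavg g.
Proof.
by move=> cf cg; rewrite /cavg RintegralD ?mulrDr//; exact: circle_integrable.
Qed.

Lemma cavgZ (c : R) f : continuous f -> cavg (fun t => c * f t) = c * cavg f.
Proof.
by move=> cf; rewrite /cavg RintegralZl ?(mulrCA c)//; exact: circle_integrable.
Qed.

Lemma eq_cavg f g : f =1 g -> cavg f = cavg g.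
Proof. by move=> /funext ->. Qed.

Lemma cavg_le f g : continuous f -> continuous g ->
  (forall t, f t <= g t) -> cavg f <= cavg g.
Proof.
move=> cf cg fg; apply: ler_wpM2l; first by rewrite invr_ge0 ltW ?pi2_gt0.
by apply: le_Rintegral; [|exact: circle_integrable..|move=> t _; exact: fg].
Qed.

(** Integration by parts on the circle in disguise: every recurrence and differential equation below
    comes from exhibiting a periodic primitive. *)
Lemma cavg_periodic_derive F f : (forall t : R, hder t F (f t)) ->
  continuous f -> F (pi *+ 2) = F 0 -> cavg f = 0.
Proof.
move=> dF cf F0; rewrite /cavg /Rintegral (@continuous_FTC2 _ f F).
- by rewrite F0 subee// mulr0.
- exact: pi2_gt0.
- exact: continuous_subspaceT.
- have cF : continuous F.
    by move=> t; apply/differentiable_continuous/derivable1_diffP; case: (dF t).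
  split.
  + by move=> t _; case: (dF t).
  + exact/cvg_at_right_filter/cF.
  + exact/cvg_at_left_filter/cF.
- by move=> t _; rewrite derive1E; case: (dF t).
Qed.

Lemma cavg_derive (f f' : R -> R -> R) (a e M : R) : 0 < e ->
  (forall x, `|x - a| < e -> continuous (f x)) ->
  (forall x t : R, `|x - a| < e -> hder x (f ^~ t) (f' x t)) ->
  (forall x t, `|x - a| < e -> `|f' x t| <= M) ->
  hder a (fun x => cavg (f x)) (cavg (f' a)).
Proof.
move=> e0 cf df f'M.
have inI x : `](a - e), (a + e)[%classic x -> `|x - a| < e.
  by rewrite /= in_itv/= ltr_distl.
have Ia : `](a - e), (a + e)[%classic a by rewrite /= in_itv/=; lra.
have M0 : 0 <= M by apply: (le_trans (normr_ge0 _) (f'M a 0 _)); rewrite subrr normr0.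
have p1E x t : `](a - e), (a + e)[%classic x -> partial1of2 f x t = f' x t.
  by move=> /inI xe; rewrite partial1of2E; case: (df x t xe).
have H := @cvg_differentiation_under_integral R _ _
  (@lebesgue_measure R) f `[0, pi *+ 2] (measurable_itv _) a (a - e) (a + e) Ia
  (fun x Ix => circle_integrable (cf x (inI x Ix)))
  (fun x t Ix _ => @ex_derive _ _ _ _ _ _ _ (df x t (inI x Ix) : is_derive x 1 _ _))
  (fun=> M) (fun=> M0) (circle_integrable (fun=> @cvg_cst _ _ _ _ _)).
have : h^-1 *: ((cavg \o f) (h + a) - (cavg \o f) a) @[h --> 0^'] --> cavg (f' a).
  rewrite [X in X @ _ --> _](_ : _ = (fun h : R => (pi *+ 2)^-1 * (h^-1 *:
    ((\int[lebesgue_measure]_(t in `[0, pi *+ 2]) f (h + a) t)%R -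
     (\int[lebesgue_measure]_(t in `[0, pi *+ 2]) f a t)%R)))); last first.
    by apply/funext => h; rewrite /cavg /= -mulrBr scalerAr.
  apply: cvgM; first exact: cvg_cst.
  rewrite (_ : (\int[lebesgue_measure]_(x in _) f' a x)%R =
    (\int[lebesgue_measure]_(x in `[0, pi *+ 2]) partial1of2 f a x)%R); last first.
    by apply: eq_Rintegral => t _; rewrite p1E.
  by apply: H => x t Ix _; rewrite p1E //; apply: f'M; exact: inI.
move=> L; apply: DeriveDef.
  by apply/cvg_ex => /=; exists (cavg (f' a)); under eq_fun do rewrite scaler1.
by rewrite -derive1E; exact/cvg_lim.
Qed.

End circle_average.

(** * Bessel functions *)

Section bessel.
Variable R : realType.
Implicit Types x t z : R.

(** The Bessel functions of orders 0 and 1 by Bessel's integral. [J0] is the characteristic function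
    of the real part of a Steinhaus variable, which is how it enters. *)
Definition J0 x : R := cavg (fun t => cos (x * cos t)).
Definition J1 x : R := cavg (fun t => cos t * sin (x * cos t)).

Lemma normM_le1 (a b : R) : `|a| <= 1 -> `|b| <= 1 -> `|a * b| <= 1.
Proof. by move=> a1 b1; rewrite normrM mulr_ile1. Qed.

Lemma norm_cos_le1 x : `|cos x| <= 1.
Proof. by rewrite ler_norml cos_geN1 cos_le1. Qed.

Lemma norm_sin_le1 x : `|sin x| <= 1.
Proof. by rewrite ler_norml sin_geN1 sin_le1. Qed.

Lemma cavgN (f : R -> R) : continuous f -> cavg (fun t => - f t) = - cavg f.
Proof.
move=> cf; rewrite -mulN1r -cavgZ//; apply: eq_cavg => t; by rewrite mulN1r.
Qed.

Lemma der_J0 x : hder x J0 (- J1 x).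
Proof.
rewrite /J1 -cavgN; last by cont.
apply: (@cavg_derive _ (fun x t => cos (x * cos t))
  (fun x t => - (cos t * sin (x * cos t))) x 1 1) => //.
- by move=> y _; cont.
- move=> y t _; apply: der_eq; first by der.
  by rewrite /=; ring.
- by move=> y t _; rewrite normrN normM_le1 ?norm_cos_le1 ?norm_sin_le1.
Qed.

Lemma der_J1 x : hder x J1 (cavg (fun t => cos t ^+ 2 * cos (x * cos t))).
Proof.
apply: (@cavg_derive _ (fun x t => cos t * sin (x * cos t))
  (fun x t => cos t ^+ 2 * cos (x * cos t)) x 1 1) => //.
- by move=> y _; cont.
- move=> y t _; apply: der_eq; first by der.
  by rewrite /=; ring.
- by move=> y t _; rewrite !normM_le1 ?norm_cos_le1.
Qed.

(** The periodic function [sin t * sin (x cos t)] has derivative [cos t sin (x cos t) - x sin^2 t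
    cos (x cos t)], of mean zero; then [sin^2] is replaced by [1 - cos^2]. Keeping the factor [x]
    avoids a case at the origin. *)
Lemma bessel_ode x :
  x * cavg (fun t => cos t ^+ 2 * cos (x * cos t)) = x * J0 x - J1 x.
Proof.
have := @cavg_periodic_derive _ (fun t => sin t * sin (x * cos t))
  (fun t => cos t * sin (x * cos t) +
     (x * (cos t ^+ 2 * cos (x * cos t)) + - x * cos (x * cos t))).
move=> H; have {H} : cavg (fun t => cos t * sin (x * cos t) +
     (x * (cos t ^+ 2 * cos (x * cos t)) + - x * cos (x * cos t))) = 0.
  apply: H; [move=> t|by cont|by rewrite sin2pi sin0 !mul0r].
  apply: der_eq; first by der.
  have sE : sin t ^+ 2 = 1 - cos t ^+ 2 by rewrite -(cos2Dsin2 t); ring.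
  transitivity (cos t * sin (x * cos t) - x * cos (x * cos t) * sin t ^+ 2).
    by rewrite /=; ring.
  by rewrite sE; ring.
rewrite cavgD; [|by cont|by cont]; rewrite cavgD; [|by cont|by cont].
rewrite !cavgZ; [|by cont|by cont].
by rewrite -/(J1 x) -/(J0 x); lra.
Qed.

Lemma der_J1_pos x : 0 < x -> hder x J1 (J0 x - J1 x / x).
Proof.
move=> x0; apply: (der_eq (der_J1 x)).
have x0' : x != 0 by rewrite gt_eqF.
by apply: (mulfI x0'); rewrite bessel_ode; field.
Qed.

Lemma cont_J0 : continuous J0.
Proof. by move=> x; exact: der_continuous (der_J0 x). Qed.

Lemma J0_le1 x : `|J0 x| <= 1.
Proof.
rewrite ler_norml -(cavg_cst (-1 : R)) -[X in _ && (_ <= X)](cavg_cst (1:R)) /J0.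
by apply/andP; split; apply: cavg_le;
  (by cont || by move=> t; rewrite ?cos_geN1 ?cos_le1).
Qed.

Definition cos_moment n : R := cavg (fun t => cos t ^+ n).

(** Wallis' recurrence, from the derivative of [sin t * cos t ^ (n + 1)]. *)
Lemma cos_moment_rec n : n.+2%:R * cos_moment n.+2 = n.+1%:R * cos_moment n.
Proof.
have : cavg (fun t : R => n.+2%:R * cos t ^+ n.+2 + - n.+1%:R * cos t ^+ n) = 0.
  apply: (@cavg_periodic_derive _ (fun t => sin t * cos t ^+ n.+1)).
  - move=> t; apply: der_eq; first by der.
    rewrite /= !exprS -[n.+2%:R]natr1.
    have := cos2Dsin2 t => E.
    transitivity (cos t * (cos t * cos t ^+ n) - n.+1%:R * cos t ^+ n * sin t ^+ 2);
      first by ring.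
    have -> : sin t ^+ 2 = 1 - cos t ^+ 2 by rewrite -E; ring.
    by ring.
  - by cont.
  - by rewrite sin2pi sin0 !mul0r.
rewrite cavgD; [|by cont|by cont]; rewrite !cavgZ; [|by cont|by cont].
by rewrite mulNr => /eqP; rewrite subr_eq0 => /eqP.
Qed.

Lemma cos_momentE : [/\ cos_moment 2 = 1 / 2, cos_moment 4 = 3 / 8, cos_moment 6 = 5 / 16,
  cos_moment 8 = 35 / 128 & cos_moment 10 = 63 / 256].
Proof.
have c0 : cos_moment 0 = 1.
  by rewrite /cos_moment; under eq_cavg do rewrite expr0; rewrite cavg_cst.
have c2 : cos_moment 2 = 1 / 2 by have := cos_moment_rec 0; rewrite c0; lra.
have c4 : cos_moment 4 = 3 / 8 by have := cos_moment_rec 2; rewrite c2; lra.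
have c6 : cos_moment 6 = 5 / 16 by have := cos_moment_rec 4; rewrite c4; lra.
have c8 : cos_moment 8 = 35 / 128 by have := cos_moment_rec 6; rewrite c6; lra.
by have := cos_moment_rec 8; rewrite c8; split => //; lra.
Qed.

End bessel.

(** * Alternating Taylor bounds for sine, cosine and the Bessel functions *)

Lemma der_ge0_from0 (R : realType) (f df : R -> R) (z : R) : f 0 = 0 -> 0 <= z ->
  (forall w, hder w f (df w)) -> (forall w, 0 <= w -> 0 <= df w) -> 0 <= f z.
Proof.
move=> f0 z0 hf hd; rewrite -f0; apply: (@der_ndecr _ f df _ _ z0) => w.
  by move=> _; exact: hf.
by move=> /andP[w0 _]; exact: hd.
Qed.

(* Lifts the bound [prev] on a derivative to the function, which vanishes at 0. *)
Ltac taylor_step prev z z0 :=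
  lazymatch goal with |- is_true (0 <= ?e) =>
    lazymatch (eval pattern z in e) with ?f z =>
      lazymatch type of prev with forall w, _ -> is_true (0 <= @?df w) =>
        apply: (@der_ge0_from0 _ f df _ _ z0)
      end
    end
  end;
  [by rewrite ?(sin0, cos0, oppr0, expR0, expr0n)/=; ring
  |by move=> w; apply: der_eq; [by der|rewrite /=; field]
  |exact: prev].

Section taylor.
Variable R : realType.
Implicit Types x t z w y : R.

Lemma sin_taylor1 z : 0 <= z -> 0 <= z - sin z.
Proof.
move=> z0; apply: (@der_ge0_from0 _ (fun z => z - sin z) (fun z => 1 - cos z) _ _ z0).
- by rewrite sin0 subr0.
- by move=> w; apply: der_eq; [by der|rewrite /=; ring].
- by move=> w _; rewrite subr_ge0 cos_le1.
Qed.

Lemma cos_taylor2 z : 0 <= z -> 0 <= cos z - (1 - z ^+ 2 / 2).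
Proof. by move=> z0; taylor_step sin_taylor1 z z0. Qed.

Lemma sin_taylor3 z : 0 <= z -> 0 <= sin z - (z - z ^+ 3 / 6).
Proof. by move=> z0; taylor_step cos_taylor2 z z0. Qed.

Lemma cos_taylor4 z : 0 <= z -> 0 <= (1 - z ^+ 2 / 2 + z ^+ 4 / 24) - cos z.
Proof. by move=> z0; taylor_step sin_taylor3 z z0. Qed.

Lemma sin_taylor5 z : 0 <= z -> 0 <= (z - z ^+ 3 / 6 + z ^+ 5 / 120) - sin z.
Proof. by move=> z0; taylor_step cos_taylor4 z z0. Qed.

Lemma cos_taylor6 z : 0 <= z ->
  0 <= cos z - (1 - z ^+ 2 / 2 + z ^+ 4 / 24 - z ^+ 6 / 720).
Proof. by move=> z0; taylor_step sin_taylor5 z z0. Qed.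

Lemma sin_taylor7 z : 0 <= z ->
  0 <= sin z - (z - z ^+ 3 / 6 + z ^+ 5 / 120 - z ^+ 7 / (720 * 7)).
Proof. by move=> z0; taylor_step cos_taylor6 z z0. Qed.

Lemma cos_taylor8 z : 0 <= z ->
  0 <= (1 - z ^+ 2 / 2 + z ^+ 4 / 24 - z ^+ 6 / 720 + z ^+ 8 / (720 * 56)) - cos z.
Proof. by move=> z0; taylor_step sin_taylor7 z z0. Qed.

Lemma sin_taylor9 z : 0 <= z ->
  0 <= (z - z ^+ 3 / 6 + z ^+ 5 / 120 - z ^+ 7 / (720 * 7) + z ^+ 9 / (720 * 504)) - sin z.
Proof. by move=> z0; taylor_step cos_taylor8 z z0. Qed.

Lemma cos_taylor10 z : 0 <= z ->
  0 <= cos z - (1 - z ^+ 2 / 2 + z ^+ 4 / 24 - z ^+ 6 / 720 + z ^+ 8 / (720 * 56)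
                - z ^+ 10 / (720 * 504 * 10)).
Proof. by move=> z0; taylor_step sin_taylor9 z z0. Qed.

Lemma cavg_even_poly (a0 a1 a2 a3 a4 a5 : R) :
  cavg (fun t => a0 + (a1 * cos t ^+ 2 + (a2 * cos t ^+ 4 + (a3 * cos t ^+ 6 +
    (a4 * cos t ^+ 8 + a5 * cos t ^+ 10))))) =
  a0 + a1 / 2 + a2 * 3 / 8 + a3 * 5 / 16 + a4 * 35 / 128 + a5 * 63 / 256.
Proof.
have [c2 c4 c6 c8 c10] := cos_momentE R.
rewrite cavgD; [|by cont|by cont]; rewrite cavg_cst.
rewrite cavgD; [|by cont|by cont]; rewrite cavgZ; last by cont.
rewrite cavgD; [|by cont|by cont]; rewrite cavgZ; last by cont.
rewrite cavgD; [|by cont|by cont]; rewrite cavgZ; last by cont.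
rewrite cavgD; [|by cont|by cont]; rewrite cavgZ; last by cont.
rewrite cavgZ; last by cont.
move: c2 c4 c6 c8 c10; rewrite /cos_moment => -> -> -> -> ->.
by field.
Qed.

(** Partial sums of the power series of [J0] in [y = x ^ 2 / 4], with coefficients
    [(-1)^k / (k!)^2]. *)
Let P3 y : R := 1 - y + y ^+ 2 / 4 - y ^+ 3 / 36.
Let P4 y : R := P3 y + y ^+ 4 / 576.

(** The Taylor bound for the cosine at [x cos t], averaged: the mean of [cos^(2k)] is
    [(2k)! / (4^k (k!)^2)], which turns the cosine series into that of [J0]. Negative arguments
    follow by parity. *)
Lemma J0_ge3 x : P3 (x ^+ 2 / 4) <= J0 x.
Proof.
have <- : cavg (fun t : R => 1 + (- (x ^+ 2 / 2) * cos t ^+ 2 + (x ^+ 4 / 24 * cos t ^+ 4 +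
    (- (x ^+ 6 / 720) * cos t ^+ 6 + (0 * cos t ^+ 8 + 0 * cos t ^+ 10))))) =
    P3 (x ^+ 2 / 4).
  by rewrite cavg_even_poly /P3; field.
apply: cavg_le; [by cont|by cont|] => t; rewrite -subr_ge0.
set w := x * cos t.
have H : 0 <= cos w - (1 - w ^+ 2 / 2 + w ^+ 4 / 24 - w ^+ 6 / 720).
  have [w0|w0] := leP 0 w; first exact: cos_taylor6.
  have := @cos_taylor6 (- w); rewrite cosN; have -> : 0 <= - w by lra.
  by move/(_ isT); congr (_ <= _); ring.
by move: H; congr (_ <= _); rewrite /w; ring.
Qed.

Lemma J0_le4 x : J0 x <= P4 (x ^+ 2 / 4).
Proof.
have <- : cavg (fun t : R => 1 + (- (x ^+ 2 / 2) * cos t ^+ 2 + (x ^+ 4 / 24 * cos t ^+ 4 +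
    (- (x ^+ 6 / 720) * cos t ^+ 6 + (x ^+ 8 / (720 * 56) * cos t ^+ 8 + 0 * cos t ^+ 10))))) =
    P4 (x ^+ 2 / 4).
  by rewrite cavg_even_poly /P4 /P3; field.
apply: cavg_le; [by cont|by cont|] => t; rewrite -subr_ge0.
set w := x * cos t.
have H : 0 <= (1 - w ^+ 2 / 2 + w ^+ 4 / 24 - w ^+ 6 / 720 + w ^+ 8 / (720 * 56)) - cos w.
  have [w0|w0] := leP 0 w; first exact: cos_taylor8.
  have := @cos_taylor8 (- w); rewrite cosN; have -> : 0 <= - w by lra.
  by move/(_ isT); congr (_ <= _); ring.
by move: H; congr (_ <= _); rewrite /w; ring.
Qed.

Lemma J0_ge5 x : P4 (x ^+ 2 / 4) - (x ^+ 2 / 4) ^+ 5 / (144 * 100) <= J0 x.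
Proof.
have <- : cavg (fun t : R => 1 + (- (x ^+ 2 / 2) * cos t ^+ 2 + (x ^+ 4 / 24 * cos t ^+ 4 +
    (- (x ^+ 6 / 720) * cos t ^+ 6 + (x ^+ 8 / (720 * 56) * cos t ^+ 8 +
      - (x ^+ 10 / (720 * 504 * 10)) * cos t ^+ 10))))) =
    P4 (x ^+ 2 / 4) - (x ^+ 2 / 4) ^+ 5 / (144 * 100).
  by rewrite cavg_even_poly /P4 /P3; field.
apply: cavg_le; [by cont|by cont|] => t; rewrite -subr_ge0.
set w := x * cos t.
have H : 0 <= cos w - (1 - w ^+ 2 / 2 + w ^+ 4 / 24 - w ^+ 6 / 720 + w ^+ 8 / (720 * 56)
   - w ^+ 10 / (720 * 504 * 10)).
  have [w0|w0] := leP 0 w; first exact: cos_taylor10.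
  have := @cos_taylor10 (- w); rewrite cosN; have -> : 0 <= - w by lra.
  by move/(_ isT); congr (_ <= _); ring.
by move: H; congr (_ <= _); rewrite /w; ring.
Qed.

Lemma xJ1E x : x * J1 x = cavg (fun t => (x * cos t) * sin (x * cos t)).
Proof.
rewrite -cavgZ; last by cont.
by apply: eq_cavg => t; rewrite mulrA.
Qed.

(** Partial sum of the series of [x J1 / 2] in [y = x ^ 2 / 4], with coefficients
    [(-1)^k / (k! (k+1)!)] at [y^(k+1)]. *)
Let Q4 y : R := y - y ^+ 2 / 2 + y ^+ 3 / 12 - y ^+ 4 / 144.

(** The factor [x] makes the averaged function [w sin w] even in [w = x cos t]; for [w < 0] both
    factors change sign, so the Taylor bounds on the positive side suffice. *)
Lemma xJ1_ge x : 2 * Q4 (x ^+ 2 / 4) <= x * J1 x.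
Proof.
rewrite xJ1E.
have <- : cavg (fun t : R => 0 + ((x ^+ 2) * cos t ^+ 2 + (- (x ^+ 4 / 6) * cos t ^+ 4 +
    ((x ^+ 6 / 120) * cos t ^+ 6 + (- (x ^+ 8 / (720 * 7)) * cos t ^+ 8 + 0 * cos t ^+ 10))))) =
    2 * Q4 (x ^+ 2 / 4).
  by rewrite cavg_even_poly /Q4; field.
apply: cavg_le; [by cont|by cont|] => t; rewrite -subr_ge0.
set w := x * cos t.
have H : 0 <= w * (sin w - (w - w ^+ 3 / 6 + w ^+ 5 / 120 - w ^+ 7 / (720 * 7))).
  have [w0|w0] := leP 0 w; first by apply: mulr_ge0; [exact: w0|exact: sin_taylor7].
  rewrite -mulrNN; apply: mulr_ge0; first lra.
  have := @sin_taylor7 (- w); rewrite sinN; have -> : 0 <= - w by lra.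
  by move/(_ isT); congr (_ <= _); ring.
by move: H; congr (_ <= _); rewrite /w; ring.
Qed.

Lemma xJ1_le x : x * J1 x <= 2 * (Q4 (x ^+ 2 / 4) + (x ^+ 2 / 4) ^+ 5 / (144 * 20)).
Proof.
rewrite xJ1E.
have <- : cavg (fun t : R => 0 + ((x ^+ 2) * cos t ^+ 2 + (- (x ^+ 4 / 6) * cos t ^+ 4 +
    ((x ^+ 6 / 120) * cos t ^+ 6 + (- (x ^+ 8 / (720 * 7)) * cos t ^+ 8 +
     x ^+ 10 / (720 * 504) * cos t ^+ 10))))) =
    2 * (Q4 (x ^+ 2 / 4) + (x ^+ 2 / 4) ^+ 5 / (144 * 20)).
  by rewrite cavg_even_poly /Q4; field.
apply: cavg_le; [by cont|by cont|] => t; rewrite -subr_ge0.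
set w := x * cos t.
have H : 0 <= w * ((w - w ^+ 3 / 6 + w ^+ 5 / 120 - w ^+ 7 / (720 * 7) +
    w ^+ 9 / (720 * 504)) - sin w).
  have [w0|w0] := leP 0 w; first by apply: mulr_ge0; [exact: w0|exact: sin_taylor9].
  rewrite -mulrNN; apply: mulr_ge0; first lra.
  have := @sin_taylor9 (- w); rewrite sinN; have -> : 0 <= - w by lra.
  by move/(_ isT); congr (_ <= _); ring.
by move: H; congr (_ <= _); rewrite /w; ring.
Qed.

End taylor.

(** * Size and decay of the Bessel functions beyond [x0] *)

Section bessel_bounds.
Variable R : realType.
Implicit Types x t z w y : R.

(* Just below the first zero of [J0]; [x0 ^ 2 / 4 = 7 / 5]. *)
Definition x0 : R := Num.sqrt (28 / 5).

Lemma x0_gt0 : 0 < x0.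
Proof. by rewrite sqrtr_gt0; lra. Qed.

Lemma x0sq : x0 ^+ 2 = 28 / 5.
Proof. by rewrite sqr_sqrtr; lra. Qed.

Lemma x0_ge2 : 2 <= x0.
Proof.
have := x0sq; have := x0_gt0 => h0 h2; rewrite leNgt; apply/negP => h; nra.
Qed.

Lemma x0_ge73 : 7 / 3 <= x0.
Proof.
have := x0sq; have := x0_gt0 => h0 h2; rewrite leNgt; apply/negP => h; nra.
Qed.

Lemma J0_x0 : 1 / 80 <= J0 x0 <= 1 / 45.
Proof.
have := @J0_ge3 _ x0; have := @J0_le4 _ x0; rewrite x0sq => h1 h2.
apply/andP; split; [apply: le_trans h2|apply: (le_trans h1)]; lra.
Qed.

Lemma J1_x0 : 31 / 25 <= x0 * J1 x0 <= 5 / 4.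
Proof.
have := @xJ1_ge _ x0; have := @xJ1_le _ x0; rewrite x0sq => h1 h2.
apply/andP; split; [apply: le_trans h2|apply: (le_trans h1)]; lra.
Qed.

(* A decreasing functional (by the Bessel equation), which forces
   [J0 ^ 2 + J1 ^ 2 = O(1 / x)]. *)
Definition energy x : R :=
  x * (J0 x ^+ 2 + J1 x ^+ 2) - J0 x * J1 x + J0 x ^+ 2 / (2 * x).

Lemma der_energy x : 0 < x -> hder x energy (- (J0 x ^+ 2 / (2 * x ^+ 2))).
Proof.
move=> xp; have xn : x != 0 by rewrite gt_eqF.
have h0 := der_J0 x; have h1 := der_J1_pos xp.
have hV : hder x (fun y => (2 * y)^-1) (- 2 / (2 * x) ^+ 2).
  apply: (@derV _ _ (fun y => 2 * y)); first by rewrite mulf_neq0 // pnatr_eq0.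
  by apply: der_eq; [by der|rewrite /=; ring].
by apply: der_eq; [rewrite /energy; der|rewrite /=; field].
Qed.

Lemma energy_x0 : energy x0 <= 2 / 3.
Proof.
have /andP[a1 a2] := J0_x0; have /andP[b1 b2] := J1_x0.
have x0p := x0_gt0; have xl := x0_ge73; have sq := x0sq.
(* Multiplied by [x0], everything is expressed through [x0 ^ 2 = 28 / 5], [J0 x0] and [x0 * J1 x0],
   which have rational bounds; the [x0] left on the other side is at least [7 / 3]. *)
have E : x0 * energy x0 = x0 ^+ 2 * J0 x0 ^+ 2 + (x0 * J1 x0) ^+ 2
    - J0 x0 * (x0 * J1 x0) + J0 x0 ^+ 2 / 2.
  by rewrite /energy; field; rewrite gt_eqF.
rewrite -(ler_pM2l x0p) E sq; move: (J0 x0) (x0 * J1 x0) a1 a2 b1 b2 => a b.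
move: (x0) xl => u xl a1 a2 b1 b2 {E sq x0p}.
have aa : a * a <= a * (1 / 45) by apply: ler_wpM2l; lra.
have bb : b * b <= 5 / 4 * (5 / 4) by apply: ler_pM; lra.
have ab : 1 / 80 * (6 / 5) <= a * b by apply: ler_pM; lra.
have uu : 7 / 3 * (2 / 3) <= u * (2 / 3) by apply: ler_wpM2r; lra.
by apply: le_trans uu; rewrite !expr2; lra.
Qed.

Lemma energy_le x : x0 <= x -> energy x <= 2 / 3.
Proof.
move=> hx; apply: le_trans energy_x0.
apply: (@der_nincr _ energy (fun x => - (J0 x ^+ 2 / (2 * x ^+ 2))) _ _ hx).
  move=> y /andP[hy _]; apply: der_energy; exact: lt_le_trans x0_gt0 hy.
move=> y _; rewrite oppr_le0; apply: divr_ge0; first exact: sqr_ge0.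
by apply: mulr_ge0 => //; exact: sqr_ge0.
Qed.

Lemma J0J1_decay x : x0 <= x -> J0 x ^+ 2 + J1 x ^+ 2 <= 2 / x.
Proof.
move=> hx; have hE := energy_le hx.
have x2 : 2 <= x by exact: le_trans x0_ge2 hx.
have xp : 0 < x by lra.
rewrite ler_pdivlMr//.
have : 0 <= J0 x ^+ 2 / (2 * x) by rewrite divr_ge0 ?sqr_ge0//; lra.
move: hE; rewrite /energy; set a := J0 x; set b := J1 x; set c := _ / (2 * x) => hE hc.
have ab : a * b <= (a ^+ 2 + b ^+ 2) / 2 by have := sqr_ge0 (a - b); nra.
have s0 : 0 <= a ^+ 2 + b ^+ 2 by apply: addr_ge0; exact: sqr_ge0.
have h2 : 2 * (a ^+ 2 + b ^+ 2) <= x * (a ^+ 2 + b ^+ 2) by apply: ler_wpM2r.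
by rewrite [_ * x]mulrC; lra.
Qed.

(** The largest value is about 0.403, at the first minimum of [J0], near 3.83. Polynomial bounds
    cover [x < 4]; for [x >= 4] the energy gives [x J0 ^ 2 <= 2 / 3], hence [|J0| <= sqrt (1 / 6)],
    about 0.408. *)
Lemma J0_le_m x : x0 <= x -> `|J0 x| <= 21 / 50.
Proof.
move=> hx; have x2 : 2 <= x by exact: le_trans x0_ge2 hx.
have xp : 0 < x by lra.
have [x4|x4] := leP 4 x.
  rewrite -(@ler_pXn2r _ 2) ?nnegrE//.
  rewrite real_normK ?num_real//.
  have hE := energy_le hx; rewrite -(ler_pM2l xp).
  have h : 0 <= J0 x ^+ 2 / (2 * x) by rewrite divr_ge0 ?sqr_ge0//; lra.
  move: hE; rewrite /energy; move: h; set c := _ / (2 * x) => h hE.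
  have Ec : c * (2 * x) = J0 x ^+ 2 by rewrite /c mulfVK// mulf_neq0 ?pnatr_eq0 ?gt_eqF.
  set a := J0 x in Ec hE *; set b := J1 x in hE *.
  (* AM-GM: [a b <= x b ^ 2 + a ^ 2 / (4 x)] *)
  have sq : 0 <= x * b ^+ 2 - a * b + c / 2.
    have : 0 <= x * (x * b ^+ 2 - a * b + c / 2).
      have -> : x * (x * b ^+ 2 - a * b + c / 2) = (x * b - a / 2) ^+ 2.
        by rewrite !mulrDr (_ : x * (c / 2) = c * (2 * x) / 4); [rewrite Ec; field|field].
      exact: sqr_ge0.
    by rewrite pmulr_rge0.
  have : x * a ^+ 2 <= 2 / 3 by lra.
  have : 4 * (21 / 50) ^+ 2 <= x * (21 / 50) ^+ 2 :> R by nra.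
  by lra.
set y := x ^+ 2 / 4.
have y1 : 7 / 5 <= y.
  have := x0sq; have := x0_gt0 => h0 h2; rewrite /y; nra.
have y2 : y <= 4 by rewrite /y; nra.
have := @J0_ge5 _ x; have := @J0_le4 _ x; rewrite -/y => h1 h2.
rewrite ler_norml; apply/andP; split.
  apply: le_trans h2.
  (* Certificates for the linear arithmetic: the value [37 / 10] is close to the minimiser of the
     quintic lower bound for [J0]. *)
  have t1 : 0 <= (y - 37 / 10) ^+ 2 * (4 - y) by apply: mulr_ge0; [exact: sqr_ge0|lra].
  have t2 : 0 <= ((y - 37 / 10) ^+ 2) ^+ 2 by exact: sqr_ge0.
  have t3 : 0 <= (y - 37 / 10 + 1 / 20) ^+ 2 by exact: sqr_ge0.
  have t4 : 0 <= y ^+ 4 * (4 - y) by apply: mulr_ge0; [apply: exprn_ge0|]; lra.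
  by lra.
apply: (le_trans h1).
have t1 : 0 <= (y - 5 / 2) ^+ 2 * (y + 5) by apply: mulr_ge0; [exact: sqr_ge0|lra].
have t2 : 0 <= (y - 7 / 5) * (4 - y) by apply: mulr_ge0; lra.
have t3 : 0 <= y ^+ 3 * (4 - y) by apply: mulr_ge0; [apply: exprn_ge0|]; lra.
by lra.
Qed.

(* [(J0 ^ 2 + J1 ^ 2) / 2] with corrections making the derivative
   [- J0 ^ 2 / x + O(J0 ^ 2 / x ^ 5)]. *)
Definition tail_energy x : R :=
  J0 x ^+ 2 * (1 / 2 + 2 / 3 / x ^+ 2 - 8 / 3 / x ^+ 4) +
  J1 x ^+ 2 * (1 / 2 - 1 / 3 / x ^+ 2) - J0 x * J1 x * (1 / x - 4 / 3 / x ^+ 3).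

Lemma der_invX x n : x != 0 -> hder x (fun y => (y ^+ n)^-1) (- (n%:R * x ^+ n.-1) / (x ^+ n) ^+ 2).
Proof.
move=> xn; apply: (@derV _ _ (fun y => y ^+ n)); first by rewrite expf_neq0.
by apply: der_eq; [der|rewrite /=; ring].
Qed.

Lemma der_tail_energy x : 0 < x ->
  hder x tail_energy (- (J0 x ^+ 2 / x) + 32 / 3 * J0 x ^+ 2 / x ^+ 5).
Proof.
move=> xp; have xn : x != 0 by rewrite gt_eqF.
have h0 := der_J0 x; have h1 := der_J1_pos xp.
have h2 := der_invX 2 xn; have h3 := der_invX 3 xn; have h4 := der_invX 4 xn.
have h : hder x (fun y => y^-1) (- 1 / x ^+ 2).
  by apply: derV => //; exact: der_id.
by apply: der_eq; [rewrite /tail_energy; der|rewrite /=; field].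
Qed.

(** A quadratic form in [J0] and [J1] with coefficients in [1 / x], shown nonnegative by its
    discriminant. The coefficient [9 / 20] is split off because [9 / 20 * lamA >= 1 / 4] will absorb
    a term [q / 4 * J0 ^ 2]. *)
Lemma tail_energy_ge x : x0 <= x -> 9 / 20 * J0 x ^+ 2 <= tail_energy x.
Proof.
move=> hx; have xp : 0 < x by exact: lt_le_trans x0_gt0 hx.
have xn : x != 0 by rewrite gt_eqF.
pose r := x^-1.
have r0 : 0 < r by rewrite invr_gt0.
have r2 : r ^+ 2 <= 5 / 28.
  have x2 : 28 / 5 <= x ^+ 2.
    by rewrite -x0sq; apply: lerXn2r => //; rewrite nnegrE ltW ?x0_gt0.
  have e : r ^+ 2 * x ^+ 2 = 1 by rewrite -exprMn /r mulVf ?expr1n.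
  have : r ^+ 2 * (28 / 5) <= r ^+ 2 * x ^+ 2 by apply: ler_wpM2l => //; exact: sqr_ge0.
  by rewrite e; lra.
rewrite -subr_ge0.
have -> : tail_energy x - 9 / 20 * J0 x ^+ 2 =
    J0 x ^+ 2 * (1 / 20 + 2 / 3 * r ^+ 2 - 8 / 3 * r ^+ 4) +
    J1 x ^+ 2 * (1 / 2 - 1 / 3 * r ^+ 2) - J0 x * J1 x * (r - 4 / 3 * r ^+ 3).
  by rewrite /tail_energy /r; field.
move: (J0 x) (J1 x) r r0 r2 => a b {x hx xp xn} r r0 r2.
set A := 1 / 20 + _ - _; set B := 1 / 2 - _; set C := r - _.
have v0 : 0 <= r ^+ 2 by exact: sqr_ge0.
have B0 : 0 < B by rewrite /B; lra.
have D : C ^+ 2 <= 4 * A * B.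
  rewrite -subr_ge0.
  have -> : 4 * A * B - C ^+ 2 = 1 / 10 + 4 / 15 * r ^+ 2 - 32 / 9 * (r ^+ 2) ^+ 2 +
     16 / 9 * (r ^+ 2) ^+ 3 by rewrite /A /B /C; field.
  move: (r ^+ 2) v0 r2 => v v0 v1.
  have : v * v <= v * (5 / 28) by apply: ler_wpM2l.
  have : 0 <= v ^+ 3 by exact: exprn_ge0.
  by rewrite expr2; lra.
have : 0 <= (a ^+ 2 * A + b ^+ 2 * B - a * b * C) * (4 * B).
  have -> : (a ^+ 2 * A + b ^+ 2 * B - a * b * C) * (4 * B) =
    (2 * B * b - C * a) ^+ 2 + a ^+ 2 * (4 * A * B - C ^+ 2) by ring.
  by rewrite addr_ge0 ?sqr_ge0// mulr_ge0 ?sqr_ge0// subr_ge0.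
by rewrite pmulr_lge0//; lra.
Qed.

Lemma tail_energy_x0 : 7 / 60 <= tail_energy x0.
Proof.
have xn : x0 != 0 by rewrite gt_eqF// x0_gt0.
have /andP[a1 a2] := J0_x0; have /andP[b1 b2] := J1_x0.
have -> : tail_energy x0 = J0 x0 ^+ 2 * (1 / 2 + 2 / 3 / x0 ^+ 2 - 8 / 3 / (x0 ^+ 2) ^+ 2) +
  (x0 * J1 x0) ^+ 2 / x0 ^+ 2 * (1 / 2 - 1 / 3 / x0 ^+ 2) -
  J0 x0 * (x0 * J1 x0) * (1 / x0 ^+ 2 - 4 / 3 / (x0 ^+ 2) ^+ 2).
  by rewrite /tail_energy; field.
rewrite x0sq; move: (J0 x0) (x0 * J1 x0) a1 a2 b1 b2 => a b a1 a2 b1 b2.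
have aa : 0 <= a * a by apply: mulr_ge0; lra.
have bb : 31 / 25 * (31 / 25) <= b * b by apply: ler_pM; lra.
have ab : a * b <= 1 / 45 * (5 / 4) by apply: ler_pM; lra.
by rewrite !expr2; lra.
Qed.

(** Only the order [1 / x] matters: since [q < 1], it makes the boundary term
    [tail_energy x * x ^ q] vanish at infinity. *)
Lemma tail_energy_decay x : x0 <= x -> `|tail_energy x| <= 12 / x.
Proof.
move=> hx; have hd := J0J1_decay hx.
have x2 : 2 <= x by exact: le_trans x0_ge2 hx.
have xn : x != 0 by rewrite gt_eqF//; lra.
pose r := x^-1.
have r0 : 0 < r by rewrite invr_gt0; lra.
have r1 : r <= 1 / 2.
  have e : r * x = 1 by rewrite /r mulVf.
  have : r * 2 <= r * x by apply: ler_wpM2l => //; exact: ltW.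
  by rewrite e; lra.
have -> : 12 / x = 6 * (2 / x) by field.
apply: (@le_trans _ _ (6 * (J0 x ^+ 2 + J1 x ^+ 2))); last by apply: ler_wpM2l.
have -> : tail_energy x = J0 x ^+ 2 * (1 / 2 + 2 / 3 * r ^+ 2 - 8 / 3 * r ^+ 4) +
    J1 x ^+ 2 * (1 / 2 - 1 / 3 * r ^+ 2) - J0 x * J1 x * (r - 4 / 3 * r ^+ 3).
  by rewrite /tail_energy /r; field.
move: (J0 x) (J1 x) r r0 r1 => a b {x hx hd x2 xn} r r0 r1.
set A := 1 / 2 + _ - _; set B := 1 / 2 - _; set C := r - _.
have q20 : 0 <= r ^+ 2 by exact: sqr_ge0.
have q2 : r ^+ 2 <= 1 / 4.
  have h : r * r <= 1 / 2 * (1 / 2) by apply: ler_pM; lra.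
  by rewrite expr2; lra.
have q30 : 0 <= r ^+ 3 by apply: exprn_ge0; lra.
have q31 : r ^+ 3 <= 1 / 8.
  have : r * r ^+ 2 <= 1 / 2 * (1 / 4) by apply: ler_pM; lra.
  by rewrite -exprS; lra.
have q40 : 0 <= r ^+ 4 by apply: exprn_ge0; lra.
have q41 : r ^+ 4 <= 1 / 16.
  have : r ^+ 2 * r ^+ 2 <= 1 / 4 * (1 / 4) by apply: ler_pM; lra.
  by rewrite -exprD; lra.
have hA : `|A| <= 2 by rewrite ler_norml /A; lra.
have hB : `|B| <= 2 by rewrite ler_norml /B; lra.
have hC : `|C| <= 2 by rewrite ler_norml /C; lra.
have ab : `|a * b| <= a ^+ 2 + b ^+ 2.
  have := sqr_ge0 (a - b); have := sqr_ge0 (a + b); rewrite !expr2 => h1 h2.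
  have := sqr_ge0 a; have := sqr_ge0 b; rewrite !expr2 => h3 h4.
  by rewrite ler_norml; lra.
apply: (le_trans (ler_normB _ _)).
apply: (@le_trans _ _ (a ^+ 2 * 2 + b ^+ 2 * 2 + (a ^+ 2 + b ^+ 2) * 2)); last first.
  by have h1 := sqr_ge0 a; have h2 := sqr_ge0 b; lra.
apply: lerD.
  apply: (le_trans (ler_normD _ _)); apply: lerD.
    by rewrite normrM (ger0_norm (sqr_ge0 a)) ler_wpM2l ?sqr_ge0.
  by rewrite normrM (ger0_norm (sqr_ge0 b)) ler_wpM2l ?sqr_ge0.
by rewrite normrM ler_pM.
Qed.

End bessel_bounds.

(** * Integrals of powers of the Bessel function *)

Section half_line.
Variable R : realType.
Implicit Types (u v h H : R -> R) (a b x y e : R).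
Notation mu := (@lebesgue_measure R).

Definition hline v : \bar R := (\int[mu]_(x in `]0%R, +oo[) (v x)%:E)%E.

Lemma hline_le (v : R -> R) (C : \bar R) : measurable_fun setT v ->
  (forall x, 0 < x -> 0 <= v x) ->
  (forall a b, 0 < a -> a < b -> (\int[mu]_(x in `[a, b]) (v x)%:E <= C)%E) ->
  (hline v <= C)%E.
Proof.
move=> mv v0 H.
(* With [n.+2] the endpoints satisfy [1 / (n + 2) < 1 < n + 2] already for [n = 0], as the strict
   inequality in the hypothesis demands. *)
pose F (n : nat) : set R := `[n.+2%:R^-1, n.+2%:R]%classic.
have FE : \bigcup_n F n = `]0, +oo[%classic :> set R.
  apply/seteqP; split => x /=.
    move=> [n _]; rewrite /F /= !in_itv/= => /andP[nx _].
    by rewrite andbT (lt_le_trans _ nx) // invr_gt0.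
  rewrite in_itv/= andbT => x0.
  pose n := maxn (Num.bound x) (Num.bound x^-1).
  exists n => //; rewrite /F /= in_itv/=; apply/andP; split.
    rewrite -[leRHS]invrK lef_pV2 ?posrE ?invr_gt0//.
    apply: ltW; apply: (@lt_le_trans _ _ (Num.bound x^-1)%:R).
      by have := archi_boundP (ltW (eqbRL (invr_gt0 x) x0)).
    by rewrite ler_nat (leq_trans (leq_maxr (Num.bound x) _))// -addn2 leq_addr.
  apply: ltW; apply: (@lt_le_trans _ _ (Num.bound x)%:R).
    exact: archi_boundP (ltW x0).
  by rewrite ler_nat (leq_trans (leq_maxl _ (Num.bound x^-1)))// -addn2 leq_addr.
have cvgF : (\int[mu]_(x in F i) (v x)%:E @[i --> \oo] --> hline v)%E.
  rewrite /hline -FE; apply: ge0_nondecreasing_set_cvg_integral => //.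
  - move=> m n mn; rewrite subsetEset /F; apply: subset_itv; rewrite bnd_simp.
      by rewrite lef_pV2 ?posrE// ler_nat.
    by rewrite ler_nat.
  - by move=> i; exact: measurable_itv.
  - by move=> i; apply/measurable_EFinP; exact: measurable_funTS.
  - move=> i x; rewrite /F /= in_itv/= => /andP[ix _]; rewrite lee_fin v0//.
    by rewrite (lt_le_trans _ ix)// invr_gt0.
rewrite -(cvg_lim _ cvgF)//; apply: lime_le; first by apply/cvg_ex; exists (hline v).
apply: nearW => n; apply: H; first by rewrite invr_gt0.
by rewrite (@lt_trans _ _ 1)// ?invf_lt1// ?ltr1n.
Qed.

Lemma seg_integrable v a b : (forall x, a <= x <= b -> {for x, continuous v}) ->
  mu.-integrable `[a, b] (EFin \o v).
Proof.
move=> cv; apply: continuous_compact_integrable; first exact: segment_compact.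
apply: continuous_in_subspaceT => x /[!inE]/= /[!in_itv]/= xab; exact: cv.
Qed.

Lemma seg_compare u v h H a b : a < b ->
  (forall x, a <= x <= b -> {for x, continuous u}) ->
  (forall x, a <= x <= b -> {for x, continuous v}) ->
  (forall x, a <= x <= b -> {for x, continuous h}) ->
  (forall x, a <= x <= b -> hder x H (h x)) ->
  (forall x, a <= x <= b -> v x + h x <= u x) ->
  (\int[mu]_(x in `[a, b]) (v x)%:E + (H b - H a)%:E <=
   \int[mu]_(x in `[a, b]) (u x)%:E)%E.
Proof.
move=> ab cu cv ch dH vhu.
have ftc : (\int[mu]_(x in `[a, b]) (h x)%:E = (H b - H a)%:E)%E.
  have cH x : a <= x <= b -> {for x, continuous H}.
    by move=> xab; exact: der_continuous (dH x xab).
  rewrite (@continuous_FTC2 _ h H _ _ ab) ?EFinB//.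
  - apply: continuous_in_subspaceT => x /[!inE]/= /[!in_itv]/= xab; exact: ch.
  - split.
    + move=> x /[!in_itv]/= /andP[ax xb].
      by have : hder x H (h x) by [apply: dH; rewrite !ltW]; case.
    + by apply/cvg_at_right_filter/cH; rewrite lexx ltW.
    + by apply/cvg_at_left_filter/cH; rewrite lexx ltW.
  - move=> x /[!in_itv]/= /andP[ax xb]; rewrite derive1E.
    by have : hder x H (h x) by [apply: dH; rewrite !ltW]; case.
rewrite -ftc -integralD//; [|exact: seg_integrable..].
apply: le_integral => //.
- by apply: integrableD => //; exact: seg_integrable.
- exact: seg_integrable.
- by move=> x /[!inE]/= /[!in_itv]/= xab; rewrite lee_fin; exact: vhu.
Qed.

Lemma integral_itv_cat (f : R -> \bar R) a b c : measurable_fun setT f ->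
  (forall x, a <= x <= c -> (0 <= f x)%E) -> a <= b -> b <= c ->
  (\int[mu]_(x in `[a, c]) f x =
   \int[mu]_(x in `[a, b]) f x + \int[mu]_(x in `[b, c]) f x)%E.
Proof.
move=> mf f0 ab bc; rewrite -[X in (_ + X)%E]integral_itv_obnd_cbnd; last exact: measurable_funTS.
have itvE : `[a, c]%classic = `[a, b] `|` `]b, c] :> set R.
  apply/seteqP; split => x /=; rewrite !in_itv/=.
    by move=> /andP[-> ->]; rewrite andbT; case: (leP x b) => h; by [left|right].
  move=> [/andP[-> xb]|/andP[bx ->]]; first by rewrite (le_trans xb).
  by rewrite (le_trans ab)// ltW.
rewrite -ge0_integral_setU//=.
- by rewrite itvE.
- exact: measurable_funTS.
- move=> x h; apply: f0; have : `[a, c]%classic x by rewrite itvE.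
  by rewrite /= in_itv.
- apply/disj_setPS => x [/=]; rewrite !in_itv/= => /andP[_ xc] /andP[cx _].
  by move: (le_lt_trans xc cx); rewrite ltxx.
Qed.

(* The antiderivatives H1, H2 carry the difference of the two integrands on
   (0, c] and [c, +oo); only their boundary values matter. *)
Lemma hline_compare u v v1 v2 h1 H1 h2 H2 (c l1 l2 : R) : 0 < c ->
  measurable_fun setT u -> measurable_fun setT v ->
  (forall x, 0 < x -> 0 <= u x) -> (forall x, 0 < x -> 0 <= v x) ->
  (forall x, 0 < x -> {for x, continuous u}) ->
  (forall x, 0 < x -> {for x, continuous v1}) ->
  (forall x, 0 < x -> {for x, continuous v2}) ->
  (forall x, 0 < x <= c -> v x = v1 x) -> (forall x, c < x -> v x = v2 x) ->
  (forall x, 0 < x -> {for x, continuous h1}) ->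
  (forall x, 0 < x -> {for x, continuous h2}) ->
  (forall x, 0 < x <= c -> hder x H1 (h1 x)) ->
  (forall x, c <= x -> hder x H2 (h2 x)) ->
  (forall x, 0 < x <= c -> v1 x + h1 x <= u x) ->
  (forall x, c <= x -> v2 x + h2 x <= u x) ->
  (forall e, 0 < e -> exists2 x1, 0 < x1 & forall x, 0 < x <= x1 -> H1 x <= l1 + e) ->
  (forall e, 0 < e -> exists x1, forall x, x1 <= x -> l2 - e <= H2 x) ->
  0 <= (H1 c - l1) + (l2 - H2 c) ->
  (hline v <= hline u)%E.
Proof.
move=> c0 mu_ mv u0 v0 cu cv1 cv2 vv1 vv2 ch1 ch2 dH1 dH2 vu1 vu2 lim1 lim2 H0.
apply: hline_le => // a b a0 ab.
apply/lee_addgt0Pr => e e0.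
have e2 : 0 < e / 2 by rewrite divr_gt0.
have [x1 x10 hx1] := lim1 _ e2; have [x2 hx2] := lim2 _ e2.
(* The segment is enlarged, which is allowed as [v] is nonnegative, until it contains [c] in its
   interior and both boundary terms are within [e / 2] of their limits. *)
pose a' := Num.min (Num.min a x1) (c / 2); pose b' := Num.max (Num.max b x2) (c + 1).
have a'0 : 0 < a' by rewrite /a' !lt_min a0 x10 divr_gt0.
have a'c : a' < c by rewrite /a' !gt_min; apply/orP; right; lra.
have cb' : c < b' by rewrite /b' !lt_max; apply/orP; right; lra.
have a'a : a' <= a by rewrite /a' !ge_min lexx.
have bb' : b <= b' by rewrite /b' !le_max lexx.
have a'x1 : a' <= x1 by rewrite /a' !ge_min lexx orbT.
have x2b' : x2 <= b' by rewrite /b' !le_max lexx orbT.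
have split (f : R -> R) : measurable_fun setT f -> (forall x, 0 < x -> 0 <= f x) ->
  (\int[mu]_(x in `[a', b']) (f x)%:E =
   \int[mu]_(x in `[a', c]) (f x)%:E + \int[mu]_(x in `[c, b']) (f x)%:E)%E.
  move=> mf f0; apply: integral_itv_cat (ltW a'c) (ltW cb').
    exact/measurable_EFinP.
  by move=> x /andP[ax _]; rewrite lee_fin f0// (lt_le_trans a'0).
apply: (@le_trans _ _ (\int[mu]_(x in `[a', b']) (v x)%:E))%E.
  apply: ge0_subset_integral => //.
  - by apply/measurable_EFinP; exact: measurable_funTS.
  - move=> x /=; rewrite in_itv/= lee_fin => /andP[ax _]; apply: v0.
    exact: lt_le_trans ax.
  - by apply: subset_itv; rewrite bnd_simp.
have pos1 x : a' <= x <= c -> 0 < x.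
  by move=> /andP[ax _]; exact: lt_le_trans ax.
have pos2 x : c <= x <= b' -> 0 < x.
  by move=> /andP[cx _]; exact: lt_le_trans cx.
have s1 := @seg_compare u v1 h1 H1 a' c a'c
  (fun x xab => cu x (pos1 x xab))
  (fun x xab => cv1 x (pos1 x xab))
  (fun x xab => ch1 x (pos1 x xab)).
have s2 := @seg_compare u v2 h2 H2 c b' cb'
  (fun x xab => cu x (pos2 x xab))
  (fun x xab => cv2 x (pos2 x xab))
  (fun x xab => ch2 x (pos2 x xab)).
have {}s1 : (\int[mu]_(x in `[a', c]) (v1 x)%:E + (H1 c - H1 a')%:E <=
   \int[mu]_(x in `[a', c]) (u x)%:E)%E.
  apply: s1 => x /andP[ax xc].
    by apply: dH1; rewrite xc (lt_le_trans a'0 ax).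
  by apply: vu1; rewrite xc (lt_le_trans a'0 ax).
have {}s2 : (\int[mu]_(x in `[c, b']) (v2 x)%:E + (H2 b' - H2 c)%:E <=
   \int[mu]_(x in `[c, b']) (u x)%:E)%E.
  by apply: s2 => x /andP[cx _]; [exact: dH2|exact: vu2].
have s3 : (\int[mu]_(x in `[a', b']) (u x)%:E <= hline u)%E.
  apply: ge0_subset_integral => //.
  - by apply/measurable_EFinP; exact: measurable_funTS.
  - by move=> x /=; rewrite in_itv/= andbT lee_fin => x0; exact: u0.
  - by apply: subset_itv; rewrite bnd_simp// ltW.
have f1 : (\int[mu]_(x in `[a', c]) (v1 x)%:E)%E \is a fin_num.
  apply: integrable_fin_num => //; apply: seg_integrable => x /pos1; exact: cv1.
have f2 : (\int[mu]_(x in `[c, b']) (v2 x)%:E)%E \is a fin_num.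
  apply: integrable_fin_num => //; apply: seg_integrable => x /pos2; exact: cv2.
have e1 : (\int[mu]_(x in `[a', c]) (v x)%:E = \int[mu]_(x in `[a', c]) (v1 x)%:E)%E.
  apply: eq_integral => x /[!inE]/= /[!in_itv]/= /andP[ax xc].
  by rewrite vv1// xc (lt_le_trans a'0 ax).
have e2' : (\int[mu]_(x in `[c, b']) (v x)%:E = \int[mu]_(x in `[c, b']) (v2 x)%:E)%E.
  (* At [c] the value of [v] is that of [v1], not of [v2]; the point is removed from the segment. *)
  rewrite -[LHS]integral_itv_obnd_cbnd; last first.
    by apply/measurable_EFinP; exact: measurable_funTS.
  rewrite -[RHS]integral_itv_obnd_cbnd; last first.
    have /integrableP[+ _] : mu.-integrable `[c, b'] (EFin \o v2).
      by apply: seg_integrable => x /pos2; exact: cv2.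
    apply: measurable_funS => //; exact: subset_itv_oc_cc.
  apply: eq_integral => x /[!inE]/= /[!in_itv]/= /andP[cx xb].
  by rewrite vv2.
have := hx1 a' _; rewrite a'0 a'x1 => /(_ isT) h1a.
have h2b := hx2 b' x2b'.
rewrite (split v)//.
apply: (@le_trans _ _ (\int[mu]_(x in `[a', b']) (u x)%:E + e%:E))%E; last exact: leeD2r.
rewrite (split u)//.
apply: le_trans (leeD2r _ (leeD s1 s2)).
rewrite e1 e2' -(fineK f1) -(fineK f2) -!EFinD lee_fin.
by lra.
Qed.

End half_line.

(** * The integral inequality for exponents near 2 *)

Section bessel_integrals.
Variable R : realType.
Variable q : R.
Hypothesis q0 : 0 < q.
Hypothesis q1 : q < 1.
Implicit Types (x y z u s : R).
Local Notation x0 := (x0 R).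

Definition wt x : R := x `^ (q - 1).

Lemma wt_ge0 x : 0 <= wt x.
Proof. exact: powR_ge0. Qed.

Lemma xwt x : 0 < x -> x * wt x = x `^ q.
Proof. by move=> x_gt0; rewrite /wt mulr_powRB1// ltW. Qed.

Lemma measurable_wt : measurable_fun setT wt.
Proof. exact: measurable_powR. Qed.

Lemma cont_wt x : 0 < x -> {for x, continuous wt}.
Proof.
by move=> x_gt0; apply: (der_continuous (der_powR (q - 1) x_gt0 (der_id x))).
Qed.

Lemma cont_powR_pos (a x : R) : 0 < x -> {for x, continuous (fun y => y `^ a)}.
Proof.
by move=> x_gt0; apply: (der_continuous (der_powR a x_gt0 (der_id x))).
Qed.

Lemma der_xq x : 0 < x -> hder x (fun y => y `^ q) (q * wt x).
Proof.
by move=> xp; apply: (der_eq (der_powR q xp (der_id x))); rewrite mulr1.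
Qed.

Lemma cont_mul_at (f g : R -> R) x : {for x, continuous f} ->
  {for x, continuous g} -> {for x, continuous (fun y => f y * g y)}.
Proof. by move=> cf cg; exact: (cvgM cf cg). Qed.

Lemma cont_add_at (f g : R -> R) x : {for x, continuous f} ->
  {for x, continuous g} -> {for x, continuous (fun y => f y + g y)}.
Proof. by move=> cf cg; exact: (cvgD cf cg). Qed.

(* [1 - t * pl (1 - z)] bounds [z ^ t] from above for [0 <= t <= 3 / 4]. *)
Definition pl u : R := u + u ^+ 2 / 8.

Definition P3 y : R := 1 - y + y ^+ 2 / 4 - y ^+ 3 / 36.

Lemma J0_taylor x : exists e, [/\ J0 x = P3 (x ^+ 2 / 4) + e, 0 <= e &
  e <= (x ^+ 2 / 4) ^+ 4 / 576].
Proof.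
exists (J0 x - P3 (x ^+ 2 / 4)); have := J0_ge3 x; have := J0_le4 x.
rewrite -/(P3 _) => h1 h2; split; lra.
Qed.

Lemma y_range x : 0 < x <= x0 -> 0 <= x ^+ 2 / 4 <= 7 / 5.
Proof.
move=> /andP[xp xc].
have : x ^+ 2 <= 28 / 5.
  by rewrite -(x0sq R); apply: lerXn2r => //; rewrite nnegrE ltW// ?x0_gt0.
have := sqr_ge0 x => h1 h2; apply/andP; split; lra.
Qed.

Lemma P3_range y : 0 <= y <= 7 / 5 -> 1 / 100 <= P3 y <= 1.
Proof.
move=> /andP[y0 y1]; rewrite /P3.
have h1 : 0 <= (7 / 5 - y) * y by apply: mulr_ge0; lra.
have h2 : 0 <= (7 / 5 - y) * y ^+ 2.
  by apply: mulr_ge0; [lra|exact: sqr_ge0].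
have h3 : 0 <= (7 / 5 - y) ^+ 2 by exact: sqr_ge0.
have h4 : 0 <= y ^+ 3 by exact: exprn_ge0.
by apply/andP; split; lra.
Qed.

Lemma J0_range x : 0 < x <= x0 -> 0 < J0 x <= 1.
Proof.
move=> hx; have := J0_ge3 x; rewrite -/(P3 _) => h1.
have /andP[h2 _] := P3_range (y_range hx).
have := J0_le1 x; rewrite ler_norml => /andP[_ ->]; rewrite andbT; lra.
Qed.

(** Subtracting the square [(u (u - 2/3)) ^ 2 / 8] from the quartic [(1 - u) ^ 2 * pl u] removes the
    term in [u ^ 4], which keeps the primitive in [y] at degree 9; the bound touches at 0 and
    [2/3]. *)
Lemma pl_cubic u : (u - 139 / 72 * u ^+ 2 + 11 / 12 * u ^+ 3) <=
  (1 - u) ^+ 2 * pl u.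
Proof.
rewrite -subr_ge0.
have -> : (1 - u) ^+ 2 * pl u - (u - 139 / 72 * u ^+ 2 + 11 / 12 * u ^+ 3)
  = (u * (u - 2 / 3)) ^+ 2 / 8 by rewrite /pl; field.
by rewrite divr_ge0 ?sqr_ge0.
Qed.

(** This is [1 - P3 y], the polynomial stand-in for [1 - J0]. *)
Definition Uy y : R := y - y ^+ 2 / 4 + y ^+ 3 / 36.
Definition deficit_poly y : R := Uy y - 139 / 72 * Uy y ^+ 2 + 11 / 12 * Uy y ^+ 3 - y ^+ 4 / 576.
(* [A1], [A2], [A3] are primitives of [Uy ^ i / y], i = 1, 2, 3. *)
Definition A1 y : R := y - y ^+ 2 / 8 + y ^+ 3 / 108.
Definition A2 y : R := y ^+ 2 / 2 - y ^+ 3 / 6 + 17 / 576 * y ^+ 4 - y ^+ 5 / 360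
  + y ^+ 6 / (36 * 216).
Definition A3 y : R := y ^+ 3 / 3 - 3 / 16 * y ^+ 4 + 13 / 240 * y ^+ 5
  - 11 / (24 * 48) * y ^+ 6 + 13 / (12 * 12 * 84) * y ^+ 7
  - y ^+ 8 / (12 * 12 * 96) + y ^+ 9 / (216 * 216 * 9).
Definition deficit_prim y : R := (A1 y - 139 / 72 * A2 y + 11 / 12 * A3 y - y ^+ 4 / (48 * 48)) / 2.

Lemma der_deficit_prim x : 0 < x -> hder x (fun x => deficit_prim (x ^+ 2 / 4)) (deficit_poly (x ^+ 2 / 4) / x).
Proof.
move=> xp; have xn : x != 0 by rewrite gt_eqF.
by apply: der_eq; [rewrite /deficit_prim /A1 /A2 /A3; der|rewrite /= /deficit_poly /Uy; field].
Qed.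

Lemma deficit_poly_le x : 0 < x <= x0 -> deficit_poly (x ^+ 2 / 4) <= J0 x ^+ 2 * pl (1 - J0 x).
Proof.
move=> hx; have [e [E e0 e1]] := J0_taylor x.
have /andP[y0 y1] := y_range hx; have /andP[p0 p1] := P3_range (y_range hx).
have /andP[j0 j1] := J0_range hx.
move: E j0 j1; set y := _ / 4 in y0 y1 p0 p1 e1 * => E j0 j1.
have {1}-> : J0 x = 1 - (1 - J0 x) by ring.
apply: le_trans (pl_cubic _).
have E' : 1 - J0 x = Uy y - e by rewrite E /P3 /Uy; ring.
rewrite E'.
have U1 : Uy y <= 1 by move: p0; rewrite /P3 /Uy; lra.
have U0 : 0 <= Uy y - e by rewrite -E'; lra.
rewrite /deficit_poly; move: (Uy y) U1 U0 => U U1 U0.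
rewrite -subr_ge0.
(* Passing from [U] to [1 - J0 = U - e] costs at most [e <= y ^ 4 / 576], from the linear term: the
   other terms of the cubic decrease on [[0, 1]], so they can only gain. *)
have -> : U - e - 139 / 72 * (U - e) ^+ 2 + 11 / 12 * (U - e) ^+ 3 -
   (U - 139 / 72 * U ^+ 2 + 11 / 12 * U ^+ 3 - y ^+ 4 / 576) =
   (y ^+ 4 / 576 - e) + e * (139 / 72 * (U + (U - e)) -
     11 / 12 * (U ^+ 2 + U * (U - e) + (U - e) ^+ 2)) by field.
apply: addr_ge0; first lra.
apply: mulr_ge0 => //.
have h1 : 0 <= U * (1 - U) by apply: mulr_ge0; lra.
have h2 : 0 <= U * (1 - (U - e)) by apply: mulr_ge0; lra.
have h3 : 0 <= (U - e) * (1 - (U - e)) by apply: mulr_ge0; lra.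
by lra.
Qed.

(** The sign condition for freezing the weight: in the comparison on [(0, x0]], the factor
    [x0 ^ q - x ^ q] multiplies exactly the difference of these two sides. *)
Lemma J0_deficit_le x : 0 < x <= x0 ->
  J0 x ^+ 2 * pl (1 - J0 x) <= x * J0 x * J1 x / 2.
Proof.
move=> hx; have [e [E e0 e1]] := J0_taylor x.
have /andP[y0 y1] := y_range hx; have /andP[p0 p1] := P3_range (y_range hx).
have /andP[j0 j1] := J0_range hx.
have h := xJ1_ge x.
move: E j0 j1 h; set y := _ / 4 in y0 y1 p0 p1 e1 * => E j0 j1 h.
have -> : x * J0 x * J1 x / 2 = J0 x * (x * J1 x / 2) by field.
rewrite expr2 -mulrA; apply: ler_wpM2l; first exact: ltW.
apply: (@le_trans _ _ ((1 - J0 x) - 7 / 8 * (1 - J0 x) ^+ 2)).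
  rewrite -subr_ge0.
  have -> : 1 - J0 x - 7 / 8 * (1 - J0 x) ^+ 2 - J0 x * pl (1 - J0 x) =
    (1 - J0 x) ^+ 3 / 8 by rewrite /pl; field.
  by apply: divr_ge0 => //; apply: exprn_ge0; lra.
apply: (@le_trans _ _ (y - y ^+ 2 / 2 + y ^+ 3 / 12 - y ^+ 4 / 144)); last lra.
have E' : 1 - J0 x = Uy y - e by rewrite E /P3 /Uy; ring.
have U0 : 0 <= Uy y - e by rewrite -E'; lra.
have U1 : Uy y <= 1 by move: p0; rewrite /P3 /Uy; lra.
rewrite E'.
(* On [[0, 1]] the slope of [u - 7/8 u ^ 2] is at least [- 3/4]. *)
apply: (@le_trans _ _ (Uy y - 7 / 8 * Uy y ^+ 2 + 3 / 4 * e)).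
  rewrite -subr_ge0.
  have -> : Uy y - 7 / 8 * Uy y ^+ 2 + 3 / 4 * e - (Uy y - e - 7 / 8 * (Uy y - e) ^+ 2)
    = e * (7 / 4 - 7 / 8 * (Uy y + (Uy y - e))) by field.
  by apply: mulr_ge0 => //; lra.
apply: (@le_trans _ _ (Uy y - 7 / 8 * Uy y ^+ 2 + 3 / 4 * (y ^+ 4 / 576))); first lra.
rewrite -subr_ge0.
have -> : y - y ^+ 2 / 2 + y ^+ 3 / 12 - y ^+ 4 / 144 -
    (Uy y - 7 / 8 * Uy y ^+ 2 + 3 / 4 * (y ^+ 4 / 576)) =
  y ^+ 2 * (- (1 / 4) + y / 18 - y ^+ 2 / 144 - y ^+ 2 / 768 +
     7 / 8 * (1 - y / 4 + y ^+ 2 / 36) ^+ 2) by rewrite /Uy; field.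
apply: mulr_ge0; first exact: sqr_ge0.
set V := 1 - y / 4 + y ^+ 2 / 36.
have yy : 0 <= y * (7 / 5 - y) by apply: mulr_ge0; lra.
have V0 : 13 / 20 <= V by rewrite /V; have := sqr_ge0 y; lra.
have : 13 / 20 * (13 / 20) <= V * V by apply: ler_pM; lra.
by rewrite [V ^+ 2]expr2; lra.
Qed.

End bessel_integrals.

Section hline_J0_deficit_ge.
Variable R : realType.
Variable q : R.
Hypothesis q0 : 0 < q.
Hypothesis q1 : q < 1.
Implicit Types (x y z u s : R).
Local Notation x0 := (x0 R).
Local Notation wt := (wt q).

Lemma cont_small (f : R -> R) : {for 0, continuous f} ->
  forall e, 0 < e -> exists2 x1, 0 < x1 & forall x, 0 < x <= x1 -> f x <= f 0 + e.
Proof.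
move=> cf e e0.
have /cvgrPdist_le/(_ _ e0) [d /= d0 hd] := cf.
exists (d / 2); first by rewrite divr_gt0.
move=> x /andP[xp xd].
have : `|f 0 - f x| <= e.
  by apply: hd; rewrite /= sub0r normrN gtr0_norm//; lra.
by rewrite ler_norml => /andP[h _]; lra.
Qed.

Lemma wt_small e : 0 < e -> exists2 x1, 0 < x1 & forall x, x1 <= x -> wt x <= e.
Proof.
move=> e0; exists (e^-1 `^ (1 - q)^-1); first by rewrite powR_gt0// invr_gt0.
move=> x hx.
have p0 : 0 < e^-1 `^ (1 - q)^-1 by rewrite powR_gt0// invr_gt0.
have xp : 0 < x by exact: lt_le_trans hx.
have r0 : 0 <= 1 - q by rewrite subr_ge0 ltW.
have h := ge0_ler_powR r0 (ltW p0) (ltW xp) hx.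
rewrite /wt (_ : q - 1 = - (1 - q)); last by ring.
rewrite powRN -[e]invrK lef_pV2 ?posrE ?powR_gt0 ?invr_gt0//.
have n : 1 - q != 0 by apply: lt0r_neq0; rewrite subr_gt0.
by apply: le_trans h; rewrite -powRrM mulVf// powRr1// invr_ge0 ltW.
Qed.

(** Beyond [x0] one has [|J0| <= 21 / 50], hence [1 - |J0| >= 29 / 50]: this is the least value that
    [pl (1 - |J0|)] is allowed there. *)
Definition lamA : R := pl (29 / 50).

Lemma lamA_ge : 31 / 50 <= lamA.
Proof. by rewrite /lamA /pl; lra. Qed.

Lemma deficit_prim_num : 0 <= deficit_prim (7 / 5 : R) - 1 / 4 + lamA * (7 / 60).
Proof. rewrite /lamA /pl /deficit_prim /A1 /A2 /A3; lra. Qed.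

Let H1 x : R := - (1 / 4) * (J0 x ^+ 2 * x `^ q) +
  x0 `^ q * (deficit_prim (x ^+ 2 / 4) + 1 / 4 * J0 x ^+ 2).
Let h1 x : R := - (1 / 4) * (2 * J0 x * (- J1 x) * x `^ q + J0 x ^+ 2 * (q * wt x)) +
  x0 `^ q * (deficit_poly (x ^+ 2 / 4) * x^-1 + 1 / 4 * (2 * J0 x * (- J1 x))).
(** The derivative of [tail_energy] is [- J0 ^ 2 / x] to leading order, so that [H2] grows like the
    primitive of [lamA * J0 ^ 2 * wt], a lower bound for [u]. *)
Let H2 x : R := - lamA * (tail_energy x * x `^ q).
Let h2 x : R := - lamA * ((- (J0 x ^+ 2 * x^-1) + 32 / 3 * J0 x ^+ 2 * (x ^+ 5)^-1) * x `^ q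
  + tail_energy x * (q * wt x)).

Let dH1 x : 0 < x -> hder x H1 (h1 x).
Proof.
move=> xp; have dJ0 := der_J0 x; have dq := der_xq q xp; have dQ := der_deficit_prim xp.
by apply: der_eq; [rewrite /H1; der|rewrite /= /h1; ring].
Qed.

Let dH2 x : 0 < x -> hder x H2 (h2 x).
Proof.
move=> xp; have dG := der_tail_energy xp; have dq := der_xq q xp.
by apply: der_eq; [rewrite /H2; der|rewrite /= /h2; ring].
Qed.

Let ch1 x : 0 < x -> {for x, continuous h1}.
Proof.
move=> xp; have xn : x != 0 by rewrite gt_eqF.
have dJ0 := der_J0 x; have dJ1 := der_J1 x; have dq := der_xq q xp.
have dw : hder x wt _ := der_powR (q - 1) xp (der_id x).
have dV := derV xn (der_id x).
by eapply der_continuous; rewrite /h1 /deficit_poly /Uy; der.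
Qed.

Let ch2 x : 0 < x -> {for x, continuous h2}.
Proof.
move=> xp; have xn : x != 0 by rewrite gt_eqF.
have dJ0 := der_J0 x; have dq := der_xq q xp; have dG := der_tail_energy xp.
have dw : hder x wt _ := der_powR (q - 1) xp (der_id x).
have dV := derV xn (der_id x); have dV5 := der_invX 5 xn.
by eapply der_continuous; rewrite /h2; der.
Qed.

Let u x : R := J0 x ^+ 2 * pl (1 - `|J0 x|) * wt x.
Let v x : R := q / 4 * (J0 x ^+ 2 * wt x).

Lemma pl_ge0 z : 0 <= z -> 0 <= pl z.
Proof. by move=> z0; rewrite /pl; apply: addr_ge0 => //; apply: divr_ge0 => //; exact: sqr_ge0. Qed.

Lemma pl_homo y z : 0 <= y -> y <= z -> pl y <= pl z.
Proof.
move=> y0 yz; rewrite /pl; apply: lerD => //; apply: ler_wpM2r => //.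
by apply: lerXn2r => //; rewrite nnegrE; lra.
Qed.

Lemma cont_u_J0 : continuous (fun x : R => J0 x ^+ 2 * pl (1 - `|J0 x|)).
Proof. by have cJ := @cont_J0 R; rewrite /pl; cont. Qed.

Lemma cont_J0sq : continuous (fun x : R => J0 x ^+ 2).
Proof. by have cJ := @cont_J0 R; cont. Qed.

Let vu1 x : 0 < x <= x0 -> v x + h1 x <= u x.
Proof.
move=> hx; have /andP[xp xc] := hx; have xn : x != 0 by rewrite gt_eqF.
have /andP[j0 j1] := J0_range hx.
have D := J0_deficit_le hx; have F := deficit_poly_le hx.
rewrite /u (gtr0_norm j0).
have Eq : x `^ q = x * wt x by rewrite xwt.
have hq : x `^ q <= x0 `^ q.
  by apply: ge0_ler_powR => //; rewrite ?nnegrE ltW// x0_gt0.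
rewrite /v /h1 -subr_ge0.
set T := J0 x ^+ 2 * pl _ in D F *.
set X := x `^ q in Eq hq *; set C := x0 `^ q in hq *; set f := deficit_poly _ in F *.
have -> : T * wt x - (q / 4 * (J0 x ^+ 2 * wt x) +
   (- (1 / 4) * (2 * J0 x * - J1 x * X + J0 x ^+ 2 * (q * wt x)) +
    C * (f * x^-1 + 1 / 4 * (2 * J0 x * - J1 x)))) =
  C * (T - f) / x + (C - X) * (x * J0 x * J1 x / 2 - T) / x.
  by rewrite Eq; field.
have C0 : 0 <= C by exact: powR_ge0.
apply: addr_ge0; apply: divr_ge0; try exact: ltW; apply: mulr_ge0 => //; lra.
Qed.

Let vu2 x : x0 <= x -> v x + h2 x <= u x.
Proof.
move=> hx; have xp : 0 < x by exact: lt_le_trans (x0_gt0 R) hx.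
have xn : x != 0 by rewrite gt_eqF.
have hm := J0_le_m hx; have hG := tail_energy_ge hx.
have Eq : x `^ q = x * wt x by rewrite xwt.
have w0 := wt_ge0 q x.
have hp : lamA <= pl (1 - `|J0 x|) by apply: pl_homo; lra.
have l0 := lamA_ge.
rewrite /u /v /h2 Eq -subr_ge0.
set p := pl _ in hp *.
have -> : J0 x ^+ 2 * p * wt x - (q / 4 * (J0 x ^+ 2 * wt x) +
   - lamA * ((- (J0 x ^+ 2 * x^-1) + 32 / 3 * J0 x ^+ 2 * (x ^+ 5)^-1) * (x * wt x) +
      tail_energy x * (q * wt x))) =
  wt x * (J0 x ^+ 2 * (p - lamA) + lamA * (32 / 3) * J0 x ^+ 2 / x ^+ 4 +
     q * (lamA * (tail_energy x - 9 / 20 * J0 x ^+ 2) + (9 / 20 * lamA - 1 / 4) * J0 x ^+ 2)).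
  by field.
have s0 := sqr_ge0 (J0 x).
apply: mulr_ge0 => //; apply: addr_ge0.
  apply: addr_ge0; first by apply: mulr_ge0 => //; lra.
  by apply: divr_ge0; [apply: mulr_ge0 => //; lra|apply: exprn_ge0; exact: ltW].
apply: mulr_ge0; first exact: ltW.
by apply: addr_ge0; apply: mulr_ge0 => //; lra.
Qed.

(* [H1] on (0, x0] and [H2] on [x0, +oo) turn the difference of the integrands
   into boundary terms at [x0], whose sign is [deficit_prim_num]. *)
Lemma hline_J0_deficit_ge : (hline v <= hline u)%E.
Proof.
have x0p := x0_gt0 R.
(* The limit of [H1] at 0 is [x0 ^ q / 4], as [J0 0 = 1] and [deficit_prim 0 = 0]; [H2] tends to 0
   at infinity. *)
apply: (@hline_compare R u v v v h1 H1 h2 H2 x0 (x0 `^ q / 4) 0 x0p).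
- apply: measurable_funM; last exact: measurable_wt.
  by apply: continuous_measurable_fun; exact: cont_u_J0.
- apply: measurable_funM => //; apply: measurable_funM; last exact: measurable_wt.
  by apply: continuous_measurable_fun; exact: cont_J0sq.
- move=> x xp; apply: mulr_ge0; last exact: wt_ge0.
  apply: mulr_ge0; first exact: sqr_ge0.
  by apply: pl_ge0; rewrite subr_ge0 J0_le1.
- move=> x xp; apply: mulr_ge0; first by apply: divr_ge0 => //; exact: ltW.
  by apply: mulr_ge0; [exact: sqr_ge0|exact: wt_ge0].
- move=> x xp; apply: cont_mul_at; [exact: cont_u_J0|exact: cont_wt].
- move=> x xp; apply: cont_mul_at; first exact: cst_continuous.
  by apply: cont_mul_at; [exact: cont_J0sq|exact: cont_wt].
- move=> x xp; apply: cont_mul_at; first exact: cst_continuous.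
  by apply: cont_mul_at; [exact: cont_J0sq|exact: cont_wt].
- by [].
- by [].
- exact: ch1.
- exact: ch2.
- by move=> x /andP[xp _]; exact: dH1.
- by move=> x hx; apply: dH2; exact: lt_le_trans hx.
- exact: vu1.
- exact: vu2.
- move=> e e0.
  have cf : {for 0, continuous (fun x : R => x0 `^ q * (deficit_prim (x ^+ 2 / 4) + 1 / 4))}.
    have : continuous (fun x : R => x0 `^ q * (deficit_prim (x ^+ 2 / 4) + 1 / 4)).
      by rewrite /deficit_prim /A1 /A2 /A3; cont.
    exact.
  have [x1 x10 hx1] := cont_small cf e0; exists x1 => // x /[dup] /andP[xp _] /hx1.
  have Q0 : deficit_prim 0 = 0 :> R by rewrite /deficit_prim /A1 /A2 /A3 !expr0n/=; ring.
  rewrite expr0n/= mul0r Q0 add0r => h; rewrite mulrA mulr1 in h.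
  apply: le_trans h; rewrite /H1.
  have C0 : 0 <= x0 `^ q by exact: powR_ge0.
  have X0 : 0 <= x `^ q by exact: powR_ge0.
  have J2 : J0 x ^+ 2 <= 1.
    by rewrite -(real_normK (num_real _)) expr_le1// J0_le1.
  have t1 : 0 <= J0 x ^+ 2 * x `^ q by apply: mulr_ge0 => //; exact: sqr_ge0.
  have t2 : x0 `^ q * (deficit_prim (x ^+ 2 / 4) + 1 / 4 * J0 x ^+ 2) <=
      x0 `^ q * (deficit_prim (x ^+ 2 / 4) + 1 / 4) by apply: ler_wpM2l => //; lra.
  by lra.
- move=> e e0.
  have l0 := lamA_ge; have lp : 0 < 12 * lamA by lra.
  have [x1 x10 hx1] := wt_small (divr_gt0 e0 lp).
  exists (Num.max x0 x1) => x; rewrite ge_max => /andP[hx hx'].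
  have xp : 0 < x by exact: lt_le_trans hx.
  have := tail_energy_decay hx; have := hx1 _ hx'; rewrite ler_pdivlMr// => h3 h4.
  rewrite /H2 -(@xwt R q q0 x xp) sub0r mulNr lerN2.
  have w0 := wt_ge0 q x.
  have : tail_energy x * x <= 12.
    rewrite -ler_pdivlMr//; apply: le_trans h4; exact: ler_norm.
  move=> h5; have h6 : tail_energy x * x * wt x <= 12 * wt x by apply: ler_wpM2r.
  have h7 : lamA * (tail_energy x * x * wt x) <= lamA * (12 * wt x) by apply: ler_wpM2l => //; lra.
  by rewrite mulrA; lra.
- rewrite /H1 /H2 (x0sq R).
  have -> : 28 / 5 / 4 = 7 / 5 :> R by lra.
  have C0 : 0 <= x0 `^ q by exact: powR_ge0.
  have N := deficit_prim_num; have G := tail_energy_x0 R; have l0 := lamA_ge.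
  set C := x0 `^ q in C0 *.
  have -> : - (1 / 4) * (J0 x0 ^+ 2 * C) + C * (deficit_prim (7 / 5) + 1 / 4 * J0 x0 ^+ 2) -
    C / 4 + (0 - - lamA * (tail_energy x0 * C)) =
    C * ((deficit_prim (7 / 5) - 1 / 4 + lamA * (7 / 60)) + lamA * (tail_energy x0 - 7 / 60)) by field.
  apply: mulr_ge0 => //; apply: addr_ge0 => //; apply: mulr_ge0; lra.
Qed.

End hline_J0_deficit_ge.

(** * The Gaussian comparison for large exponents *)

Section exp_bounds.
Variable R : realType.
Implicit Types z w : R.

Lemma exp_taylor2 z : 0 <= z -> 0 <= (1 - z + z ^+ 2 / 2) - expR (- z).
Proof.
move=> z0; apply: (@der_ge0_from0 _ (fun z => (1 - z + z ^+ 2 / 2) - expR (- z))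
  (fun z => expR (- z) - (1 - z)) _ _ z0).
- by rewrite oppr0 expR0 expr0n/=; ring.
- by move=> w; apply: der_eq; [by der|rewrite /=; field].
- by move=> w _; rewrite subr_ge0; have := expR_ge1Dx (- w).
Qed.

Lemma exp_taylor3 z : 0 <= z -> 0 <= expR (- z) - (1 - z + z ^+ 2 / 2 - z ^+ 3 / 6).
Proof. by move=> z0; taylor_step exp_taylor2 z z0. Qed.

Lemma exp_taylor4 z : 0 <= z ->
  0 <= (1 - z + z ^+ 2 / 2 - z ^+ 3 / 6 + z ^+ 4 / 24) - expR (- z).
Proof. by move=> z0; taylor_step exp_taylor3 z z0. Qed.

Lemma exp_num : expR (- (14 / 5)) <= 7 / 100 :> R.
Proof.
(* The quadratic Taylor bound is sharp enough at [7 / 20]; three squarings bring it to [14 / 5]. *)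
have -> : - (14 / 5) = 8%:R * - (7 / 20) :> R by lra.
rewrite expRM_natl.
have p0 : 0 <= 7 / 20 :> R by lra.
have h : expR (- (7 / 20)) <= 57 / 80 :> R by have := exp_taylor2 p0; rewrite subr_ge0 => h; apply: (le_trans h); lra.
have e0 : 0 <= expR (- (7 / 20)) :> R by exact: expR_ge0.
move: (expR _) h e0 => e h e0.
have e2 : e ^+ 2 <= 51 / 100 by rewrite expr2; have hh := ler_pM e0 e0 h h; lra.
have s2 := sqr_ge0 e; have e4 : e ^+ 4 <= 261 / 1000.
  have -> : e ^+ 4 = e ^+ 2 * e ^+ 2 by rewrite -exprD.
  by have hh := ler_pM s2 s2 e2 e2; lra.
have s4 : 0 <= e ^+ 4 by exact: exprn_ge0.
have -> : e ^+ 8 = e ^+ 4 * e ^+ 4 by rewrite -exprD.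
by have hh := ler_pM s4 s4 e4 e4; lra.
Qed.

End exp_bounds.

Section hline_J0_gauss_le.
Variable R : realType.
Variable q : R.
Hypothesis q0 : 0 < q.
Hypothesis q1 : q < 1.
Implicit Types (x y z u s : R).
Local Notation x0 := (x0 R).
Local Notation wt := (wt q).

(** The expansion of [P3 ^ 2 - E4 ^ 2], with [E4] the quartic Taylor polynomial of [exp (- y)]. It
    starts at [y ^ 2], because [J0 ^ 2] and [exp (- x ^ 2 / 2)] agree to first order in
    [y = x ^ 2 / 4]. *)
Definition gauss_poly y : R := - (1 / 2) * y ^+ 2 + 7 / 9 * y ^+ 3 - 79 / 144 * y ^+ 4 +
  17 / 72 * y ^+ 5 - 89 / (36 * 36) * y ^+ 6 + y ^+ 7 / 72 - y ^+ 8 / 576.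
Definition gauss_prim y : R := (- (1 / 4) * y ^+ 2 + 7 / 27 * y ^+ 3 - 79 / 576 * y ^+ 4 +
  17 / 360 * y ^+ 5 - 89 / (36 * 216) * y ^+ 6 + y ^+ 7 / 504 - y ^+ 8 / (576 * 8)) / 2.

Lemma gauss_prim_num : - (61 / 1000) <= gauss_prim (7 / 5).
Proof. by rewrite /gauss_prim; lra. Qed.

Lemma der_gauss_prim x : 0 < x -> hder x (fun x => gauss_prim (x ^+ 2 / 4)) (gauss_poly (x ^+ 2 / 4) / x).
Proof.
move=> xp; have xn : x != 0 by rewrite gt_eqF.
by apply: der_eq; [rewrite /gauss_prim; der|rewrite /= /gauss_poly; field].
Qed.

(** Used twice: to dominate [|J0| ^ s] by a Gaussian, and as the sign condition that permits
    freezing [x ^ q] at [x0 ^ q]. *)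
Lemma J0_le_exp x : 0 < x <= x0 -> J0 x <= expR (- (x ^+ 2 / 4)).
Proof.
move=> hx; have /andP[y0 y1] := y_range hx.
apply: (le_trans (J0_le4 x)); have := exp_taylor3 y0.
set y := _ / 4 in y0 y1 * => h.
have h1 : 0 <= y ^+ 2 * (7 / 5 - y) by apply: mulr_ge0; [exact: sqr_ge0|lra].
have h2 : 0 <= y ^+ 3 * (7 / 5 - y) by apply: mulr_ge0; [exact: exprn_ge0|lra].
have h3 : 0 <= y ^+ 2 by exact: sqr_ge0.
by lra.
Qed.

Lemma gauss_poly_le x : 0 < x <= x0 -> gauss_poly (x ^+ 2 / 4) <= J0 x ^+ 2 - expR (- (x ^+ 2 / 2)).
Proof.
move=> hx; have /andP[y0 y1] := y_range hx; have /andP[p0 p1] := P3_range (y_range hx).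
have hJ := J0_ge3 x; rewrite -/(P3 _) in hJ.
have he := exp_taylor4 y0.
have -> : expR (- (x ^+ 2 / 2)) = expR (- (x ^+ 2 / 4)) ^+ 2.
  by rewrite -expRM_natl; congr expR; field.
have e0 := expR_ge0 (- (x ^+ 2 / 4)).
move: hJ he e0 p0 p1; set y := x ^+ 2 / 4 => hJ he e0 p0 p1.
pose E4 := 1 - y + y ^+ 2 / 2 - y ^+ 3 / 6 + y ^+ 4 / 24.
have he' : expR (- y) <= E4 by rewrite -subr_ge0.
have -> : gauss_poly y = P3 y ^+ 2 - E4 ^+ 2 by rewrite /gauss_poly /P3 /E4; field.
apply: lerB; apply: lerXn2r => //; rewrite nnegrE; lra.
Qed.

Let H1 x : R := x0 `^ q * gauss_prim (x ^+ 2 / 4).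
Let h1 x : R := x0 `^ q * (gauss_poly (x ^+ 2 / 4) * x^-1).
(** The constant for which [K * x >= wt x] beyond [x0], with equality at [x0]; the exact derivative
    of [K exp (- x ^ 2 / 2)] then pays for the weighted Gaussian tail. *)
Let K : R := wt x0 / x0.
(** Beyond [x0] a share [37 / 100] of [J0 ^ 2] is kept in [v2]; the remaining [63 / 100] is
    converted into a boundary term. *)
Let H2 x : R := - (63 / 100) * (tail_energy x * x `^ q) + K * expR (- (x ^+ 2 / 2)).
Let h2 x : R := - (63 / 100) *
  ((- (J0 x ^+ 2 * x^-1) + 32 / 3 * J0 x ^+ 2 * (x ^+ 5)^-1) * x `^ q
  + tail_energy x * (q * wt x)) - K * (x * expR (- (x ^+ 2 / 2))).

Let dH1 x : 0 < x -> hder x H1 (h1 x).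
Proof.
move=> xp; have dQ := der_gauss_prim xp.
by apply: der_eq; [rewrite /H1; der|rewrite /= /h1; ring].
Qed.

Let dH2 x : 0 < x -> hder x H2 (h2 x).
Proof.
move=> xp; have dG := der_tail_energy xp; have dq := der_xq q xp.
by apply: der_eq; [rewrite /H2; der|rewrite /= /h2; field; rewrite gt_eqF].
Qed.

Let ch1 x : 0 < x -> {for x, continuous h1}.
Proof.
move=> xp; have xn : x != 0 by rewrite gt_eqF.
have dV := derV xn (der_id x).
by eapply der_continuous; rewrite /h1 /gauss_poly; der.
Qed.

Let ch2 x : 0 < x -> {for x, continuous h2}.
Proof.
move=> xp; have xn : x != 0 by rewrite gt_eqF.
have dJ0 := der_J0 x; have dq := der_xq q xp; have dG := der_tail_energy xp.
have dw : hder x wt _ := der_powR (q - 1) xp (der_id x).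
have dV := derV xn (der_id x); have dV5 := der_invX 5 xn.
by eapply der_continuous; rewrite /h2; der.
Qed.

Let u x : R := J0 x ^+ 2 * wt x.
Let v1 x : R := expR (- (x ^+ 2 / 2)) * wt x.
Let v2 x : R := expR (- (x ^+ 2 / 2)) * wt x + 37 / 100 * (J0 x ^+ 2 * wt x).
Let v x : R := expR (- (x ^+ 2 / 2)) * wt x +
  37 / 100 * (\1_(`]x0, +oo[%classic : set R) x * (J0 x ^+ 2 * wt x)).

Let vu1 x : 0 < x <= x0 -> v1 x + h1 x <= u x.
Proof.
move=> hx; have /andP[xp xc] := hx; have xn : x != 0 by rewrite gt_eqF.
have /andP[j0 j1] := J0_range hx.
have F := gauss_poly_le hx; have JE := J0_le_exp hx.
have Eq : x `^ q = x * wt x by rewrite xwt.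
have hq : x `^ q <= x0 `^ q.
  by apply: ge0_ler_powR => //; rewrite ?nnegrE ltW// x0_gt0.
have e2 : expR (- (x ^+ 2 / 2)) = expR (- (x ^+ 2 / 4)) ^+ 2.
  by rewrite -expRM_natl; congr expR; field.
have JE2 : J0 x ^+ 2 <= expR (- (x ^+ 2 / 2)).
  by rewrite e2; apply: lerXn2r => //; rewrite nnegrE ?expR_ge0// ltW.
rewrite /u /v1 /h1 -subr_ge0.
move: F JE2; set X := x `^ q in Eq hq *; set C := x0 `^ q in hq *.
set f := gauss_poly _; set E := expR _ => F JE2.
have -> : J0 x ^+ 2 * wt x - (E * wt x + C * (f * x^-1)) =
  C * ((J0 x ^+ 2 - E) - f) / x + (C - X) * (E - J0 x ^+ 2) / x.
  by rewrite Eq; field.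
have C0 : 0 <= C by exact: powR_ge0.
apply: addr_ge0; apply: divr_ge0; try exact: ltW; apply: mulr_ge0 => //; lra.
Qed.

Let vu2 x : x0 <= x -> v2 x + h2 x <= u x.
Proof.
move=> hx; have xp : 0 < x by exact: lt_le_trans (x0_gt0 R) hx.
have xn : x != 0 by rewrite gt_eqF.
have cp := x0_gt0 R; have cn : x0 != 0 by rewrite gt_eqF.
have hG := tail_energy_ge hx.
have Eq : x `^ q = x * wt x by rewrite xwt.
have w0 := wt_ge0 q x.
have hw : wt x <= wt x0.
  rewrite /wt (_ : q - 1 = - (1 - q)); last by ring.
  rewrite !powRN lef_pV2 ?posrE ?powR_gt0//.
  by apply: ge0_ler_powR => //; rewrite ?subr_ge0 ?nnegrE ltW.
have E0 := expR_ge0 (- (x ^+ 2 / 2)).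
rewrite /u /v2 /h2 Eq -subr_ge0; set E := expR _ in E0 *.
have -> : J0 x ^+ 2 * wt x - (E * wt x + 37 / 100 * (J0 x ^+ 2 * wt x) +
   (- (63 / 100) * ((- (J0 x ^+ 2 * x^-1) + 32 / 3 * J0 x ^+ 2 * (x ^+ 5)^-1) * (x * wt x) +
      tail_energy x * (q * wt x)) - K * (x * E))) =
  wt x * (63 / 100 * (32 / 3) * J0 x ^+ 2 / x ^+ 4 + 63 / 100 * q * tail_energy x) +
  E * (K * x - wt x).
  by field.
have s0 := sqr_ge0 (J0 x).
have G0 : 0 <= tail_energy x by lra.
apply: addr_ge0; apply: mulr_ge0 => //.
  apply: addr_ge0.
    by apply: divr_ge0; [apply: mulr_ge0 => //; lra|apply: exprn_ge0; exact: ltW].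
  by apply: mulr_ge0 => //; apply: mulr_ge0; [lra|exact: ltW].
rewrite subr_ge0 /K -mulrA; apply: (le_trans hw).
by rewrite ler_peMr ?wt_ge0// mulrC ler_pdivlMr// mul1r.
Qed.

Let cont_E : continuous (fun x : R => expR (- (x ^+ 2 / 2))).
Proof. by cont. Qed.

(** For large [s], [|J0| ^ s] lies below a Gaussian before [x0] and below a small multiple of
    [J0 ^ 2] beyond. The two terms of [v] make room for these two majorants under the integral at
    [s = 2]. *)
Lemma hline_J0_gauss_le : (hline v <= hline u)%E.
Proof.
have x0p := x0_gt0 R.
have u0 x : 0 <= u x by apply: mulr_ge0; [exact: sqr_ge0|exact: wt_ge0].
have mu_ : measurable_fun setT u.
  apply: measurable_funM; last exact: measurable_wt.
  by apply: continuous_measurable_fun; exact: cont_J0sq.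
have mv1 : measurable_fun setT v1.
  apply: measurable_funM; last exact: measurable_wt.
  by apply: continuous_measurable_fun; exact: cont_E.
have v10 x : 0 <= v1 x by apply: mulr_ge0; [exact: expR_ge0|exact: wt_ge0].
have cu x : 0 < x -> {for x, continuous u}.
  by move=> xp; apply: cont_mul_at; [exact: cont_J0sq|exact: cont_wt].
have cv1 x : 0 < x -> {for x, continuous v1}.
  by move=> xp; apply: cont_mul_at; [exact: cont_E|exact: cont_wt].
apply: (@hline_compare R u v v1 v2 h1 H1 h2 H2 x0 0 0 x0p).
- exact: mu_.
- apply: measurable_funD; first exact: mv1.
  apply: measurable_funM; first exact: measurable_cst.
  by apply: measurable_funM; [exact: measurable_indic|exact: mu_].
- by move=> x _; exact: u0.
- move=> x _; apply: addr_ge0; first exact: v10.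
  apply: mulr_ge0 => //; apply: mulr_ge0; last exact: u0.
  by rewrite indicE.
- exact: cu.
- exact: cv1.
- move=> x xp; apply: cont_add_at; first exact: cv1.
  by apply: cont_mul_at; [exact: cst_continuous|exact: cu].
- move=> x /andP[_ xc]; rewrite /v /v1 indicE memNset.
    by rewrite mul0r mulr0 addr0.
  by rewrite /= in_itv/= andbT; apply/negP; rewrite -leNgt.
- move=> x cx; rewrite /v /v2 indicE mem_set ?mul1r//.
  by rewrite /= in_itv/= andbT.
- exact: ch1.
- exact: ch2.
- by move=> x /andP[xp _]; exact: dH1.
- by move=> x hx; apply: dH2; exact: lt_le_trans hx.
- exact: vu1.
- exact: vu2.
- move=> e e0.
  have cf : {for 0, continuous (fun x : R => x0 `^ q * gauss_prim (x ^+ 2 / 4))}.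
    have : continuous (fun x : R => x0 `^ q * gauss_prim (x ^+ 2 / 4)) by rewrite /gauss_prim; cont.
    exact.
  have [x1 x10 hx1] := cont_small cf e0; exists x1 => // x /hx1.
  have Q0 : gauss_prim 0 = 0 :> R by rewrite /gauss_prim !expr0n/=; ring.
  by rewrite expr0n/= mul0r Q0 mulr0.
- move=> e e0; have lp : 0 < 12 * (63 / 100) :> R by lra.
  have [x1 x10 hx1] := wt_small q1 (divr_gt0 e0 lp).
  exists (Num.max x0 x1) => x; rewrite ge_max => /andP[hx hx'].
  have xp : 0 < x by exact: lt_le_trans hx.
  have := tail_energy_decay hx; have := hx1 _ hx'; rewrite ler_pdivlMr// => h3 h4.
  rewrite /H2 -(@xwt R q q0 x xp) sub0r.
  have w0 := wt_ge0 q x.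
  have : tail_energy x * x <= 12.
    rewrite -ler_pdivlMr//; apply: le_trans h4; exact: ler_norm.
  move=> h5; have h6 : tail_energy x * x * wt x <= 12 * wt x by apply: ler_wpM2r.
  have K0 : 0 <= K * expR (- (x ^+ 2 / 2)).
    apply: mulr_ge0; last exact: expR_ge0.
    by apply: divr_ge0; [exact: wt_ge0|exact: ltW].
  by rewrite [tail_energy x * (x * _)]mulrA; lra.
- rewrite /H1 /H2 /K (x0sq R).
  have -> : 28 / 5 / 4 = 7 / 5 :> R by lra.
  have -> : 28 / 5 / 2 = 14 / 5 :> R by lra.
  have C0 : 0 <= x0 `^ q by exact: powR_ge0.
  have N := gauss_prim_num; have G := tail_energy_x0 R; have E := exp_num R.
  have -> : wt x0 / x0 = x0 `^ q / (28 / 5).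
    rewrite -(x0sq R) -(@xwt R q q0 x0 x0p); field.
    by rewrite gt_eqF.
  set C := x0 `^ q in C0 *; set e := expR _ in E *.
  have -> : C * gauss_prim (7 / 5) - 0 + (0 - (- (63 / 100) * (tail_energy x0 * C) + C / (28 / 5) * e)) =
    C * (gauss_prim (7 / 5) + 63 / 100 * tail_energy x0 - 5 / 28 * e) by field.
  (* The three numerical bounds are matched exactly: [- 61/1000 + 63/100 * 7/60 - 5/28 * 7/100 =
     0]. *)
  by apply: mulr_ge0 => //; lra.
Qed.

End hline_J0_gauss_le.

(** * Change of scale on the half-line *)

Section scaling.
Variable R : realType.
Implicit Types (x y c : R).
Notation mu := (@lebesgue_measure R).

Definition dilate c : measurableTypeR R -> measurableTypeR R := fun x => c * x.

Lemma measurable_dilate c : measurable_fun setT (dilate c).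
Proof. by apply: measurable_funM; [exact: measurable_cst|exact: measurable_id]. Qed.

Definition dilate_measure c : {measure set (measurableTypeR R) -> \bar R} :=
  measure_function_pushforward__canonical__measure_function_Measure mu (measurable_dilate c).

Lemma lebesgue_dilate c (c0 : 0 < c) A : measurable A ->
  mu A = mscale (NngNum (ltW c0)) (dilate_measure c) A.
Proof.
move=> mA; apply: lebesgue_measure_unique => //= _ [[a b]] _ <-.
rewrite /mscale /= /pushforward.
have -> : dilate c @^-1` `]a, b] = `](a / c), (b / c)]%classic.
  apply/seteqP; split => x /=; rewrite /dilate !in_itv/=.
    by rewrite ltr_pdivrMr// ler_pdivlMr// mulrC.
  by rewrite ltr_pdivrMr// ler_pdivlMr// mulrC.
rewrite !lebesgue_measure_itv/= !lte_fin ltr_pM2r ?invr_gt0//.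
case: ifPn => _; last by rewrite mule0.
by rewrite -!EFinB -EFinM; congr EFin; field; rewrite gt_eqF.
Qed.

Lemma hline_dilate (f : R -> R) c : 0 < c ->
  measurable_fun setT f -> (forall x, 0 < x -> 0 <= f x) ->
  hline f = (c%:E * hline (fun x => f (c * x)%R))%E.
Proof.
move=> c0 mf f0.
have mfE : measurable_fun setT (EFin \o f) by exact/measurable_EFinP.
rewrite /hline (@eq_measure_integral _ _ _ _
  (mscale (NngNum (ltW c0)) (dilate_measure c))); last first.
  by move=> A mA _; exact: lebesgue_dilate.
rewrite ge0_integral_mscale//; last 2 first.
- by apply/measurable_EFinP; exact: measurable_funTS.
- by move=> x /=; rewrite in_itv/= andbT lee_fin; exact: f0.
rewrite (@ge0_integral_pushforward _ _ _ _ R (dilate c) (measurable_dilate c)) //; last 2 first.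
- by apply/measurable_EFinP; exact: measurable_funTS.
- by move=> x /[!inE]/=; rewrite in_itv/= andbT lee_fin; exact: f0.
rewrite (_ : dilate c @^-1` `]0, +oo[ = `]0, +oo[%classic)//.
by apply/seteqP; split => x /=; rewrite /dilate !in_itv/= !andbT pmulr_rgt0.
Qed.

Lemma hline_scale (q : R) (f : R -> R) c : 0 < c ->
  measurable_fun setT f -> (forall x, 0 < x -> 0 <= f x) ->
  hline (fun x => f (c * x)%R * wt q x)%R =
  ((c `^ (- q))%:E * hline (fun x => f x * wt q x)%R)%E.
Proof.
move=> c0 mf f0.
have mw := measurable_wt q.
have mfc : measurable_fun setT (fun x => f (c * x)).
  by apply: (measurableT_comp mf); exact: measurable_dilate.
have P0 : (0 <= hline (fun x => f (c * x)%R * wt q x)%R)%E.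
  by apply: integral_ge0 => x /=; rewrite in_itv/= andbT => x0;
     rewrite lee_fin mulr_ge0 ?wt_ge0 ?f0 ?mulr_gt0.
rewrite [in RHS](@hline_dilate _ c)//; last 2 first.
- exact: measurable_funM.
- by move=> x x0; rewrite mulr_ge0 ?wt_ge0 ?f0.
have -> : hline (fun x => f (c * x)%R * wt q (c * x)%R)%R =
   ((c `^ (q - 1))%:E * hline (fun x => f (c * x)%R * wt q x)%R)%E.
  rewrite /hline -ge0_integralZl//; last 3 first.
  - by apply/measurable_EFinP; apply: measurable_funTS; exact: measurable_funM.
  - move=> x /=; rewrite in_itv/= andbT => x0.
    by rewrite lee_fin mulr_ge0 ?wt_ge0 ?f0 ?mulr_gt0.
  - by rewrite lee_fin powR_ge0.
  apply: eq_integral => x /[!inE]/=; rewrite in_itv/= andbT => x0.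
  rewrite -EFinM; congr EFin; rewrite /wt powRM ?(ltW c0) ?(ltW x0)//.
  by ring.
rewrite !muleA -!EFinM.
have -> : c `^ (- q) * c * c `^ (q - 1) = 1.
  have cn : c != 0 by rewrite gt_eqF.
  rewrite -{2}(powRr1 (ltW c0)) -!powRD ?cn ?implybT//.
  by rewrite (_ : - q + 1 + (q - 1) = 0) ?powRr0//; ring.
by rewrite mul1e.
Qed.

End scaling.

(** * Weighted means and bounds on real powers *)

Section weighted_means.
Variable R : realType.
Implicit Types (x y z u w t : R).

Lemma expR_tangent u v : expR v * (1 + (u - v)) <= expR u.
Proof.
rewrite -[in leRHS](subrK v u) expRD mulrC ler_wpM2r ?expR_ge0//.
exact: expR_ge1Dx.
Qed.

(** The tangent of the exponential at the weighted mean [v] of the logarithms gives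
    [exp v * (1 + (ln (x i) - v)) <= x i]; in the weighted sum the corrections cancel. *)
Lemma weighted_amgm n (p x : 'I_n -> R) : (forall i, 0 <= p i) ->
  \sum_i p i = 1 -> (forall i, 0 <= x i) ->
  \prod_i x i `^ p i <= \sum_i p i * x i.
Proof.
(* A vanishing [x i] with [p i != 0] kills the product. Otherwise each factor is
   [exp (p i * ln (x i))], even when [x i = 0], since then [p i = 0] and [0 ^ 0 = 1]. *)
move=> p0 p1 x0; have [/existsP[i /andP[/eqP xi pi]]|] := boolP [exists i, (x i == 0) && (p i != 0)].
  rewrite (bigD1 i)//= xi powR0// mul0r.
  by apply: sumr_ge0 => j _; exact: mulr_ge0.
rewrite negb_exists => /forallP h.
pose l i := p i * ln (x i).
have E i : x i `^ p i = expR (l i).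
  rewrite /powR /l; case: eqP => // xi; have := h i.
  by rewrite xi eqxx/= negbK => /eqP ->; rewrite eqxx mul0r expR0.
rewrite (eq_bigr (fun i => expR (l i)))//.
rewrite -(big_morph _ (@expRD R) (@expR0 R)).
set v := \sum_i l i.
have -> : expR v = \sum_i p i * (expR v * (1 + (ln (x i) - v))).
  rewrite (eq_bigr (fun i => expR v * (p i * (1 - v) + l i))); last by move=> i _; rewrite /l; ring.
  rewrite -mulr_sumr big_split/= -/v -mulr_suml p1.
  by rewrite (_ : 1 * (1 - v) + v = 1) ?mulr1//; ring.
apply: ler_sum => i _; have := h i; rewrite negb_and negbK => /orP[xi|/eqP ->].
  apply: ler_wpM2l => //; apply: (le_trans (expR_tangent _ _)).
  by rewrite lnK// posrE lt_neqAle eq_sym xi x0.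
by rewrite !mul0r.
Qed.

Lemma weighted_amgm2 t x y : 0 <= t <= 1 -> 0 <= x -> 0 <= y ->
  x `^ (1 - t) * y `^ t <= (1 - t) * x + t * y.
Proof.
move=> /andP[t0 t1] x0 y0.
have := @weighted_amgm 2 (fun i => if i == ord0 then 1 - t else t)
  (fun i => if i == ord0 then x else y).
rewrite !big_ord_recl !big_ord0/= ?addr0 ?mulr1 => -> //.
- by move=> i; case: ifP => _ //; rewrite subr_ge0.
- by ring.
- by move=> i; case: ifP.
Qed.

Lemma powR_le_chord t w : 0 <= t <= 1 -> 0 <= w -> w `^ t <= 1 - t + t * w.
Proof.
move=> t01 w0; have := weighted_amgm2 t01 (@ler01 R) w0.
by rewrite powR1 mul1r mulr1.
Qed.

Lemma powR_ge_tangent t v : 0 <= t -> 0 <= v < 1 -> 1 + t * v <= ((1 - v)^-1) `^ t.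
Proof.
move=> t0 /andP[v0 v1]; have p : 0 < 1 - v by lra.
rewrite /powR invr_eq0 gt_eqF// lnV ?posrE//.
apply: le_trans (expR_ge1Dx _); rewrite lerD2l mulrN -mulrN ler_wpM2l//.
by rewrite lerNr; have := @le_ln1Dx R (- v); apply; lra.
Qed.

(** The origin of [pl]: with [u = 1 - z], the right side is the second-order Taylor polynomial of
    [(1 - u) ^ (3/4)], whose later coefficients are all negative. Taking fourth powers makes the
    inequality polynomial. *)
Lemma powR34_le z : 0 <= z <= 1 -> z `^ (3 / 4) <= 1 - 3 / 4 * pl (1 - z).
Proof.
move=> /andP[z0 z1]; pose w := (1 - z) / 4.
have zE : z = 1 - 4 * w by rewrite /w; lra.
have w0 : 0 <= w by rewrite /w; lra.
have v0 : 0 <= 1 - 4 * w by lra.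
have BE : 1 - 3 / 4 * pl (1 - z) = 1 - 3 * w - 3 / 2 * w ^+ 2.
  by rewrite zE /pl; field.
have B0 : 0 <= 1 - 3 * w - 3 / 2 * w ^+ 2.
  have : 0 <= w * (1 - 4 * w) by exact: mulr_ge0.
  by lra.
rewrite BE -(@ler_pXn2r _ 4) ?nnegrE ?powR_ge0//.
rewrite -powR_mulrn ?powR_ge0// -powRrM (_ : 3 / 4 * 4%:R = 3%:R) ?powR_mulrn//; last by field.
rewrite zE -subr_ge0.
rewrite [leRHS](_ : _ = w ^+ 3 * (10 - 135 / 2 * w + 81 * w ^+ 2 + 108 * w ^+ 3 + 81 / 2 * w ^+ 4 + 81 / 16 * w ^+ 5)); last by field.
apply: mulr_ge0; first exact: exprn_ge0.
(* The quintic has nonnegative Bernstein coefficients on [0, 1/4]. *)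
have h0 : 0 <= (1 - 4 * w) ^+ 5 by exact: exprn_ge0.
have h1 : 0 <= w * (1 - 4 * w) ^+ 4 by apply: mulr_ge0 => //; exact: exprn_ge0.
have h2 : 0 <= w ^+ 2 * (1 - 4 * w) ^+ 3 by apply: mulr_ge0 => //; exact: exprn_ge0.
have h3 : 0 <= w ^+ 3 * (1 - 4 * w) ^+ 2 by apply: mulr_ge0 => //; exact: exprn_ge0.
have h4 : 0 <= w ^+ 4 * (1 - 4 * w) by apply: mulr_ge0 => //; exact: exprn_ge0.
have h5 : 0 <= w ^+ 5 by exact: exprn_ge0.
by lra.
Qed.

(** Since [z ^ t = (z ^ (3/4)) ^ (4t/3)], it lies below the chord from 1 to [z ^ (3/4)], which is
    linear in [t]; the case [t = 3/4] therefore suffices. This fixes the range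
    [s <= 2 + 3/4 = 11/4]. *)
Lemma powR2D_le z t : 0 <= z <= 1 -> 0 <= t <= 3 / 4 ->
  z `^ (2 + t) + t * (z ^+ 2 * pl (1 - z)) <= z ^+ 2.
Proof.
move=> /andP[z0 z1] /andP[t0 t1].
have [->|zn] := eqVneq z 0; first by rewrite powR0 ?gt_eqF; lra.
rewrite powRD ?zn ?implybT// (_ : z `^ 2 = z ^+ 2); last by rewrite -powR_mulrn.
rewrite mulrCA -mulrDr -[leRHS]mulr1; apply: ler_wpM2l; first exact: sqr_ge0.
have th : 0 <= 4 / 3 * t <= 1 by lra.
have := powR_le_chord th (powR_ge0 z (3 / 4)).
rewrite -powRrM (_ : 3 / 4 * (4 / 3 * t) = t); last by field.
move=> h; have := @powR34_le z; rewrite z0 z1 => /(_ isT) h2.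
have : 4 / 3 * t * z `^ (3 / 4) <= 4 / 3 * t * (1 - 3 / 4 * pl (1 - z)).
  by apply: ler_wpM2l => //; lra.
set A := pl _; set B := z `^ t in h *; set C := z `^ _ in h *.
by move: h => /[swap]; lra.
Qed.

End weighted_means.

Section hline_theory.
Variable R : realType.
Implicit Types (f g : R -> R) (c : R).

Lemma hline_ge0 f : (forall x, 0 < x -> 0 <= f x) -> (0 <= hline f)%E.
Proof.
by move=> f0; apply: integral_ge0 => x /=; rewrite in_itv/= andbT lee_fin; exact: f0.
Qed.

Lemma hline_mono f g : measurable_fun setT f -> measurable_fun setT g ->
  (forall x, 0 < x -> 0 <= f x) -> (forall x, 0 < x -> f x <= g x) ->
  (hline f <= hline g)%E.
Proof.
move=> mf mg f0 fg; apply: ge0_le_integral => //.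
- by move=> x /=; rewrite in_itv/= andbT lee_fin; exact: f0.
- by apply/measurable_EFinP; exact: measurable_funTS.
- by apply/measurable_EFinP; exact: measurable_funTS.
- by move=> x /=; rewrite in_itv/= andbT lee_fin; exact: fg.
Qed.

Lemma hlineD f g : measurable_fun setT f -> measurable_fun setT g ->
  (forall x, 0 < x -> 0 <= f x) -> (forall x, 0 < x -> 0 <= g x) ->
  hline (fun x => f x + g x) = (hline f + hline g)%E.
Proof.
move=> mf mg f0 g0; rewrite /hline; under eq_integral do rewrite EFinD.
apply: ge0_integralD => //.
- by move=> x /=; rewrite in_itv/= andbT lee_fin; exact: f0.
- by apply/measurable_EFinP; exact: measurable_funTS.
- by move=> x /=; rewrite in_itv/= andbT lee_fin; exact: g0.
- by apply/measurable_EFinP; exact: measurable_funTS.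
Qed.

Lemma hlineZ f c : 0 <= c -> measurable_fun setT f -> (forall x, 0 < x -> 0 <= f x) ->
  hline (fun x => c * f x) = (c%:E * hline f)%E.
Proof.
move=> c0 mf f0; rewrite /hline; under eq_integral do rewrite EFinM.
apply: ge0_integralZl => //.
- by apply/measurable_EFinP; exact: measurable_funTS.
- by move=> x /=; rewrite in_itv/= andbT lee_fin; exact: f0.
Qed.

Lemma eq_hline f g : (forall x, 0 < x -> f x = g x) -> hline f = hline g.
Proof.
by move=> fg; apply: eq_integral => x /[!inE]/=; rewrite in_itv/= andbT => /fg ->.
Qed.

End hline_theory.

(** * Comparison of the power integrals of [J0] with the one at exponent 2 *)

Section bessel_powers.
Variable R : realType.
Variable q : R.
Hypothesis q0 : 0 < q.
Hypothesis q1 : q < 1.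
Implicit Types (x s t : R).
Local Notation x0 := (x0 R).
Local Notation wt := (wt q).

Definition J0_moment s : \bar R := hline (fun x => `|J0 x| `^ s * wt x).
Definition J0_moment2 : \bar R := hline (fun x => J0 x ^+ 2 * wt x).

Lemma measurable_J0 : measurable_fun setT (@J0 R).
Proof. by apply: continuous_measurable_fun; exact: cont_J0. Qed.

Lemma measurable_absJ0_powR s : measurable_fun setT (fun x => `|@J0 R x| `^ s).
Proof.
apply: (measurableT_comp (measurable_powR s)).
exact: (measurableT_comp (@normr_measurable R setT) measurable_J0).
Qed.

Lemma measurable_J0_moment s : measurable_fun setT (fun x => `|J0 x| `^ s * wt x).
Proof. by apply: measurable_funM; [exact: measurable_absJ0_powR|exact: measurable_wt]. Qed.

Lemma measurable_J0sq : measurable_fun setT (fun x => @J0 R x ^+ 2).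
Proof. by apply: measurable_funX; exact: measurable_J0. Qed.

Lemma measurable_J0_moment2 : measurable_fun setT (fun x => J0 x ^+ 2 * wt x).
Proof. by apply: measurable_funM; [exact: measurable_J0sq|exact: measurable_wt]. Qed.

Lemma J0_moment_integrand_ge0 s x : 0 <= `|J0 x| `^ s * wt x.
Proof. by rewrite mulr_ge0 ?powR_ge0// wt_ge0. Qed.

Lemma J0_moment2_integrand_ge0 x : 0 <= J0 x ^+ 2 * wt x.
Proof. by rewrite mulr_ge0 ?sqr_ge0// wt_ge0. Qed.

Lemma J0_moment2_ge0 : (0 <= J0_moment2)%E.
Proof. by apply: hline_ge0 => x _; exact: J0_moment2_integrand_ge0. Qed.

Lemma J0_moment_near2 t : 0 <= t <= 3 / 4 -> (J0_moment (2 + t) + (t * (q / 4))%:E * J0_moment2 <= J0_moment2)%E.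
Proof.
move=> t01; have /andP[t0 t1] := t01.
have mpl : measurable_fun setT (fun x => J0 x ^+ 2 * pl (1 - `|J0 x|) * wt x).
  apply: measurable_funM; last exact: measurable_wt.
  by apply: continuous_measurable_fun; exact: cont_u_J0.
have pl0 x : 0 <= J0 x ^+ 2 * pl (1 - `|J0 x|) * wt x.
  apply: mulr_ge0 (wt_ge0 _ _); apply: mulr_ge0 (sqr_ge0 _) _.
  by apply: pl_ge0; rewrite subr_ge0 J0_le1.
have A : ((q / 4)%:E * J0_moment2 <= hline (fun x => J0 x ^+ 2 * pl (1 - `|J0 x|) * wt x)%R)%E.
  rewrite -hlineZ.
  - exact: hline_J0_deficit_ge.
  - by rewrite divr_ge0// ltW.
  - exact: measurable_J0_moment2.
  - by move=> x _; exact: J0_moment2_integrand_ge0.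
rewrite EFinM -muleA.
apply: (@le_trans _ _ (J0_moment (2 + t) + t%:E * hline (fun x => J0 x ^+ 2 * pl (1 - `|J0 x|) * wt x)%R)%E).
  by apply: leeD2l; apply: lee_wpmul2l => //; rewrite lee_fin.
rewrite -hlineZ// -hlineD; last 4 first.
- exact: measurable_J0_moment.
- exact: measurable_funM.
- by move=> x _; exact: J0_moment_integrand_ge0.
- by move=> x _; rewrite mulr_ge0.
apply: hline_mono.
- apply: measurable_funD; first exact: measurable_J0_moment.
  exact: measurable_funM.
- exact: measurable_J0_moment2.
- by move=> x _; rewrite addr_ge0 ?J0_moment_integrand_ge0// mulr_ge0.
- move=> x _; rewrite mulrA -mulrDl ler_wpM2r ?wt_ge0//.
  have := @powR2D_le _ `|J0 x| t; rewrite normr_ge0 J0_le1 real_normK ?num_real//.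
  by apply.
Qed.

Lemma J0_moment2_y_le s : J0_moment2 = +oo%E -> 0 < s ->
  (J0_moment s <= ((2 / s) `^ (q / 2))%:E * J0_moment2)%E.
Proof.
move=> -> s0; rewrite gt0_muley ?leey// lte_fin.
by apply: powR_gt0; rewrite divr_gt0.
Qed.

(** With [z = t q / 4] the integral is at most [1 - z] times that at 2, while
    [(s / 2) ^ (q / 2) <= 1 + z] by concavity; and [(1 - z)(1 + z) <= 1]. *)
Lemma J0_moment_le_near s : 2 <= s <= 11 / 4 -> (J0_moment s <= ((2 / s) `^ (q / 2))%:E * J0_moment2)%E.
Proof.
move=> /andP[s2 s3]; have sp : 0 < s by lra.
have [/(@J0_moment2_y_le s)|fin] := eqVneq J0_moment2 +oo%E; first exact.
have {}fin : J0_moment2 \is a fin_num by rewrite ge0_fin_numE ?J0_moment2_ge0// ltey.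
have [t /andP[t0 t1] sE] : exists2 t, 0 <= t <= 3 / 4 & s = 2 + t.
  by exists (s - 2); [apply/andP; split; lra|ring].
have t01 : 0 <= t <= 3 / 4 by rewrite t0.
have := J0_moment_near2 t01; rewrite -sE.
have P0 := J0_moment2_ge0; rewrite -(fineK fin) -EFinM; rewrite -(fineK fin) lee_fin in P0.
move: (fine _) P0 => F F0; rewrite -leeBrDr// -EFinB => h.
apply: (le_trans h); rewrite -EFinM lee_fin -[X in X - _]mul1r -mulrBl.
apply: ler_wpM2r => //.
have Q0 := q0; have Q1 := q1.
have q2 : 0 <= q / 2 <= 1 by lra.
have := powR_le_chord q2 (ltW (divr_gt0 sp (@ltr0Sn R 1))).
have -> : 2 / s = (s / 2)^-1 by rewrite invf_div.
rewrite -(@powR_inv1 _ (s / 2)); last by lra.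
rewrite -powRrM (mulrC (- 1) (q / 2)) (powRrM _ _ (- 1)) powR_inv1 ?powR_ge0// => hc.
have p : 0 < (s / 2) `^ (q / 2) by apply: powR_gt0; lra.
rewrite -[leLHS]mulr1 -[leRHS]mul1r ler_pdivlMr// mulr1.
have hc' : (s / 2) `^ (q / 2) <= 1 + t * (q / 4) by apply: (le_trans hc); rewrite sE; lra.
have tq : 0 <= t * (q / 4) <= 1.
  apply/andP; split; first by apply: mulr_ge0 => //; lra.
  by rewrite -[leRHS](mulr1 1); apply: ler_pM => //; lra.
move: hc' tq; move: (t * (q / 4)) => z hz /andP[z0 z1].
apply: (@le_trans _ _ ((1 - z) * (1 + z))); first by apply: ler_wpM2l; lra.
have := sqr_ge0 z; lra.
Qed.

(** As [sqrt (s / 2) >= 1], the power is bounded below by its value for [q = 1]. After squaring, the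
    claim at [s = 7/2] is [(21/50)^3 * 7/4 <= (37/100)^2], with little to spare; this determines
    [37 / 100]. *)
Lemma scale_bound_far s : 7 / 2 <= s ->
  (21 / 50 : R) `^ (s - 2) <= 37 / 100 * Num.sqrt (s / 2) `^ (- q).
Proof.
move=> s7; have c1 : 1 <= Num.sqrt (s / 2) by rewrite -[leLHS]sqrtr1 ler_sqrt; lra.
set c := Num.sqrt _ in c1 *; have cp : 0 < c by lra.
have Q0 := q0; have Q1 := q1.
have hc : c^-1 <= c `^ (- q).
  by rewrite -(powR_inv1 (ltW cp)); apply: ler_powR => //; lra.
apply: (@le_trans _ _ (37 / 100 * c^-1)); last by apply: ler_wpM2l => //; lra.
rewrite ler_pdivlMr//.
rewrite -(@ler_pXn2r _ 2) ?nnegrE//; last by apply: mulr_ge0; [exact: powR_ge0|exact: ltW].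
rewrite exprMn sqr_sqrtr; last by lra.
rewrite -powR_mulrn ?powR_ge0// -powRrM.
have [t t0 ->] : exists2 t, 0 <= t & s = 7 / 2 + t by exists (s - 7 / 2); lra.
have -> : (7 / 2 + t - 2) * 2%:R = 3%:R + 2%:R * t :> R by field.
rewrite powRD; last by apply/implyP => _; lra.
rewrite powR_mulrn; last by lra.
(* Here [s / 2 = 7/4 * (1 + 2t/7)], and the exponential decay in [t] beats this linear growth. *)
have ht : (21 / 50 : R) `^ (2%:R * t) * (1 + 2 / 7 * t) <= 1.
  rewrite powRrM powR_mulrn; last by lra.
  have p : 0 < (21 / 50 : R) ^+ 2 by apply: exprn_gt0; lra.
  rewrite /powR gt_eqF//.
  have l1 : ln ((21 / 50 : R) ^+ 2) <= - (2 / 7).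
    have -> : (21 / 50 : R) ^+ 2 = 1 + ((21 / 50 : R) ^+ 2 - 1) by ring.
    by apply: (le_trans (@le_ln1Dx R _ _)); lra.
  apply: (@le_trans _ _ (expR (t * ln ((21 / 50 : R) ^+ 2)) * expR (2 / 7 * t))).
    by apply: ler_wpM2l; [exact: expR_ge0|exact: expR_ge1Dx].
  rewrite -expRD -[leRHS]expR0 ler_expR.
  have : 0 <= t * (- (2 / 7) - ln ((21 / 50 : R) ^+ 2)) by apply: mulr_ge0; lra.
  by set l := ln _; lra.
by set z := _ `^ _ in ht *; lra.
Qed.

(** Before [x0], [J0 ^ s <= exp (- s x ^ 2 / 4) = g (c x)] with [c = sqrt (s / 2)], and the
    substitution yields exactly [c ^ (- q) = (2 / s) ^ (q / 2)]. Beyond [x0],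
    [|J0| ^ s <= (21/50) ^ (s - 2) * J0 ^ 2]. *)
Lemma J0_moment_le_far s : 7 / 2 <= s -> (J0_moment s <= ((2 / s) `^ (q / 2))%:E * J0_moment2)%E.
Proof.
move=> s7; have sp : 0 < s by lra.
have Q0 := q0; have Q1 := q1.
pose c := Num.sqrt (s / 2); have cp : 0 < c by rewrite sqrtr_gt0; lra.
have c2 : c ^+ 2 = s / 2 by rewrite sqr_sqrtr; lra.
have cE : (2 / s) `^ (q / 2) = c `^ (- q).
  have -> : 2 / s = c `^ (- 2%:R).
    by rewrite powRN powR_mulrn ?(ltW cp)// c2 invf_div.
  by rewrite -powRrM; congr (_ `^ _); field.
pose g x : R := expR (- (x ^+ 2 / 2)).
have g0 x : 0 <= g x by exact: expR_ge0.
have mg : measurable_fun setT g.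
  by apply: continuous_measurable_fun; rewrite /g; cont.
have mgw : measurable_fun setT (fun x => g x * wt x).
  by apply: measurable_funM => //; exact: measurable_wt.
have mgc : measurable_fun setT (fun x => g (c * x)).
  by apply: (measurableT_comp mg); exact: measurable_dilate.
have mgcw : measurable_fun setT (fun x => g (c * x) * wt x).
  by apply: measurable_funM => //; exact: measurable_wt.
pose i x : R := \1_(`]x0, +oo[%classic) x * (J0 x ^+ 2 * wt x).
have i0 x : 0 <= i x by apply: mulr_ge0 => //; exact: J0_moment2_integrand_ge0.
have mi : measurable_fun setT i.
  by apply: measurable_funM; [exact: measurable_indic|exact: measurable_J0_moment2].
have B : (hline (fun x => g x * wt x)%R + (37 / 100)%:E * hline i <= J0_moment2)%E.
  rewrite -hlineZ//.
  rewrite -hlineD//.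
  - exact: hline_J0_gauss_le.
  - exact: measurable_funM.
  - by move=> x _; rewrite mulr_ge0// wt_ge0.
  - by move=> x _; rewrite mulr_ge0//; lra.
have gw0 x : 0 < x -> 0 <= g x * wt x by move=> _; rewrite mulr_ge0// wt_ge0.
have G0 := hline_ge0 gw0; have I0 := @hline_ge0 _ i (fun x _ => i0 x).
pose m := (21 / 50 : R) `^ (s - 2).
apply: (@le_trans _ _ (hline (fun x => g (c * x)%R * wt x)%R + m%:E * hline i)%E).
  rewrite -hlineZ ?powR_ge0// -hlineD//; last 3 first.
  - exact: measurable_funM.
  - by move=> x _; rewrite mulr_ge0// wt_ge0.
  - by move=> x _; rewrite mulr_ge0// powR_ge0.
  apply: hline_mono.
  - exact: measurable_J0_moment.
  - by apply: measurable_funD => //; exact: measurable_funM.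
  - by move=> x _; exact: J0_moment_integrand_ge0.
  move=> x xp; rewrite /i indicE; have [xx|xx] := leP x x0.
    rewrite memNset ?mul0r ?mulr0 ?addr0; last by rewrite /= in_itv/= andbT; apply/negP; rewrite -leNgt.
    apply: ler_wpM2r; first exact: wt_ge0.
    have hx : 0 < x <= x0 by rewrite xp.
    have /andP[j0 j1] := J0_range hx; rewrite gtr0_norm//.
    apply: (@le_trans _ _ (expR (- (x ^+ 2 / 4)) `^ s)).
      by apply: ge0_ler_powR; rewrite ?nnegrE ?expR_ge0 ?(ltW sp) ?(ltW j0)//; exact: J0_le_exp.
    rewrite /powR gt_eqF ?expR_gt0// expRK /g ler_expR exprMn c2.
    by rewrite le_eqVlt; apply/orP; left; apply/eqP; field.
  rewrite mem_set ?mul1r/=; last by rewrite in_itv/= andbT.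
  apply: (@le_trans _ _ (m * (J0 x ^+ 2 * wt x))); last first.
    by rewrite lerDr mulr_ge0// wt_ge0.
  rewrite mulrA; apply: ler_wpM2r; first exact: wt_ge0.
  have [->|zn] := eqVneq (J0 x) 0; first by rewrite normr0 powR0 ?expr0n/= ?mulr0// gt_eqF.
  rewrite -[X in _ `^ X](subrK 2) powRD; last by rewrite normr_eq0 zn implybT.
  rewrite [X in _ * X](_ : _ = J0 x ^+ 2); last by rewrite (powR_mulrn 2 (normr_ge0 _)) real_normK ?num_real.
  apply: ler_wpM2r; first exact: sqr_ge0.
  apply: ge0_ler_powR; rewrite ?nnegrE ?normr_ge0//; try lra.
  by apply: J0_le_m; exact: ltW.
rewrite (@hline_scale _ q g c cp mg)// cE.
apply: le_trans (lee_wpmul2l _ B); last by rewrite lee_fin powR_ge0.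
rewrite (ge0_muleDr _ G0); last by apply: mule_ge0.
apply: leeD2l; rewrite muleA -EFinM; apply: lee_wpmul2r => //.
by rewrite lee_fin mulrC; exact: scale_bound_far.
Qed.

End bessel_powers.

Section bessel_power_inequality.
Variable R : realType.
Variable q : R.
Hypothesis q0 : 0 < q.
Hypothesis q1 : q < 1.
Implicit Types (x s t : R).
Local Notation wt := (wt q).
Local Notation J0_moment := (J0_moment q).
Local Notation J0_moment2 := (J0_moment2 q).

(** What the interpolation between [11/4] and [7/2] requires at its lower end, where [v = 3/14] and
    [1 + q v / 2 = 1 + 3 q / 28]. *)
Lemma chord_num : 1 - 3 / 16 * q <= (4 / 7 : R) `^ (q / 2) * (1 + 3 / 28 * q).
Proof.
have Q0 := q0; have Q1 := q1.
have l1 : - (9 / 16) <= ln (4 / 7 : R).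
  rewrite -ler_expR lnK ?posrE; last by lra.
  have h : 0 <= 9 / 16 :> R by lra.
  have := exp_taylor4 h; rewrite subr_ge0 => h2; apply: (le_trans h2); lra.
(* From [ln (4/7) >= - 9/16] the power is at least [exp (- 9 q / 32)], the square of
   [exp (- 9 q / 64)]. *)
have h1 : (1 - 9 / 64 * q) ^+ 2 <= (4 / 7 : R) `^ (q / 2).
  rewrite /powR gt_eqF; last by lra.
  apply: (@le_trans _ _ (expR (- (9 / 64 * q)) ^+ 2)).
    rewrite ler_sqr ?nnegrE ?expR_ge0//; last by lra.
    exact: expR_ge1Dx.
  rewrite -expRM_natl ler_expR.
  have : 0 <= q * (ln (4 / 7 : R) + 9 / 16) by apply: mulr_ge0; lra.
  by set l := ln _; lra.
apply: (@le_trans _ _ ((1 - 9 / 64 * q) ^+ 2 * (1 + 3 / 28 * q))); last first.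
  by apply: ler_wpM2r => //; lra.
have h2 : 0 <= q * (1 - q) by apply: mulr_ge0; lra.
have h3 : 0 <= q * q * q by rewrite !mulr_ge0//; lra.
by lra.
Qed.

(* [|J0| ^ s] lies below its chord in [s] between 11/4 and 7/2. *)
Lemma J0_moment_le_mid s : 11 / 4 <= s <= 7 / 2 -> (J0_moment s <= ((2 / s) `^ (q / 2))%:E * J0_moment2)%E.
Proof.
move=> /andP[s2 s3]; have sp : 0 < s by lra.
have Q0 := q0; have Q1 := q1.
have [/(@J0_moment2_y_le _ _ s)|fin] := eqVneq J0_moment2 +oo%E; first exact.
have {}fin : J0_moment2 \is a fin_num by rewrite ge0_fin_numE ?J0_moment2_ge0// ltey.
(* Measured from [7/2], so that [2 / s = (4/7) / (1 - v)]; [v = 3/14] is [s = 11/4], and [t] below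
   runs from 0 there to 1 at [7/2]. *)
have [v /andP[v0 v1] sE] : exists2 v, 0 <= v <= 3 / 14 & s = 7 / 2 * (1 - v).
  by exists (1 - 2 / 7 * s); [apply/andP; split; lra|field].
pose t := 1 - 14 / 3 * v.
have t0 : 0 <= t by rewrite /t; lra.
have t1 : 0 <= 1 - t by rewrite /t; lra.
have hA : (J0_moment (11 / 4) + (3 / 16 * q)%:E * J0_moment2 <= J0_moment2)%E.
  have h : 0 <= (3 / 4 : R) <= 3 / 4 by apply/andP; split; lra.
  have := J0_moment_near2 q0 q1 h.
  by rewrite (_ : 2 + 3 / 4 = 11 / 4 :> R) 1?(_ : 3 / 4 * (q / 4) = 3 / 16 * q)//; field.
have hB := J0_moment_le_far q0 q1 (lexx (7 / 2)).
rewrite (_ : 2 / (7 / 2) = 4 / 7 :> R) in hB; last by field.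
have hS : (J0_moment s <= (1 - t)%:E * J0_moment (11 / 4) + t%:E * J0_moment (7 / 2))%E.
  have g0 c r : 0 <= c -> forall x, 0 < x -> 0 <= c * (`|J0 x| `^ r * wt x).
    by move=> c0 x _; rewrite mulr_ge0// J0_moment_integrand_ge0.
  have mm c r : measurable_fun setT (fun x => c * (`|J0 x| `^ r * wt x)).
    by apply: measurable_funM => //; exact: measurable_J0_moment.
  rewrite -!hlineZ//; try (by exact: measurable_J0_moment); try (by move=> x _; exact: J0_moment_integrand_ge0).
  rewrite -hlineD; [|exact: mm|exact: mm|exact: g0|exact: g0].
  apply: hline_mono; [exact: measurable_J0_moment| |by move=> x _; exact: J0_moment_integrand_ge0|].
    by apply: measurable_funD; exact: mm.
  move=> x _; rewrite !mulrA -mulrDl; apply: ler_wpM2r; first exact: wt_ge0.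
  have t01 : 0 <= t <= 1 by apply/andP; split=> //; lra.
  have := weighted_amgm2 t01 (powR_ge0 `|J0 x| (11 / 4)) (powR_ge0 `|J0 x| (7 / 2)).
  have tE : 11 / 4 * (1 - t) + 7 / 2 * t = s by rewrite sE /t; field.
  by rewrite -!powRrM -powRD tE ?(gt_eqF sp).
apply: (le_trans hS).
have P0 (c : R) : 0 <= c -> (0 <= c%:E * J0_moment2)%E.
  by move=> c0; apply: mule_ge0; [rewrite lee_fin|exact: J0_moment2_ge0].
have P2 := J0_moment2_ge0 q.
rewrite -(fineK fin) -!EFinM in hA hB P2 *.
rewrite -leeBrDr// -EFinB in hA.
set F := fine _ in hA hB P2 *; rewrite lee_fin in P2.
apply: (@le_trans _ _ ((1 - t)%:E * (F - 3 / 16 * q * F)%:E + t%:E * ((4 / 7) `^ (q / 2) * F)%:E)%E).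
  by apply: leeD; apply: lee_wpmul2l; rewrite ?lee_fin.
rewrite -!EFinM -EFinD lee_fin.
have -> : (1 - t) * (F - 3 / 16 * q * F) + t * ((4 / 7) `^ (q / 2) * F) =
   ((1 - t) * (1 - 3 / 16 * q) + t * (4 / 7) `^ (q / 2)) * F by ring.
apply: ler_wpM2r => //.
have -> : 2 / s = 4 / 7 * (1 - v)^-1 by rewrite sE; field; lra.
rewrite (@powRM _ (4 / 7) (1 - v)^-1); [|lra|by rewrite invr_ge0; lra].
have v01 : 0 <= v < 1 by apply/andP; split=> //; lra.
have q20 : 0 <= q / 2 by lra.
have hv := powR_ge_tangent q20 v01.
(* The tangent at [v = 0] makes both sides affine in [v]: they agree at [s = 7/2], and the other end
   is [chord_num]. *)
apply: (@le_trans _ _ ((4 / 7) `^ (q / 2) * (1 + q / 2 * v))); last first.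
  by apply: ler_wpM2l => //; exact: powR_ge0.
have := ler_wpM2l t1 chord_num.
set A := _ `^ _; have -> : v = (1 - t) * (3 / 14) by rewrite /t; field.
by lra.
Qed.

Lemma J0_moment_le s : 2 <= s -> (J0_moment s <= ((2 / s) `^ (q / 2))%:E * J0_moment2)%E.
Proof.
move=> s2; have [h|h] := leP s (11 / 4); first by apply: J0_moment_le_near => //; rewrite s2.
have [h'|h'] := leP s (7 / 2); first by apply: J0_moment_le_mid; rewrite h' ltW.
by apply: J0_moment_le_far => //; exact: ltW.
Qed.

(** With [s = 1 / a ^ 2] the factors combine to [a ^ (- q) * (2 a ^ 2) ^ (q / 2) = 2 ^ (q / 2)],
    which is the scaling factor of the right side: [a] disappears. *)
Lemma bessel_power_le a : 0 < a -> a ^+ 2 <= 1 / 2 ->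
  (hline (fun x => `|J0 (a * x)| `^ (a ^- 2) * wt x)%R <=
   hline (fun x => J0 ((Num.sqrt 2)^-1 * x) ^+ 2 * wt x)%R)%E.
Proof.
move=> a0 a2; have r0 : 0 < Num.sqrt 2 :> R by rewrite sqrtr_gt0.
rewrite (@hline_scale _ q (fun x => `|J0 x| `^ (a ^- 2)) a a0 (measurable_absJ0_powR _)); last first.
  by move=> x _; exact: powR_ge0.
rewrite (@hline_scale _ q (fun x => J0 x ^+ 2) _ _ (@measurable_J0sq R)); last first.
- by move=> x _; exact: sqr_ge0.
- by rewrite invr_gt0.
have s2 : 2 <= a ^- 2.
  rewrite -[leLHS]invrK lef_pV2 ?posrE ?invr_gt0 ?exprn_gt0//; lra.
apply: (le_trans (lee_wpmul2l _ (J0_moment_le s2))); first by rewrite lee_fin powR_ge0.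
rewrite muleA -EFinM le_eqVlt; apply/orP; left; apply/eqP; congr (_%:E * _)%E.
have an : a != 0 by rewrite gt_eqF.
rewrite invrK powRM ?sqr_ge0// -(powR_mulrn _ (ltW a0)) -powRrM.
rewrite (_ : 2%:R * (q / 2) = q); last by field.
rewrite mulrCA -powRD ?an ?implybT// addNr powRr0 mulr1.
have -> : (Num.sqrt 2)^-1 = 2 `^ (- (1 / 2)) :> R.
  by rewrite -powR12_sqrt// powRN mul1r.
by rewrite -powRrM; congr (_ `^ _); field.
Qed.

End bessel_power_inequality.

(** * Averages over the circle *)

Section translation.
Variable R : realType.
Implicit Types (x y a b c : R).
Notation mu := (@lebesgue_measure R).

Definition translate c : measurableTypeR R -> measurableTypeR R := fun x => x + c.

Lemma measurable_translate c : measurable_fun setT (translate c).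
Proof. by apply: measurable_funD; [exact: measurable_id|exact: measurable_cst]. Qed.

Definition translate_measure c : {measure set (measurableTypeR R) -> \bar R} :=
  measure_function_pushforward__canonical__measure_function_Measure mu (measurable_translate c).

Lemma lebesgue_translate c A : measurable A -> mu A = translate_measure c A.
Proof.
move=> mA; apply: lebesgue_measure_unique => //= _ [[a b]] _ <-.
rewrite /translate_measure /= /pushforward.
have -> : translate c @^-1` `]a, b] = `](a - c), (b - c)]%classic.
  by apply/seteqP; split => x /=; rewrite /translate !in_itv/= ltrBlDr lerBrDr.
by rewrite !lebesgue_measure_itv/= !lte_fin ltrD2r -!EFinB; case: ifP => // _; congr EFin; ring.
Qed.

Lemma integral_translate c a b (f : R -> \bar R) : measurable_fun setT f ->
  (forall x, 0 <= f x)%E ->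
  (\int[mu]_(x in `[a, b]) f (x + c)%R = \int[mu]_(x in `[(a + c)%R, (b + c)%R]) f x)%E.
Proof.
move=> mf f0; apply/esym.
rewrite (@eq_measure_integral _ _ _ _ (translate_measure c)); last first.
  by move=> A mA _; exact: lebesgue_translate.
rewrite (@ge0_integral_pushforward _ _ _ _ R (translate c) (measurable_translate c)) //; last first.
  exact: measurable_funTS.
rewrite (_ : translate c @^-1` `[a + c, b + c] = `[a, b]%classic)//.
by apply/seteqP; split => x /=; rewrite /translate !in_itv/= !lerD2r.
Qed.

End translation.

Section uniform_average.
Variable R : realType.
Implicit Types (f g : R -> \bar R).
Notation mu := (@lebesgue_measure R).

(** The extended-real counterpart of [cavg]: it accepts integrands such as [neg_pow], which take the
    value [+oo]. *)
Definition eavg f : \bar R := (\int[uniform_prob (@pi2_gt0 R)]_t f t)%E.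

Lemma eavgE f : measurable_fun setT f -> (forall x, 0 <= f x)%E ->
  eavg f = (((pi *+ 2)^-1)%:E * \int[mu]_(x in `[0%R, (pi *+ 2)%R]) f x)%E.
Proof. by move=> mf f0; rewrite /eavg integral_uniform// subr0. Qed.

Lemma eavg_cst (c : \bar R) : eavg (fun=> c) = c.
Proof.
rewrite /eavg integral_cst// -[RHS]mule1; congr (_ * _)%E.
exact: (@probability_setT _ _ _ (uniform_prob (@pi2_gt0 R))).
Qed.

Lemma eavg_cavg (f : R -> R) : continuous f -> (forall t, 0 <= f t) ->
  eavg (EFin \o f) = (cavg f)%:E.
Proof.
move=> cf f0; rewrite eavgE.
- rewrite /cavg EFinM; congr (_ * _)%E.
  rewrite fineK//; apply: integrable_fin_num => //; exact: circle_integrable.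
- by apply/measurable_EFinP; exact: continuous_measurable_fun.
- by move=> x; rewrite lee_fin.
Qed.

(** Rotation invariance: the shifted period is cut at [2 pi], and its second piece is moved back by
    one period. *)
Lemma eavg_shift f (phi : R) : measurable_fun setT f -> (forall x, 0 <= f x)%E ->
  (forall t, f (t + pi *+ 2) = f t) -> 0 <= phi <= pi *+ 2 ->
  eavg (fun t => f (t + phi)) = eavg f.
Proof.
move=> mf f0 fp /andP[p0 p1].
have mfs : measurable_fun setT (fun t : R => f (t + phi)).
  by apply: (measurableT_comp mf); exact: measurable_translate.
rewrite !eavgE//; congr (_ * _)%E; rewrite integral_translate// add0r.
rewrite (integral_itv_cat mf (fun x _ => f0 x) p1) ?lerDl//.
rewrite (integral_itv_cat mf (fun x _ => f0 x) p0 p1) addeC; congr (_ + _)%E.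
have := @integral_translate R (pi *+ 2) 0 phi f mf f0.
rewrite add0r (addrC phi) => <-.
by apply: eq_integral => x _; rewrite fp.
Qed.

End uniform_average.

(** Inverses are treated apart from [der] because they leave a nonvanishing condition to prove. *)
Ltac derI := repeat (der; lazymatch goal with
  | |- hder _ (fun x => (@?f x)^-1) _ => apply: (@derV _ _ f)
  end).

(** * Rotations and the radial kernel *)

Section circle_integrals.
Variable R : realType.
Implicit Types (x y r t a b : R).

(** The phase is kept in [[0, 2 pi]] for [eavg_shift]. As [cos (t + phi)] contributes [- sin phi] to
    [sin t], it is [acos c] for [y <= 0] and [2 pi - acos c] for [y > 0]. *)
Lemma polar x y : exists2 phi, 0 <= phi <= pi *+ 2 &
  forall t, x * cos t + y * sin t = Num.sqrt (x ^+ 2 + y ^+ 2) * cos (t + phi).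
Proof.
set r := Num.sqrt _; have xy0 : 0 <= x ^+ 2 + y ^+ 2 by rewrite addr_ge0 ?sqr_ge0.
have r2 : r ^+ 2 = x ^+ 2 + y ^+ 2 by rewrite sqr_sqrtr.
have p0 := pi_ge0 R.
have [r0|rn] := eqVneq r 0.
  exists 0; first by rewrite lexx/= mulrn_wge0.
  move=> t; rewrite r0 mul0r.
  have : x ^+ 2 + y ^+ 2 == 0 by rewrite -r2 r0 expr0n.
  by rewrite paddr_eq0 ?sqr_ge0// !sqrf_eq0 => /andP[/eqP -> /eqP ->]; rewrite !mul0r addr0.
have rp : 0 < r by rewrite lt_neqAle eq_sym rn sqrtr_ge0.
pose c := x / r.
have c1 : -1 <= c <= 1.
  rewrite -ler_norml -(@ler_pXn2r _ 2) ?nnegrE ?normr_ge0// real_normK ?num_real//.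
  rewrite expr1n /c expr_div_n ler_pdivrMr ?exprn_gt0// mul1r r2 lerDl; exact: sqr_ge0.
have xE : x = r * cos (acos c) by rewrite acosK ?in_itv//= /c mulrC divfK.
have yE : `|y| = r * sin (acos c).
  rewrite sin_acos// -sqrtr_sqr -[X in X * _](ger0_norm (ltW rp)) -sqrtr_sqr -sqrtrM ?sqr_ge0//.
  by congr Num.sqrt; rewrite /c mulrBr mulr1 expr_div_n mulrCA divff ?expf_neq0// mulr1 r2; ring.
have a0 : 0 <= acos c by rewrite acos_ge0.
have ap : acos c <= pi by rewrite acos_lepi.
have [y0|y0] := leP y 0.
  exists (acos c); first by rewrite a0/= mulr2n; lra.
  move=> t; rewrite cosD mulrBr [X in X * cos t]xE.
  have -> : y = - (r * sin (acos c)) by rewrite -yE ler0_norm ?opprK.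
  by ring.
exists (pi *+ 2 - acos c); first by rewrite mulr2n; apply/andP; split; lra.
move=> t; rewrite (_ : t + (pi *+ 2 - acos c) = (t - acos c) + pi *+ 2); last by ring.
rewrite cosD2pi cosB mulrDr [X in X * cos t]xE.
have -> : y = r * sin (acos c) by rewrite -yE gtr0_norm.
by ring.
Qed.

Lemma eavg_rot (f : R -> \bar R) x y : measurable_fun setT f -> (forall u, 0 <= f u)%E ->
  eavg (fun t => f (x * cos t + y * sin t)) =
  eavg (fun t => f (Num.sqrt (x ^+ 2 + y ^+ 2) * cos t)).
Proof.
move=> mf f0; have [phi hp E] := polar x y.
under [in LHS]eq_fun do rewrite E.
apply: (@eavg_shift _ (fun t => f (Num.sqrt (x ^+ 2 + y ^+ 2) * cos t)) phi) => //.
- apply: (measurableT_comp mf).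
  by apply: continuous_measurable_fun; cont.
- by move=> t; rewrite cosD2pi.
Qed.

(** A shift by [pi] reverses the sign; 1 is added because [eavg_shift] concerns nonnegative
    functions. *)
Lemma cavg_sin_cos b : cavg (fun t => sin (b * cos t)) = 0.
Proof.
pose f t := (1 + sin (b * cos t))%:E.
have cf : continuous (fun t => 1 + sin (b * cos t)) by cont.
have f0 t : 0 <= 1 + sin (b * cos t) by have := sin_geN1 (b * cos t); lra.
have cg : continuous (fun t => 1 - sin (b * cos t)) by cont.
have g0 t : 0 <= 1 - sin (b * cos t) by have := sin_le1 (b * cos t); lra.
have E : eavg (fun t => f (t + pi)) = eavg f.
  apply: eavg_shift => //.
  - by apply/measurable_EFinP; exact: continuous_measurable_fun.
  - by move=> t; rewrite /f cosD2pi.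
  - by rewrite pi_ge0 mulr2n lerDl pi_ge0.
rewrite (_ : (fun t => f (t + pi)) = EFin \o (fun t => 1 - sin (b * cos t))) in E; last first.
  by apply/funext => t; rewrite /f/= cosDpi mulrN sinN.
rewrite !eavg_cavg// in E.
have circ_point : continuous (fun t => sin (b * cos t)) by cont.
have cN : continuous (fun t => - sin (b * cos t)) by cont.
have c1 : continuous (fun _ : R => 1 : R) by cont.
have := congr1 fine E; rewrite /= (cavgD c1 cN) (cavgD c1 circ_point) cavgN//; lra.
Qed.

Lemma eavg_cos_circle a b x y : x ^+ 2 + y ^+ 2 = 1 ->
  eavg (fun t => (1 + cos (a + b * (x * cos t + y * sin t)))%:E) =
  (1 + cos a * J0 b)%:E.
Proof.
move=> xy1; have mf : measurable_fun setT (fun u : R => 1 + cos (a + b * u)).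
  by apply: continuous_measurable_fun; cont.
rewrite (@eavg_rot (fun u => (1 + cos (a + b * u))%:E)); last 2 first.
- exact/measurable_EFinP.
- by move=> u; rewrite lee_fin; have := cos_geN1 (a + b * u); lra.
rewrite xy1 sqrtr1.
rewrite (_ : (fun t => _) = EFin \o (fun t => 1 + cos (a + b * cos t))); last first.
  by apply/funext => t /=; rewrite mul1r.
rewrite eavg_cavg; [|by cont|by move=> t; have := cos_geN1 (a + b * cos t); lra].
congr EFin; rewrite (@eq_cavg _ _ (fun t => (1 + cos a * cos (b * cos t)) + (- sin a) * sin (b * cos t))); last first.
  by move=> t /=; rewrite cosD; ring.
rewrite cavgD; [|by cont|by cont].
rewrite cavgD; [|by cont|by cont].
rewrite cavg_cst !cavgZ; [|by cont|by cont].
by rewrite cavg_sin_cos mulr0 addr0.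
Qed.

Definition circ_kernel r : R := cavg (fun t => (1 + (r * cos t) ^+ 2)^-1).

Lemma circ_kernel_den_gt0 r t : 0 < 1 + (r * cos t) ^+ 2.
Proof. by have := sqr_ge0 (r * cos t); lra. Qed.

Lemma der_circ_kernel r : hder r circ_kernel (cavg (fun t => - (2 * r * cos t ^+ 2) / (1 + (r * cos t) ^+ 2) ^+ 2)).
Proof.
apply: (@cavg_derive _ (fun r t => (1 + (r * cos t) ^+ 2)^-1)
  (fun r t => - (2 * r * cos t ^+ 2) / (1 + (r * cos t) ^+ 2) ^+ 2) r 1 (2 * (`|r| + 1))) => //.
- by move=> z _; apply: contV; [by move=> u; rewrite gt_eqF// circ_kernel_den_gt0|cont].
- move=> z t _; have h := circ_kernel_den_gt0 z t; apply: der_eq; first by derI; rewrite gt_eqF.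
  by rewrite /=; field; rewrite gt_eqF.
- move=> z t hz; have h := circ_kernel_den_gt0 z t.
  have zr : `|z| <= `|r| + 1.
    by rewrite -[z in leLHS](subrK r) (le_trans (ler_normD _ _))// addrC lerD2l ltW.
  rewrite normrM normrN normfV.
  have -> : `|2 * z * cos t ^+ 2| = 2 * `|z| * cos t ^+ 2.
    by rewrite normrM (ger0_norm (sqr_ge0 (cos t))) normrM [ `|2|]gtr0_norm.
  rewrite (gtr0_norm (exprn_gt0 2 h)) ler_pdivrMr ?exprn_gt0// -!mulrA ler_pM2l//.
  have c1 : cos t ^+ 2 <= 1 by rewrite -[leRHS](cos2Dsin2 t) lerDl sqr_ge0.
  have d1 : 1 <= (1 + (z * cos t) ^+ 2) ^+ 2.
    by rewrite exprn_ege1// lerDl sqr_ge0.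
  have s0 := sqr_ge0 (cos t); have z0 := normr_ge0 z.
  apply: ler_pM => //; exact: le_trans c1 d1.
Qed.

(** The differential equation of [1 / sqrt (1 + r ^ 2)], obtained from the periodic function
    [- r sin t cos t / (1 + r ^ 2 cos^2 t)]. *)
Lemma circ_kernel_ode r : (1 + r ^+ 2) * (cavg (fun t => - (2 * r * cos t ^+ 2) / (1 + (r * cos t) ^+ 2) ^+ 2)) + r * circ_kernel r = 0.
Proof.
have c1 : continuous (fun t => - (2 * r * cos t ^+ 2) / (1 + (r * cos t) ^+ 2) ^+ 2).
  apply: contM; first by cont.
  by apply: contV; [move=> u; rewrite gt_eqF// exprn_gt0// circ_kernel_den_gt0|cont].
have c2 : continuous (fun t => (1 + (r * cos t) ^+ 2)^-1).
  by apply: contV; [by move=> u; rewrite gt_eqF// circ_kernel_den_gt0|cont].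
have cc1 := contM (@cont_cst R (1 + r ^+ 2)) c1; have cc2 := contM (@cont_cst R r) c2.
rewrite /circ_kernel -(cavgZ _ c1) -(cavgZ _ c2) -(cavgD cc1 cc2).
apply: (@cavg_periodic_derive _ (fun t => - r * (sin t * cos t / (1 + (r * cos t) ^+ 2)))).
- move=> t; have h := circ_kernel_den_gt0 r t; apply: der_eq; first by derI; rewrite gt_eqF.
  rewrite /=; have sE : sin t ^+ 2 = 1 - cos t ^+ 2 by rewrite -(cos2Dsin2 t); ring.
  apply/eqP; rewrite -subr_eq0; apply/eqP.
  (* The identity holds only modulo [sin^2 + cos^2 = 1], so the difference is displayed as a
     multiple of [sin^2 - (1 - cos^2)]. *)
  transitivity (r / (1 + (r * cos t) ^+ 2) ^+ 2 * (sin t ^+ 2 - (1 - cos t ^+ 2)) * (1 - r ^+2 * cos t ^+ 2)).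
    by field; rewrite gt_eqF.
  by rewrite sE subrr mulr0 mul0r.
- exact: (contD cc1 cc2).
- by rewrite sin_mulr2n sinpi cospi sin0; ring.
Qed.

Lemma circ_kernel_ge0 r : 0 <= circ_kernel r.
Proof.
rewrite -(cavg_cst 0); apply: cavg_le.
- exact: cont_cst.
- by apply: contV; [by move=> u; rewrite gt_eqF// circ_kernel_den_gt0|cont].
- by move=> t; rewrite invr_ge0 ltW// circ_kernel_den_gt0.
Qed.

Lemma circ_kernel0 : circ_kernel 0 = 1.
Proof.
rewrite -[RHS](cavg_cst 1); apply: eq_cavg => t.
by rewrite mul0r expr0n addr0 invr1.
Qed.

Lemma circ_kernel_sqr r : 0 <= r -> circ_kernel r ^+ 2 * (1 + r ^+ 2) = 1.
Proof.
move=> r0; pose g z := circ_kernel z ^+ 2 * (1 + z ^+ 2).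
have g0 : g 0 = 1 by rewrite /g circ_kernel0 expr0n addr0 mulr1 expr1n.
have dg z : hder z g 0.
  have dk := der_circ_kernel z; rewrite /g; apply: der_eq; first by der.
  have := circ_kernel_ode z; set k' := cavg _ in dk * => h.
  rewrite /=; transitivity (2 * circ_kernel z * ((1 + z ^+ 2) * k' + z * circ_kernel z)); first by ring.
  by rewrite h mulr0.
apply/eqP; rewrite -/(g r) -g0 eq_le; apply/andP; split.
  by apply: (@der_nincr _ g (fun=> 0)) => // z _; exact: dg.
by apply: (@der_ndecr _ g (fun=> 0)) => // z _; exact: dg.
Qed.

Lemma circ_kernelE r : 0 <= r -> circ_kernel r = (Num.sqrt (1 + r ^+ 2))^-1.
Proof.
move=> r0; have p : 0 < 1 + r ^+ 2 by have := sqr_ge0 r; lra.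
have := circ_kernel_sqr r0; rewrite -[in X in _ * X](sqr_sqrtr (ltW p)) -exprMn => h.
have q0 : 0 <= circ_kernel r * Num.sqrt (1 + r ^+ 2) by rewrite mulr_ge0 ?circ_kernel_ge0 ?sqrtr_ge0.
have E : circ_kernel r * Num.sqrt (1 + r ^+ 2) = 1.
  by apply/eqP; rewrite -(@pexpr_eq1 _ _ 2)//; exact/eqP.
have s0 : Num.sqrt (1 + r ^+ 2) != 0 by rewrite gt_eqF// sqrtr_gt0.
by rewrite -[LHS](mulfK s0) E mul1r.
Qed.

Lemma eavg_circ_kernel x y :
  eavg (fun t => ((1 + (x * cos t + y * sin t) ^+ 2)^-1)%:E) =
  (circ_kernel (Num.sqrt (x ^+ 2 + y ^+ 2)))%:E.
Proof.
have p (u : R) : 0 < 1 + u ^+ 2 by have := sqr_ge0 u; lra.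
have ci : continuous (fun u : R => (1 + u ^+ 2)^-1).
  by apply: contV; [by move=> u; rewrite gt_eqF|cont].
rewrite (@eavg_rot (fun u => ((1 + u ^+ 2)^-1)%:E)); last 2 first.
- by apply/measurable_EFinP; exact: continuous_measurable_fun.
- by move=> u; rewrite lee_fin invr_ge0 ltW.
rewrite -eavg_cavg//.
- by apply: contV; [by move=> u; rewrite gt_eqF// circ_kernel_den_gt0|cont].
- by move=> t; rewrite invr_ge0 ltW// circ_kernel_den_gt0.
Qed.

End circle_integrals.

(** * Negative moments on a shifted circle *)

Section shifted_circle.
Variable R : realType.
Variable k : R.
Hypothesis k0 : 0 < k.
Hypothesis k1 : k < 1.
Implicit Types (x y r t a b u e : R).

(* [u ^ (- k)] with value [+oo] at [0], as [xpow]. *)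
Definition neg_pow u : \bar R := if u == 0 then +oo%E else (u `^ (- k))%:E.

Lemma powRN_le c a b : 0 <= c -> 0 < a -> a <= b -> b `^ (- c) <= a `^ (- c).
Proof.
move=> c0 a0 ab; have b0 := lt_le_trans a0 ab.
rewrite !powRN lef_pV2 ?posrE ?powR_gt0//.
by apply: ge0_ler_powR => //; rewrite nnegrE ltW.
Qed.

Lemma neg_pow_ge0 u : (0 <= neg_pow u)%E.
Proof. by rewrite /neg_pow; case: ifP => // _; rewrite lee_fin powR_ge0. Qed.

Lemma measurable_neg_pow : measurable_fun setT neg_pow.
Proof.
apply: measurable_fun_ifT.
- by apply: measurable_fun_eqr => //; exact: measurable_cst.
- exact: measurable_cst.
- by apply/measurable_EFinP; exact: measurable_powR.
Qed.

Lemma neg_powE u : 0 < u -> neg_pow u = (u `^ (- k))%:E.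
Proof. by move=> u0; rewrite /neg_pow gt_eqF. Qed.

Lemma neg_powM a u : 0 < a -> 0 <= u -> neg_pow (a * u) = ((a `^ (- k))%:E * neg_pow u)%E.
Proof.
move=> a0; rewrite le_eqVlt => /predU1P[<-|u0].
  by rewrite mulr0 /neg_pow eqxx gt0_muley// lte_fin powR_gt0.
by rewrite !neg_powE ?mulr_gt0// powRM ?ltW// EFinM.
Qed.

(** This is [|1 + r e^(it)| ^ 2]. *)
Definition quad r t := 1 + r ^+ 2 + 2 * r * cos t.

Lemma quad_ge r t e : 0 <= e -> `|r| <= 1 - e -> e ^+ 2 <= quad r t.
Proof.
move=> e0 re; have c1 := cos_le1 t; have c2 := cos_geN1 t; rewrite /quad.
have h : - (r * cos t) <= `|r|.
  rewrite (le_trans (ler_norm _))// normrN normrM ler_piMr//; exact: norm_cos_le1.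
have h2 : e ^+ 2 <= (1 - `|r|) ^+ 2 by rewrite ler_sqr ?nnegrE; lra.
have h3 : `|r| ^+ 2 = r ^+ 2 by rewrite real_normK ?num_real.
by apply: (le_trans h2); rewrite -subr_ge0; lra.
Qed.

Lemma quad_gt0 r t : `|r| < 1 -> 0 < quad r t.
Proof.
move=> r1; apply: lt_le_trans (@quad_ge r t (1 - `|r|) _ _); last 2 first.
- by rewrite subr_ge0 ltW.
- by lra.
by apply: exprn_gt0; rewrite subr_gt0.
Qed.

Lemma cont_quad r : continuous (quad r).
Proof. by rewrite /quad; cont. Qed.

Lemma der_quad r t : hder r (fun r => quad r t) (2 * r + 2 * cos t).
Proof. by rewrite /quad; apply: der_eq; [der|rewrite /=; ring]. Qed.

Lemma norm_lt1_near r z : `|r| < 1 -> `|z - r| < (1 - `|r|) / 2 -> `|z| <= 1 - (1 - `|r|) / 2.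
Proof.
move=> r1 zr; have : `|z| <= `|z - r| + `|r| by rewrite -[z in leLHS](subrK r) ler_normD.
by lra.
Qed.

Lemma norm_dquad r t : `|r| <= 1 -> `|2 * r + 2 * cos t| <= 4.
Proof.
move=> r1; rewrite -mulrDr normrM gtr0_norm//.
have := ler_normD r (cos t); have := norm_cos_le1 t; lra.
Qed.

Definition poisson_mass r := cavg (fun t => (quad r t)^-1).
Definition dpoisson_mass r := cavg (fun t => - (2 * r + 2 * cos t) / quad r t ^+ 2).

Lemma der_poisson_mass r : `|r| < 1 -> hder r poisson_mass (dpoisson_mass r).
Proof.
move=> r1; pose e := (1 - `|r|) / 2; have e0 : 0 < e by rewrite /e; lra.
have e1 : e <= 1 by rewrite /e; have := normr_ge0 r; lra.
have lt1 z : `|z - r| < e -> `|z| < 1.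
  by move=> /(norm_lt1_near r1); rewrite -/e; lra.
apply: (@cavg_derive _ (fun r t => (quad r t)^-1)
  (fun r t => - (2 * r + 2 * cos t) / quad r t ^+ 2) r e (4 / (e ^+ 2) ^+ 2)) => //.
- move=> z /lt1 hz; apply: contV; last exact: cont_quad.
  by move=> t; rewrite gt_eqF// quad_gt0.
- by move=> z t /lt1 hz; apply: derV; [rewrite gt_eqF// quad_gt0|exact: der_quad].
- move=> z t hz; have z1 := lt1 _ hz.
  have A := @quad_ge z t e (ltW e0) (norm_lt1_near r1 hz).
  have A0 : 0 < quad z t by exact: quad_gt0.
  rewrite normrM normrN normfV (gtr0_norm (exprn_gt0 2 A0)).
  apply: ler_pM => //; first by rewrite invr_ge0 exprn_ge0// ltW.
    by apply: norm_dquad; exact: ltW.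
  by rewrite lef_pV2 ?posrE ?exprn_gt0// ler_sqr ?nnegrE ?exprn_ge0// ltW.
Qed.

Lemma cont_invquad r : `|r| < 1 -> continuous (fun t => (quad r t)^-1).
Proof.
by move=> r1; apply: contV; [move=> t; rewrite gt_eqF// quad_gt0|exact: cont_quad].
Qed.

Lemma poisson_mass_ode r : `|r| < 1 -> (1 - r ^+ 2) * dpoisson_mass r = 2 * r * poisson_mass r.
Proof.
move=> r1; apply/eqP; rewrite -subr_eq0 -(mulNr (2 * r)); apply/eqP.
have cq : continuous (fun t => quad r t) by exact: cont_quad.
have c1 : continuous (fun t => - (2 * r + 2 * cos t) / quad r t ^+ 2).
  apply: contM; first by cont.
  by apply: contV; [move=> t; rewrite gt_eqF// exprn_gt0// quad_gt0|cont].
have c2 := cont_invquad r1.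
have cc1 := contM (@cont_cst R (1 - r ^+ 2)) c1.
have cc2 := contM (@cont_cst R (- (2 * r))) c2.
rewrite /poisson_mass /dpoisson_mass -(cavgZ _ c1) -(cavgZ _ c2) -(cavgD cc1 cc2).
apply: (@cavg_periodic_derive _ (fun t => - 2 * (sin t / quad r t))).
- move=> t; have h := quad_gt0 t r1.
  have dq : hder t (quad r) (- (2 * r * sin t)).
    by rewrite /quad; apply: der_eq; [der|rewrite /=; ring].
  have hn : quad r t != 0 by rewrite gt_eqF.
  apply: der_eq.
    by apply: derM; [exact: der_cst|apply: derM; [exact: (der_sin (der_id t))|exact: (derV hn dq)]].
  rewrite /=; have sE : sin t ^+ 2 = 1 - cos t ^+ 2 by rewrite -(cos2Dsin2 t); ring.
  apply/eqP; rewrite -subr_eq0; apply/eqP.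
  transitivity (- 4 * r / quad r t ^+ 2 * (sin t ^+ 2 - (1 - cos t ^+ 2))).
    by rewrite /quad in hn *; field.
  by rewrite sE subrr mulr0.
- exact: (contD cc1 cc2).
- by rewrite sin_mulr2n sinpi sin0; ring.
Qed.

(** The Poisson kernel has mean 1: by [poisson_mass_ode] the product is constant in [r], and it is 1
    at [r = 0]. *)
Lemma poisson_massE r : 0 <= r < 1 -> (1 - r ^+ 2) * poisson_mass r = 1.
Proof.
move=> /andP[r0 r1]; pose g z := (1 - z ^+ 2) * poisson_mass z.
have g0 : g 0 = 1.
  rewrite /g expr0n subr0 mul1r -[RHS](cavg_cst 1); apply: eq_cavg => t.
  by rewrite /quad expr0n mulr0 mul0r !addr0 invr1.
have dg z : `|z| < 1 -> hder z g 0.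
  move=> z1; have dk := der_poisson_mass z1; rewrite /g; apply: der_eq; first by der.
  by rewrite /= poisson_mass_ode//; ring.
have n z : 0 <= z <= r -> `|z| < 1.
  by move=> /andP[z0 z1]; rewrite ger0_norm//; exact: le_lt_trans r1.
apply/eqP; rewrite -/(g r) -g0 eq_le; apply/andP; split.
  by apply: (@der_nincr _ g (fun=> 0) 0 r r0) => [z /n|z _]; [exact: dg|exact: lexx].
by apply: (@der_ndecr _ g (fun=> 0) 0 r r0) => [z /n|z _]; [exact: dg|exact: lexx].
Qed.

Definition quad_moment r := cavg (fun t => quad r t `^ (- k)).

Lemma cont_quadpow r a : `|r| < 1 -> continuous (fun t => quad r t `^ a).
Proof.
move=> r1 t; apply: (@continuous_comp _ _ _ (quad r) (fun u => u `^ a)).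
  exact: cont_quad.
exact: cont_powR_pos (quad_gt0 t r1).
Qed.

Lemma der_quad_moment r : `|r| < 1 ->
  hder r quad_moment (cavg (fun t => - k * quad r t `^ (- k - 1) * (2 * r + 2 * cos t))).
Proof.
move=> r1; pose e := (1 - `|r|) / 2; have e0 : 0 < e by rewrite /e; lra.
have lt1 z : `|z - r| < e -> `|z| < 1.
  by move=> /(norm_lt1_near r1); rewrite -/e; lra.
apply: (@cavg_derive _ (fun r t => quad r t `^ (- k))
  (fun r t => - k * quad r t `^ (- k - 1) * (2 * r + 2 * cos t)) r e
  (k * (e ^+ 2) `^ (- k - 1) * 4)) => //.
- by move=> z /lt1 hz; exact: cont_quadpow.
- by move=> z t /lt1 hz; apply: der_powR; [exact: quad_gt0|exact: der_quad].
- move=> z t hz; have z1 := lt1 _ hz.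
  have A := @quad_ge z t e (ltW e0) (norm_lt1_near r1 hz).
  have A0 : 0 < quad z t by exact: quad_gt0.
  rewrite normrM normrM normrN (gtr0_norm k0) (ger0_norm (powR_ge0 _ _)).
  apply: ler_pM => //; first by rewrite mulr_ge0 ?powR_ge0// ltW.
    apply: ler_wpM2l; first exact: ltW.
    rewrite -opprD; apply: powRN_le A; last exact: exprn_gt0.
    by rewrite addr_ge0// ltW.
  by apply: norm_dquad; exact: ltW.
Qed.

(* With [P = (1 - r ^ 2) / quad r], of mean 1 (Poisson kernel), [r] times the
   derivative is [k] times the mean of [(P - 1) quad ^ (- k)]; this is
   nonnegative since [P] and [quad ^ (- k)] increase together. *)
Lemma der_quad_moment_ge0 r : 0 <= r < 1 ->
  0 <= cavg (fun t => - k * quad r t `^ (- k - 1) * (2 * r + 2 * cos t)).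
Proof.
move=> /andP[r0 r1]; have n1 : `|r| < 1 by rewrite ger0_norm.
have [->|rn] := eqVneq r 0.
  rewrite (@eq_cavg _ _ (fun t => - k * (2 * cos t))); last first.
    by move=> t; rewrite /quad expr0n !mulr0 mul0r !addr0 powR1 mulr1 add0r.
  rewrite (@cavg_periodic_derive _ (fun t => - k * (2 * sin t)))//.
  - move=> t; apply: der_eq.
      by apply: derM; [exact: der_cst|apply: derM; [exact: der_cst|exact: (der_sin (der_id t))]].
    by rewrite /=; ring.
  - by cont.
  - by rewrite sin_mulr2n sinpi sin0; ring.
have rp : 0 < r by rewrite lt_neqAle eq_sym rn.
have c0 : 0 < 1 - r ^+ 2.
  by rewrite subr_gt0 expr2 -[ltRHS]mulr1 ltr_pM.
have c2 := cont_invquad n1; have cp := @cont_quadpow r (- k - 1) n1.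
(* The value of [quad ^ (- k)] where the Poisson kernel [P] equals 1. Comparison with [K (P - 1)],
   of mean zero, is Chebyshev's association inequality made pointwise. *)
pose K := (1 - r ^+ 2) `^ (- k).
have l : continuous (fun t => - k * quad r t `^ (- k - 1) * (2 * r + 2 * cos t)).
  by apply: contM; [apply: contM; [cont|exact: cp]|cont].
rewrite -(pmulr_rge0 _ rp) -(cavgZ _ l).
have cA := contM (@cont_cst R (k * K * (1 - r ^+ 2))) c2.
have cB := @cont_cst R (- (k * K)).
apply: (@le_trans _ _ (cavg (fun t => k * K * (1 - r ^+ 2) * (quad r t)^-1 + - (k * K)))).
  rewrite (cavgD cA cB) (cavgZ _ c2) cavg_cst -/(poisson_mass r) -mulrA poisson_massE ?r0//.
  by rewrite mulr1 subrr.
apply: cavg_le; first exact: contD cA cB.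
  exact: contM (@cont_cst R r) l.
move=> t; have q0 := quad_gt0 t n1; have qn : quad r t != 0 by rewrite gt_eqF.
have -> : k * K * (1 - r ^+ 2) / quad r t + - (k * K) =
    k * (K * ((1 - r ^+ 2) / quad r t - 1)) by field.
have -> : r * (- k * quad r t `^ (- k - 1) * (2 * r + 2 * cos t)) =
    k * (quad r t `^ (- k) * ((1 - r ^+ 2) / quad r t - 1)).
  have -> : quad r t `^ (- k - 1) = quad r t `^ (- k) / quad r t.
    by rewrite powRD ?qn ?implybT// powR_inv1// ltW.
  by set z := quad r t `^ _; rewrite /quad in qn *; field.
apply: ler_wpM2l; first exact: ltW.
have [h|h] := leP (quad r t) (1 - r ^+ 2).
  apply: ler_wpM2r; first by rewrite subr_ge0 ler_pdivlMr// mul1r.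
  exact: powRN_le (ltW k0) q0 h.
apply: ler_wnM2r; first by rewrite subr_le0 ler_pdivrMr// mul1r ltW.
exact: powRN_le (ltW k0) c0 (ltW h).
Qed.

Lemma quad_moment_mono r r' : 0 <= r -> r <= r' -> r' < 1 -> quad_moment r <= quad_moment r'.
Proof.
move=> r0 rr' r'1; apply: (@der_ndecr _ quad_moment _ r r' rr') => z /andP[rz zr'].
  by apply: der_quad_moment; rewrite ger0_norm ?(le_trans r0)//; exact: le_lt_trans r'1.
by apply: der_quad_moment_ge0; rewrite (le_trans r0)//; exact: le_lt_trans r'1.
Qed.

Lemma measurable_neg_pow_affine a b : measurable_fun setT (fun t : R => neg_pow (a + b * t)).
Proof.
have h : continuous (fun t : R => a + b * t) by cont.
exact: (measurableT_comp measurable_neg_pow (continuous_measurable_fun h)).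
Qed.

(** The case [r = 1] of the moments of [quad], infinite-valued at [t = pi]; for [k = q / 2] it is
    the value of [E|xi_0 + xi_1| ^ (- q)]. *)
Definition circ_moment : \bar R := eavg (fun t => neg_pow (2 + 2 * cos t)).

Lemma measurable_neg_pow_quad a b : measurable_fun setT (fun t : R => neg_pow (a + b * cos t)).
Proof.
have h : continuous (fun t : R => a + b * cos t) by cont.
exact: (measurableT_comp measurable_neg_pow (continuous_measurable_fun h)).
Qed.

Lemma quad_moment_eavg r : `|r| < 1 -> eavg (fun t => neg_pow (quad r t)) = (quad_moment r)%:E.
Proof.
move=> r1; rewrite -eavg_cavg.
- by rewrite /eavg; apply: eq_integral => t _; rewrite neg_powE// quad_gt0.
- exact: cont_quadpow.
- by move=> t; exact: powR_ge0.
Qed.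

Lemma quad_moment_ge0 r : `|r| < 1 -> 0 <= quad_moment r.
Proof.
move=> r1; rewrite -(cavg_cst 0); apply: cavg_le.
- exact: cont_cst.
- exact: cont_quadpow.
- by move=> t; exact: powR_ge0.
Qed.

Lemma eavg_le (f g : R -> \bar R) : measurable_fun setT f -> measurable_fun setT g ->
  (forall t, 0 <= f t)%E -> (forall t, f t <= g t)%E -> (eavg f <= eavg g)%E.
Proof. by move=> mf mg f0 fg; apply: ge0_le_integral. Qed.

Lemma eavgZ a (f : R -> \bar R) : 0 <= a -> measurable_fun setT f ->
  (forall t, 0 <= f t)%E -> (eavg (fun t => a%:E * f t) = a%:E * eavg f)%E.
Proof. by move=> a0 mf f0; apply: ge0_integralZl_EFin. Qed.

(* For [0 < s < 1], [quad s t - s (2 + 2 cos t) = (1 - s)^2 >= 0]. *)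
Lemma quad_moment_le_circ r : 0 <= r < 1 -> ((quad_moment r)%:E <= circ_moment)%E.
Proof.
(* A factor below 1 may be sacrificed, which replaces a limit at [r = 1]: by monotonicity [r] is
   raised to some [s] with [s' <= s < 1], and [s * (s u) ^ (- k) = s ^ (1 - k) * u ^ (- k) <= u ^ (-
   k)] because [k < 1]. *)
move=> /andP[r0 r1]; have n1 : `|r| < 1 by rewrite ger0_norm.
apply/lee_mul01Pr; first by rewrite lee_fin quad_moment_ge0.
move=> s' /andP[s'0 s'1]; pose s := Num.max r s'.
have rs : r <= s by rewrite le_max lexx.
have s's : s' <= s by rewrite le_max lexx orbT.
have s1 : s < 1 by rewrite gt_max r1.
have s0 : 0 < s by exact: lt_le_trans s's.
have n2 : `|s| < 1 by rewrite gtr0_norm.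
apply: (@le_trans _ _ (s%:E * (quad_moment s)%:E)%E).
  rewrite -!EFinM lee_fin; exact: ler_pM (ltW s'0) (quad_moment_ge0 n1) s's (quad_moment_mono r0 rs s1).
have mq : measurable_fun setT (fun t => neg_pow (quad s t)).
  exact: measurable_neg_pow_quad.
rewrite -quad_moment_eavg// -eavgZ//; [|exact: ltW|by move=> t; exact: neg_pow_ge0].
apply: eavg_le.
- by apply: emeasurable_funM; [exact: measurable_cst|exact: mq].
- exact: measurable_neg_pow_quad.
- by move=> t; apply: mule_ge0; [rewrite lee_fin ltW|exact: neg_pow_ge0].
move=> t; have c1 := cos_geN1 t; have q0 := quad_gt0 t n2.
have [u0|un] := eqVneq (2 + 2 * cos t) 0; first by rewrite u0 /neg_pow eqxx leey.
have up : 0 < 2 + 2 * cos t by rewrite lt_neqAle eq_sym un; lra.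
rewrite !neg_powE// -EFinM lee_fin.
have h : s * (2 + 2 * cos t) <= quad s t.
  by rewrite /quad -subr_ge0; have := sqr_ge0 (1 - s); lra.
apply: (@le_trans _ _ (s * (s * (2 + 2 * cos t)) `^ (- k))).
  apply: ler_wpM2l; first exact: ltW.
  exact: powRN_le (ltW k0) (mulr_gt0 s0 up) h.
rewrite powRM ?(ltW s0) ?(ltW up)// mulrA ler_piMl ?powR_ge0//.
have sn : s != 0 by rewrite gt_eqF.
rewrite -{1}(powRr1 (ltW s0)) -powRD ?sn ?implybT//.
rewrite [leRHS](_ : 1 = 1 `^ (1 - k)); last by rewrite powR1.
apply: ge0_ler_powR; first by rewrite subr_ge0 ltW.
- by rewrite nnegrE ltW.
- by rewrite nnegrE.
- exact: ltW.
Qed.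

Lemma eavg_neg_pow_circle x y : x ^+ 2 + y ^+ 2 = 1 ->
  eavg (fun t => neg_pow ((x + cos t) ^+ 2 + (y + sin t) ^+ 2)) = circ_moment.
Proof.
move=> xy1.
transitivity (eavg (fun t => neg_pow (2 + 2 * (x * cos t + y * sin t)))).
  apply: eq_integral => t _; congr neg_pow; rewrite !sqrrD.
  transitivity (x ^+ 2 + y ^+ 2 + (cos t ^+ 2 + sin t ^+ 2) + 2 * (x * cos t + y * sin t)); first by ring.
  by rewrite xy1 cos2Dsin2; ring.
rewrite (@eavg_rot R (fun u => neg_pow (2 + 2 * u))).
- by rewrite xy1 sqrtr1; apply: eq_integral => t _; rewrite mul1r.
- exact: measurable_neg_pow_affine.
- by move=> u; exact: neg_pow_ge0.
Qed.

(** After a rotation only the length [r] of [(x, y)] matters. The larger of [r] and [a] is factored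
    out, leaving [quad] at a ratio below 1; if this is [r], then [r ^ (- 2k) <= a ^ (- 2k)]
    finishes. *)
Lemma eavg_neg_pow_le x y a : 0 < a ->
  (eavg (fun t => neg_pow ((x + (a * cos t)%R) ^+ 2 + (y + (a * sin t)%R) ^+ 2)%R) <=
   ((a ^+ 2) `^ (- k))%:E * circ_moment)%E.
Proof.
move=> a0; set r := Num.sqrt (x ^+ 2 + y ^+ 2).
have r2 : r ^+ 2 = x ^+ 2 + y ^+ 2 by rewrite sqr_sqrtr// addr_ge0// sqr_ge0.
have r0 : 0 <= r by exact: sqrtr_ge0.
have -> : eavg (fun t => neg_pow ((x + a * cos t) ^+ 2 + (y + a * sin t) ^+ 2)) =
   eavg (fun t => neg_pow (r ^+ 2 + a ^+ 2 + 2 * a * r * cos t)).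
  transitivity (eavg (fun t => neg_pow (r ^+ 2 + a ^+ 2 + 2 * a * (x * cos t + y * sin t)))).
    apply: eq_integral => t _; congr neg_pow; rewrite r2.
    transitivity (x ^+ 2 + y ^+ 2 + a ^+ 2 * (cos t ^+ 2 + sin t ^+ 2) + 2 * a * (x * cos t + y * sin t)); first by ring.
    by rewrite cos2Dsin2 mulr1.
  rewrite (@eavg_rot R (fun u => neg_pow (r ^+ 2 + a ^+ 2 + 2 * a * u))).
  - by apply: eq_integral => t _; rewrite mulrA.
  - exact: measurable_neg_pow_affine.
  - by move=> u; exact: neg_pow_ge0.
have scale (c : R) (f : R -> R) : 0 < c -> measurable_fun setT (fun t => neg_pow (f t)) ->
  (forall t, 0 <= f t) ->
  eavg (fun t => neg_pow (c * f t)) = ((c `^ (- k))%:E * eavg (fun t => neg_pow (f t)))%E.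
  move=> c0 mf f0; rewrite -eavgZ ?powR_ge0//; last by move=> t; exact: neg_pow_ge0.
  by apply: eq_integral => t _; rewrite neg_powM.
have G0 : (0 <= circ_moment)%E by apply: integral_ge0 => t _; exact: neg_pow_ge0.
have mq z : measurable_fun setT (fun t => neg_pow (quad z t)) by exact: measurable_neg_pow_quad.
have an : a != 0 by rewrite gt_eqF.
have [ra|ra|ra] := ltgtP r a.
- have h : 0 <= r / a < 1 by rewrite divr_ge0 ?(ltW a0)//= ltr_pdivrMr// mul1r.
  have n : `|r / a| < 1 by case/andP: h => h1 h2; rewrite ger0_norm.
  rewrite (_ : (fun t => neg_pow _) = (fun t => neg_pow (a ^+ 2 * quad (r / a) t))); last first.
    by apply/funext => t; congr neg_pow; rewrite /quad; field.
  rewrite (scale _ _ (exprn_gt0 2 a0) (mq _)); last by move=> t; rewrite ltW// quad_gt0.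
  apply: lee_wpmul2l; first by rewrite lee_fin powR_ge0.
  by rewrite quad_moment_eavg//; exact: quad_moment_le_circ.
- have rp : 0 < r by exact: lt_trans ra.
  have rn : r != 0 by rewrite gt_eqF.
  have h : 0 <= a / r < 1 by rewrite divr_ge0 ?(ltW a0)//= ltr_pdivrMr// mul1r.
  have n : `|a / r| < 1 by case/andP: h => h1 h2; rewrite ger0_norm.
  rewrite (_ : (fun t => neg_pow _) = (fun t => neg_pow (r ^+ 2 * quad (a / r) t))); last first.
    by apply/funext => t; congr neg_pow; rewrite /quad; field.
  rewrite (scale _ _ (exprn_gt0 2 rp) (mq _)); last by move=> t; rewrite ltW// quad_gt0.
  apply: (@le_trans _ _ (((r ^+ 2) `^ (- k))%:E * circ_moment)%E).
    apply: lee_wpmul2l; first by rewrite lee_fin powR_ge0.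
    by rewrite quad_moment_eavg//; exact: quad_moment_le_circ.
  apply: lee_wpmul2r => //; rewrite lee_fin.
  apply: powRN_le (ltW k0) (exprn_gt0 2 a0) _.
  by rewrite ler_sqr ?nnegrE ltW.
- rewrite ra (_ : (fun t => neg_pow _) = (fun t => neg_pow (a ^+ 2 * (2 + 2 * cos t)))); last first.
    by apply/funext => t; congr neg_pow; ring.
  rewrite (scale _ _ (exprn_gt0 2 a0) (measurable_neg_pow_quad _ _)) => [|t]; first exact: lexx.
  by have := cos_geN1 t; lra.
Qed.

End shifted_circle.

(** * Negative moments by Fourier inversion *)

Section kernels.
Variable R : realType.
Implicit Types (r t x : R).

Lemma hline_exp_cos r :
  hline (fun t => expR (- t) * (1 + cos (t * r))) = (1 + (1 + r ^+ 2)^-1)%:E.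
Proof.
have r2 : 0 < 1 + r ^+ 2 by have := sqr_ge0 r; lra.
pose F t := expR (- t) * ((r * sin (t * r) - cos (t * r)) / (1 + r ^+ 2) - 1).
pose f t := expR (- t) * (1 + cos (t * r)).
have cf : continuous f by rewrite /f; cont.
have dF t : hder t F (f t).
  rewrite /F; apply: der_eq; first by der.
  by rewrite /f /=; field; rewrite gt_eqF.
have mf : measurable_fun setT f by exact: continuous_measurable_fun.
rewrite /hline integral_itv_obnd_cbnd; last first.
  by apply/measurable_EFinP; exact: measurable_funTS.
rewrite (@ge0_continuous_FTC2y _ f F 0 0).
- rewrite sub0e -EFinN; congr EFin.
  by rewrite /F oppr0 expR0 !mul0r sin0 cos0; field; rewrite gt_eqF.
- by move=> x _; rewrite /f mulr_ge0 ?expR_ge0//; have := cos_geN1 (x * r); lra.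
- exact: continuous_subspaceT.
- pose C := (`|r| + 1) / (1 + r ^+ 2) + 1.
  have e0 : expR (- x) @[x --> +oo] --> (0 : R).
    exact: cvgr_expR.
  have eC : C * expR (- x) @[x --> +oo] --> (0 : R).
    by rewrite -[X in _ --> X](mulr0 C); apply: cvgM => //; exact: cvg_cst.
  apply/norm_cvg0P; apply: (@squeeze_cvgr _ _ _ _ (fun=> 0) (fun x => C * expR (- x))) => //.
    apply: nearW => x; rewrite normr_ge0/= /F normrM (ger0_norm (expR_ge0 _)) mulrC.
    apply: ler_wpM2r; first exact: expR_ge0.
    apply: (le_trans (ler_normB _ _)); rewrite normr1 lerD2r normrM normfV (gtr0_norm r2).
    apply: ler_wpM2r; first by rewrite invr_ge0 ltW.
    apply: (le_trans (ler_normB _ _)); apply: lerD; last exact: norm_cos_le1.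
    by rewrite normrM ler_piMr// norm_sin_le1.
  exact: cvg_cst.
- by move=> x _; case: (dF x).
- by apply: cvg_at_right_filter; exact: (der_continuous (dF 0)).
- by move=> x _; rewrite derive1E; case: (dF x).
Qed.

Lemma hline_expN : hline (fun t => expR (- t)) = 1%:E.
Proof.
have cf : continuous (fun t : R => expR (- t)) by cont.
have e0 t : 0 < t -> 0 <= expR (- t) :> R by move=> _; exact: expR_ge0.
have := hline_exp_cos 0.
rewrite (@eq_hline _ _ (fun t => 2 * expR (- t))); last first.
  by move=> t _; rewrite mulr0 cos0; ring.
rewrite (hlineZ (ler0n _ 2) (continuous_measurable_fun cf) e0).
rewrite (_ : 1 + (1 + 0 ^+ 2)^-1 = 2); last by field.
case: (hline _) => [r|/eqP|/eqP]; last 2 first.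
- by rewrite gt0_muley ?lte_fin.
- by rewrite gt0_muleNy ?lte_fin.
by rewrite -EFinM => -[h]; congr EFin; lra.
Qed.

Variable q : R.
Hypothesis q0 : 0 < q.
Hypothesis q1 : q < 1.
Local Notation wt := (wt q).

Lemma measurable_circ_kernel : measurable_fun setT (@circ_kernel R).
Proof.
by apply: continuous_measurable_fun => r; exact: (der_continuous (der_circ_kernel r)).
Qed.

Definition kernel_mass : \bar R := hline (fun x => circ_kernel x * wt x).

Lemma measurable_circ_kernel_wt : measurable_fun setT (fun x => circ_kernel x * wt x).
Proof. by apply: measurable_funM; [exact: measurable_circ_kernel|exact: measurable_wt]. Qed.

Lemma circ_kernel_wt_ge0 x : 0 <= circ_kernel x * wt x.
Proof. by rewrite mulr_ge0 ?circ_kernel_ge0 ?wt_ge0. Qed.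

Lemma hline_ge_half (f : R -> R) c : measurable_fun setT f -> 0 < c ->
  (forall x, 0 < x -> 0 <= f x) -> (forall x, 1 / 2 <= x <= 1 -> c <= f x) ->
  (0 < hline f)%E.
Proof.
move=> mf c0 f0 fc.
apply: (@lt_le_trans _ _ (\int[lebesgue_measure]_(x in `[(1 / 2)%R, 1%R]) (c%:E))%E).
  rewrite integral_cst//= lebesgue_measure_itv/= lte_fin.
  rewrite ifT; last by lra.
  by rewrite -EFinB -EFinM lte_fin mulr_gt0//; lra.
apply: (@le_trans _ _ (\int[lebesgue_measure]_(x in `[(1 / 2)%R, 1%R]) ((f x)%:E))%E).
  apply: ge0_le_integral; [by []|by move=> x _; rewrite lee_fin ltW|exact: measurable_cst| |].
    by apply/measurable_EFinP; exact: measurable_funTS.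
  by move=> x /=; rewrite in_itv/= lee_fin; exact: fc.
apply: ge0_subset_integral => //.
- by apply/measurable_EFinP; exact: measurable_funTS.
- by move=> x /=; rewrite in_itv/= andbT lee_fin; exact: f0.
- by apply: subset_itv; rewrite bnd_simp//; lra.
Qed.

Lemma wt_ge1 x : 0 < x <= 1 -> 1 <= wt x.
Proof.
move=> /andP[x0 x1]; have c0 : 0 <= 1 - q by rewrite subr_ge0 ltW.
by have := powRN_le c0 x0 x1; rewrite powR1 opprB.
Qed.

Lemma kernel_mass_gt0 : (0 < kernel_mass)%E.
Proof.
apply: (@hline_ge_half _ (1 / 2)) => //.
- exact: measurable_circ_kernel_wt.
- by move=> x _; exact: circ_kernel_wt_ge0.
move=> x /andP[x0 x1]; have xp : 0 < x by lra.
have w1 : 1 <= wt x by rewrite wt_ge1 ?xp.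
apply: (@le_trans _ _ (1 / 2 * 1)); first by rewrite mulr1.
apply: ler_pM => //; rewrite circ_kernelE; last exact: ltW.
have x21 : x ^+ 2 <= 1 by rewrite expr_le1// ltW.
have s0 : 0 < 1 + x ^+ 2 by have := sqr_ge0 x; lra.
rewrite mul1r lef_pV2 ?posrE ?sqrtr_gt0//.
rewrite -[leRHS]ger0_norm// -sqrtr_sqr ler_wsqrtr//; lra.
Qed.

(* By scaling, a finite value would be preserved under multiplication by
   [2 ^ (- q)]. *)
Lemma hline_wt : hline wt = +oo%E.
Proof.
have p : (0 < hline wt)%E.
  apply: (@hline_ge_half _ 1) => //.
  - exact: measurable_wt.
  - by move=> x _; exact: wt_ge0.
  - by move=> x /andP[x0 x1]; apply: wt_ge1; rewrite x1 andbT; lra.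
have := @hline_scale R q (fun=> 1) 2 ltac:(by []) (measurable_cst _) ltac:(by []).
rewrite (_ : (fun x => 1 * wt x) = wt); last by apply/funext => x; rewrite mul1r.
have [//|h] := eqVneq (hline wt) +oo%E.
have fin : hline wt \is a fin_num by rewrite ge0_fin_numE ?ltey// ltW.
move: p; rewrite -(fineK fin) -EFinM => p [] E; rewrite lte_fin in p.
have : 2 `^ (- q) < (1 : R).
  by rewrite powRN invf_lt1 ?powR_gt0// /powR gt_eqF// expR_gt1 mulr_gt0// ln_gt0// ltr1n.
have : (1 - 2 `^ (- q)) * fine (hline wt) = 0 by rewrite mulrBl mul1r -E subrr.
move/eqP; rewrite mulf_eq0 subr_eq0 (gt_eqF p) orbF => /eqP <-.
by rewrite ltxx.
Qed.

Lemma circ_kernel_le1 x : 0 <= x -> circ_kernel x <= 1.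
Proof.
move=> x0; rewrite circ_kernelE// invf_le1 ?sqrtr_gt0; last by have := sqr_ge0 x; lra.
by rewrite -[leLHS]sqrtr1 ler_wsqrtr// lerDl sqr_ge0.
Qed.

Lemma circ_kernel_leV x : 0 < x -> circ_kernel x <= x^-1.
Proof.
move=> x0; rewrite (circ_kernelE (ltW x0)) lef_pV2 ?posrE ?sqrtr_gt0//; last by have := sqr_ge0 x; lra.
by rewrite -[leLHS]gtr0_norm// -sqrtr_sqr ler_wsqrtr// lerDr.
Qed.

(** The kernel is at most 1 and at most [1 / x], so that [0 < q] gives convergence at 0 and [q < 1]
    at infinity. Together with positivity this allows [kernel_mass] to be cancelled at the end. *)
Lemma kernel_mass_fin : kernel_mass \is a fin_num.
Proof.
rewrite ge0_fin_numE; last exact: (ltW kernel_mass_gt0).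
apply: (@le_lt_trans _ _ (q^-1 + (1 - q)^-1)%:E); last exact: ltry.
have Q0 := q0; have Q1 := q1.
apply: hline_le; [exact: measurable_circ_kernel_wt|by move=> x _; exact: circ_kernel_wt_ge0|].
move=> a b a0 ab; pose a' := Num.min a (1 / 2); pose b' := Num.max b 2.
have a'0 : 0 < a' by rewrite lt_min a0 divr_gt0.
have a'1 : a' < 1 by rewrite gt_min; apply/orP; right; lra.
have b'1 : 1 < b' by rewrite lt_max; apply/orP; right; lra.
have mE : measurable_fun setT (fun x : R => (circ_kernel x * wt x)%:E).
  by apply/measurable_EFinP; exact: measurable_circ_kernel_wt.
apply: (@le_trans _ _ (\int[lebesgue_measure]_(x in `[a', b']) (circ_kernel x * wt x)%:E)%E).
  apply: ge0_subset_integral => //.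
  - exact: measurable_funTS.
  - by move=> x _; rewrite lee_fin circ_kernel_wt_ge0.
  - by apply: subset_itv; rewrite bnd_simp ?ge_min ?le_max lexx.
rewrite (integral_itv_cat mE _ (ltW a'1) (ltW b'1)); last by move=> x _; rewrite lee_fin circ_kernel_wt_ge0.
have ckw x : 0 < x -> {for x, continuous (fun x => circ_kernel x * wt x)}.
  by move=> x0; apply: cont_mul_at; [exact: (der_continuous (der_circ_kernel x))|exact: cont_wt].
rewrite EFinD; apply: leeD.
- have pos x : a' <= x <= 1 -> 0 < x by move=> /andP[h _]; exact: lt_le_trans h.
  (* With 0 as the larger integrand, the comparison becomes an upper bound of the integral by the
     increment of a primitive. *)
  have := @seg_compare R (fun=> 0) (fun x => circ_kernel x * wt x) (fun x => - wt x) (fun x => - (q^-1 * x `^ q)) a' 1 a'1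
    (fun x _ => @cont_cst R 0 x) (fun x h => ckw x (pos x h)).
  rewrite integral0 => h.
  have {}h : (\int[lebesgue_measure]_(x in `[a', 1%R]) (circ_kernel x * wt x)%:E <=
      0 - (- (q^-1 * 1 `^ q) - - (q^-1 * a' `^ q))%:E)%E.
    rewrite leeBrDr//; apply: h.
    by move=> x /pos xp; apply: cvgN; exact: cont_wt.
    move=> x /pos xp; have qn : q != 0 by rewrite gt_eqF.
    apply: der_eq; first by apply: derN; apply: derM; [exact: der_cst|exact: (der_xq q xp)].
    by rewrite /=; field.
    by move=> x /[dup] /pos xp /andP[_ x1]; rewrite subr_le0 ler_piMl ?wt_ge0// circ_kernel_le1// ltW.
  apply: (le_trans h); rewrite sub0e -EFinN lee_fin powR1 mulr1 opprD !opprK.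
  by rewrite gerDl oppr_le0 mulr_ge0 ?powR_ge0// invr_ge0 ltW.
- have pos x : 1 <= x <= b' -> 0 < x by move=> /andP[h _]; exact: lt_le_trans h.
  have := @seg_compare R (fun=> 0) (fun x => circ_kernel x * wt x) (fun x => - x `^ (q - 1 - 1)) (fun x => (1 - q)^-1 * x `^ (q - 1)) 1 b' b'1
    (fun x _ => @cont_cst R 0 x) (fun x h => ckw x (pos x h)).
  rewrite integral0 => h.
  have {}h : (\int[lebesgue_measure]_(x in `[1%R, b']) (circ_kernel x * wt x)%:E <=
      0 - ((1 - q)^-1 * b' `^ (q - 1) - (1 - q)^-1 * 1 `^ (q - 1))%:E)%E.
    rewrite leeBrDr//; apply: h.
    by move=> x /pos xp; apply: cvgN; exact: cont_powR_pos.
    move=> x /pos xp; have qn : 1 - q != 0 by rewrite gt_eqF// subr_gt0.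
    apply: der_eq; first by apply: derM; [exact: der_cst|exact: (der_powR _ xp (der_id x))].
    by rewrite /=; set z := x `^ (q - 1 - 1); field.
    move=> x /pos xp; rewrite subr_le0.
    have xn : x != 0 by rewrite gt_eqF.
    rewrite powRD ?xn ?implybT// (powR_inv1 (ltW xp)) mulrC.
    by apply: ler_wpM2l; [exact: wt_ge0|exact: circ_kernel_leV].
  apply: (le_trans h); rewrite sub0e -EFinN lee_fin powR1 mulr1 opprB.
  by rewrite gerDl oppr_le0 mulr_ge0 ?powR_ge0// invr_ge0 subr_ge0 ltW.
Qed.

End kernels.

Section tonelli_half_line.
Context d (T : measurableType d) (R : realType).
Variable m : {sigma_finite_measure set T -> \bar R}.
Notation mu := (@lebesgue_measure R).

(** The restriction is written as an indicator factor, so that Tonelli applies over the whole line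
    to a nonnegative, jointly measurable function. *)
Let restr (D : set R) (f : T * R -> \bar R) (z : T * R) : \bar R := (f z * (\1_D z.2)%:E)%E.

Let measurable_restr D f : measurable D -> measurable_fun setT f ->
  measurable_fun setT (restr D f).
Proof.
move=> mD mf; apply: emeasurable_funM => //; apply/measurable_EFinP.
by apply: (measurableT_comp _ measurable_snd); exact: measurable_indic.
Qed.

Let restr_ge0 D f : (forall z, 0 <= f z)%E -> forall z, (0 <= restr D f z)%E.
Proof. by move=> f0 z; rewrite mule_ge0// lee_fin. Qed.

Let restrE D f w : (\int[mu]_(t in D) f (w, t) = \int[mu]_t restr D f (w, t))%E.
Proof.
rewrite integral_mkcond; apply: eq_integral => t _.
by rewrite patchE /restr/= indicE; case: (t \in D); rewrite ?mule1 ?mule0.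
Qed.

Lemma tonelli_in (D : set R) (f : T * R -> \bar R) : measurable D ->
  measurable_fun setT f -> (forall z, 0 <= f z)%E ->
  (\int[m]_w \int[mu]_(t in D) f (w, t) = \int[mu]_(t in D) \int[m]_w f (w, t))%E.
Proof.
move=> mD mf f0; under eq_integral do rewrite restrE.
rewrite (@fubini_tonelli _ _ _ _ _ m (@lebesgue_measure R) _ (measurable_restr mD mf) (restr_ge0 D f0)).
rewrite [RHS]integral_mkcond; apply: eq_integral => t _.
rewrite patchE /restr/= indicE; case: (t \in D).
  by apply: eq_integral => w _; rewrite mule1.
by under eq_integral do rewrite mule0; rewrite integral0.
Qed.

Lemma measurable_integral_in (D : set R) (f : T * R -> \bar R) : measurable D ->
  measurable_fun setT f -> (forall z, 0 <= f z)%E ->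
  measurable_fun setT (fun w => \int[mu]_(t in D) f (w, t))%E.
Proof.
move=> mD mf f0; under eq_fun do rewrite restrE.
exact: (@measurable_fun_fubini_tonelli_F _ _ _ _ _ (@lebesgue_measure R) _
  (measurable_restr mD mf) (restr_ge0 D f0)).
Qed.

End tonelli_half_line.

(** * From the characteristic function to the negative moment *)

Section fourier_moment.
Context d (T : measurableType d) (R : realType) (P : probability T R).
Variables (X Y : T -> R) (F : R -> R).
Hypothesis mX : measurable_fun setT X.
Hypothesis mY : measurable_fun setT Y.
Hypothesis mF : measurable_fun setT F.
Hypothesis XYF : forall t a : R,
  (\int[P]_w (1 + cos (t * (X w * cos a + Y w * sin a))%R)%:E = (1 + F t)%:E)%E.
Notation mu := (@lebesgue_measure R).
Implicit Types (l t a : R).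

Let N w := Num.sqrt (X w ^+ 2 + Y w ^+ 2).

Lemma measurable_radius : measurable_fun setT N.
Proof.
apply: (measurableT_comp (continuous_measurable_fun (@sqrt_continuous R))).
by apply: measurable_funD; exact: measurable_funX.
Qed.

Lemma mean_kernel_line l a :
  (\int[P]_w (1 + (1 + (l * (X w * cos a + Y w * sin a)) ^+ 2)^-1)%:E =
   hline (fun t => expR (- t) * (1 + F (l * t)))%R)%E.
Proof.
pose f (z : T * R) : \bar R :=
  (expR (- z.2) * (1 + cos (z.2 * (l * (X z.1 * cos a + Y z.1 * sin a)))))%:E.
have mf : measurable_fun setT f.
  apply/measurable_EFinP; apply: measurable_funM.
    have cE : continuous (fun t : R => expR (- t)) by cont.
    exact: (measurableT_comp (continuous_measurable_fun cE) measurable_snd).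
  apply: measurable_funD; first exact: measurable_cst.
  apply: (measurableT_comp (continuous_measurable_fun (@continuous_cos R))).
  apply: measurable_funM; first exact: measurable_snd.
  apply: measurable_funM; first exact: measurable_cst.
  apply: measurable_funD; apply: measurable_funM.
  - exact: (measurableT_comp mX measurable_fst).
  - exact: measurable_cst.
  - exact: (measurableT_comp mY measurable_fst).
  - exact: measurable_cst.
have f0 z : (0 <= f z)%E.
  rewrite lee_fin; apply: mulr_ge0; first exact: expR_ge0.
  by have := cos_geN1 (z.2 * (l * (X z.1 * cos a + Y z.1 * sin a))); lra.
transitivity (\int[P]_w \int[mu]_(t in `]0%R, +oo[) f (w, t))%E.
  by apply: eq_integral => w _; rewrite -hline_exp_cos.
rewrite tonelli_in//; apply: eq_integral => t _; rewrite /f/=.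
under eq_integral do rewrite EFinM.
rewrite ge0_integralZl_EFin//.
- rewrite EFinM; congr (_ * _)%E; rewrite -(XYF _ a).
  by apply: eq_integral => w _; rewrite mulrA (mulrC t l).
- apply/measurable_EFinP; apply: measurable_funD; first exact: measurable_cst.
  apply: (measurableT_comp (continuous_measurable_fun (@continuous_cos R))).
  apply: measurable_funM; first exact: measurable_cst.
  apply: measurable_funM; first exact: measurable_cst.
  by apply: measurable_funD; apply: measurable_funM.
Qed.

(** In [mean_kernel_line] the right side does not depend on the direction [a]; averaging over [a]
    turns the left side into the radial kernel. *)
Lemma mean_kernel l : 0 <= l ->
  (\int[P]_w (1 + circ_kernel (l * N w))%:E =
   hline (fun t => expR (- t) * (1 + F (l * t)))%R)%E.
Proof.
move=> l0.
pose f (z : T * R) : \bar R :=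
  (1 + (1 + (l * (X z.1 * cos z.2 + Y z.1 * sin z.2)) ^+ 2)^-1)%:E.
have p (u : R) : 0 < 1 + u ^+ 2 by have := sqr_ge0 u; lra.
have ci : continuous (fun u : R => (1 + u ^+ 2)^-1).
  by apply: contV; [by move=> u; rewrite gt_eqF|cont].
have mf : measurable_fun setT f.
  apply/measurable_EFinP; apply: measurable_funD; first exact: measurable_cst.
  apply: (measurableT_comp (continuous_measurable_fun ci)).
  apply: measurable_funM; first exact: measurable_cst.
  apply: measurable_funD; apply: measurable_funM.
  - exact: (measurableT_comp mX measurable_fst).
  - exact: (measurableT_comp (continuous_measurable_fun (@continuous_cos R)) measurable_snd).
  - exact: (measurableT_comp mY measurable_fst).
  exact: (measurableT_comp (continuous_measurable_fun (@continuous_sin R)) measurable_snd).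
have f0 z : (0 <= f z)%E by rewrite lee_fin addr_ge0// invr_ge0 ltW.
transitivity (\int[P]_w eavg (fun t => f (w, t)))%E.
  apply: eq_integral => w _; rewrite /f/=.
  transitivity (eavg (fun t => 1%:E + ((1 + (l * X w * cos t + l * Y w * sin t) ^+ 2)^-1)%:E))%E; last first.
    by apply: eq_integral => t _; rewrite -EFinD mulrDr !mulrA.
  rewrite /eavg ge0_integralD//; last 2 first.
  - by move=> t _; rewrite lee_fin invr_ge0 ltW.
  - apply/measurable_EFinP.
    apply: (measurableT_comp (continuous_measurable_fun ci)).
    by apply: continuous_measurable_fun; cont.
  rewrite -!/(eavg _) eavg_cst EFinD; congr (_ + _)%E.
  rewrite eavg_circ_kernel; congr (circ_kernel _)%:E.
  rewrite /N -[X in X * _](ger0_norm l0) -sqrtr_sqr -sqrtrM ?sqr_ge0//.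
  by congr Num.sqrt; ring.
rewrite /eavg (@fubini_tonelli _ _ _ _ _ P (uniform_prob (@pi2_gt0 R)) f mf f0).
transitivity (eavg (fun=> hline (fun t => expR (- t) * (1 + F (l * t)))%R)).
  by apply: eq_integral => a _; exact: mean_kernel_line.
exact: eavg_cst.
Qed.

Lemma F_geN1 t : -1 <= F t.
Proof.
have : (0 <= (1 + F t)%:E)%E.
  rewrite -(XYF t 0); apply: integral_ge0 => w _.
  by rewrite lee_fin; have := cos_geN1 (t * (X w * cos 0 + Y w * sin 0)); lra.
by rewrite lee_fin; lra.
Qed.

Let mexp : measurable_fun setT (fun t : R => expR (- t)).
Proof. by apply: continuous_measurable_fun; cont. Qed.

Lemma measurable_comp_dilate l (f : R -> R) : measurable_fun setT f ->
  measurable_fun setT (fun t => f (l * t)).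
Proof. by move=> mf; apply: (measurableT_comp mf); exact: measurable_dilate. Qed.

Lemma measurable_kernel_radius l : measurable_fun setT (fun w => circ_kernel (l * N w)).
Proof.
apply: (measurableT_comp (@measurable_circ_kernel R)).
by apply: measurable_funM; [exact: measurable_cst|exact: measurable_radius].
Qed.

Lemma mean_kernel1 l : 0 <= l ->
  (1%:E + \int[P]_w (circ_kernel (l * N w))%:E =
   hline (fun t => expR (- t) * (1 + F (l * t)))%R)%E.
Proof.
move=> l0; rewrite -mean_kernel//.
under [RHS]eq_integral do rewrite EFinD.
rewrite ge0_integralD//.
- by congr (_ + _)%E; rewrite integral_cst// mul1e; exact/esym/probability_setT.
- by move=> w _; rewrite lee_fin circ_kernel_ge0.
- by apply/measurable_EFinP; exact: measurable_kernel_radius.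
Qed.

Lemma hline_exp1D (B : R -> R) l : measurable_fun setT B -> (forall t, 0 <= B t) ->
  (hline (fun t => expR (- t) * (1 + B (l * t)))%R =
   1%:E + hline (fun t => expR (- t) * B (l * t))%R)%E.
Proof.
move=> mB B0; have mEB : measurable_fun setT (fun t => expR (- t) * B (l * t)).
  by apply: measurable_funM => //; exact: measurable_comp_dilate.
rewrite -hline_expN -(hlineD mexp mEB); last 2 first.
- by move=> t _; exact: expR_ge0.
- by move=> t _; rewrite mulr_ge0 ?expR_ge0.
by apply: eq_hline => t _; rewrite mulrDr mulr1.
Qed.

(** [F] may be negative, so the comparison is made between [1 + F], nonnegative by [F_geN1], and
    [1 + B]; the finite term 1 is cancelled afterwards. *)
Lemma mean_kernel_le (B : R -> R) l : measurable_fun setT B -> (forall t, 0 <= B t) ->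
  (forall t, 0 < t -> F t <= B t) -> 0 < l ->
  (\int[P]_w (circ_kernel (l * N w))%:E <= hline (fun t => expR (- t) * B (l * t))%R)%E.
Proof.
move=> mB B0 FB l0; rewrite -(@leeD2lE _ 1%:E)//.
rewrite (mean_kernel1 (ltW l0)) -hline_exp1D//; apply: hline_mono.
- apply: measurable_funM => //; apply: measurable_funD => //; exact: measurable_comp_dilate.
- apply: measurable_funM => //; apply: measurable_funD => //; exact: measurable_comp_dilate.
- by move=> t _; apply: mulr_ge0; [exact: expR_ge0|have := F_geN1 (l * t); lra].
- by move=> t t0; apply: ler_wpM2l; [exact: expR_ge0|rewrite lerD2l FB// mulr_gt0].
Qed.

Lemma mean_kernel_eq (B : R -> R) l : measurable_fun setT B -> (forall t, 0 <= B t) ->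
  (forall t, 0 < t -> F t = B t) -> 0 < l ->
  (\int[P]_w (circ_kernel (l * N w))%:E = hline (fun t => expR (- t) * B (l * t))%R)%E.
Proof.
move=> mB B0 FB l0.
have := mean_kernel1 (ltW l0).
have -> : hline (fun t => expR (- t) * (1 + F (l * t)))%R =
          hline (fun t => expR (- t) * (1 + B (l * t)))%R.
  by apply: eq_hline => t t0; rewrite FB// mulr_gt0.
rewrite hline_exp1D// => /eqP.
by rewrite eq_le !leeD2lE// -eq_le => /eqP.
Qed.

Variable q : R.
Hypothesis q0 : 0 < q.
Hypothesis q1 : q < 1.
Local Notation wt := (wt q).

Lemma kernel_scale (r : R) : 0 <= r ->
  hline (fun l => circ_kernel (l * r) * wt l) = (kernel_mass q * neg_pow (q / 2) (r ^+ 2))%E.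
Proof.
rewrite le_eqVlt => /predU1P[<-|r0].
  (* At [r = 0] the left side is the infinite integral of [wt], in agreement with the value [+oo] of
     [neg_pow] at 0. *)
  rewrite expr0n/= /neg_pow eqxx gt0_muley ?kernel_mass_gt0//.
  rewrite -(hline_wt q0 q1); apply: eq_hline => l _.
  by rewrite mulr0 circ_kernel0 mul1r.
rewrite (_ : (fun l => _) = (fun l => circ_kernel (r * l) * wt l)); last first.
  by apply/funext => l; rewrite (mulrC l).
rewrite (@hline_scale _ q (@circ_kernel R) r r0 (@measurable_circ_kernel R)); last by move=> x _; exact: circ_kernel_ge0.
rewrite neg_powE ?exprn_gt0// muleC; congr (_ * _%:E)%E.
by rewrite -(powR_mulrn 2 (ltW r0)) -powRrM; congr (_ `^ _); field.
Qed.

(* Scaling in [l] turns the kernel integral into the power [N w ^ (- q)]. *)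
Lemma kernel_mass_moment :
  (kernel_mass q * \int[P]_w neg_pow (q / 2) (X w ^+ 2 + Y w ^+ 2)%R =
   \int[mu]_(l in `]0%R, +oo[) ((wt l)%:E * \int[P]_w (circ_kernel (l * N w))%:E))%E.
Proof.
have mn : measurable_fun setT (fun w => neg_pow (q / 2) (X w ^+ 2 + Y w ^+ 2)).
  apply: (measurableT_comp (measurable_neg_pow _)).
  by apply: measurable_funD; exact: measurable_funX.
rewrite -ge0_integralZl//; last 2 first.
- by move=> w _; exact: neg_pow_ge0.
- exact: (ltW (kernel_mass_gt0 q1)).
pose f (z : T * R) : \bar R := (circ_kernel (z.2 * N z.1) * wt z.2)%:E.
have mf : measurable_fun setT f.
  apply/measurable_EFinP; apply: measurable_funM.
    apply: (measurableT_comp (@measurable_circ_kernel R)); apply: measurable_funM.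
      exact: measurable_snd.
    exact: (measurableT_comp measurable_radius measurable_fst).
  exact: (measurableT_comp (measurable_wt q) measurable_snd).
have f0 z : (0 <= f z)%E by rewrite lee_fin mulr_ge0 ?circ_kernel_ge0 ?wt_ge0.
transitivity (\int[P]_w \int[mu]_(l in `]0%R, +oo[) f (w, l))%E.
  apply: eq_integral => w _.
  have -> : X w ^+ 2 + Y w ^+ 2 = N w ^+ 2 by rewrite sqr_sqrtr// addr_ge0// sqr_ge0.
  by rewrite -kernel_scale ?sqrtr_ge0.
rewrite tonelli_in//; apply: eq_integral => l _.
rewrite /f/=; under eq_integral do rewrite mulrC EFinM.
rewrite ge0_integralZl_EFin ?wt_ge0//.
- by move=> w _; rewrite lee_fin circ_kernel_ge0.
- by apply/measurable_EFinP; exact: measurable_kernel_radius.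
Qed.

(** The value [Gamma (1 - q)]; the constant [c_q] of the overview is [exp_moment / kernel_mass]. *)
Definition exp_moment : \bar R := hline (fun t => expR (- t) * t `^ (- q)).

(** Tonelli, then scaling in [l] at fixed [t]: the integral of [B (t l) * wt l] is [t ^ (- q)] times
    that of [B * wt], so the double integral factorises. *)
Lemma hline_dilate_exp (B : R -> R) : measurable_fun setT B -> (forall t, 0 <= B t) ->
  (\int[mu]_(l in `]0%R, +oo[) ((wt l)%:E * hline (fun t => expR (- t) * B (l * t))%R) =
   exp_moment * hline (fun t => B t * wt t)%R)%E.
Proof.
move=> mB B0; pose D : set R := `]0, +oo[%classic; have mD : measurable D by exact: measurable_itv.
pose f (z : R * R) : \bar R := (\1_D z.1 * (wt z.1 * (expR (- z.2) * B (z.1 * z.2))))%:E.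
have mf : measurable_fun setT f.
  apply/measurable_EFinP; apply: measurable_funM.
    by apply: (measurableT_comp _ measurable_fst); exact: measurable_indic.
  apply: measurable_funM; first exact: (measurableT_comp (measurable_wt q) measurable_fst).
  apply: measurable_funM; first exact: (measurableT_comp mexp measurable_snd).
  apply: (measurableT_comp mB); apply: measurable_funM; [exact: measurable_fst|exact: measurable_snd].
have f0 z : (0 <= f z)%E.
  by rewrite lee_fin !mulr_ge0 ?expR_ge0 ?wt_ge0.
have mBl l : measurable_fun setT (fun t => expR (- t) * B (l * t)).
  by apply: measurable_funM => //; exact: measurable_comp_dilate.
transitivity (\int[mu]_l \int[mu]_(t in D) f (l, t))%E.
  rewrite [LHS]integral_mkcond; apply: eq_integral => l _.
  rewrite patchE /f/= indicE; case: (l \in _); last first.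
    by rewrite [RHS]integral0_eq// => t _; rewrite mul0r.
  rewrite -(hlineZ (wt_ge0 q l) (mBl l)); last by move=> t _; rewrite mulr_ge0 ?expR_ge0.
  by apply: eq_integral => t _; rewrite mul1r.
rewrite tonelli_in//.
have C0 : (0 <= hline (fun t => B t * wt t)%R)%E.
  by apply: hline_ge0 => t _; rewrite mulr_ge0 ?wt_ge0.
rewrite /exp_moment muleC [X in (_ * X)%E]/hline -ge0_integralZl//; last 2 first.
- by apply/measurable_EFinP; apply: measurable_funTS; apply: measurable_funM => //; exact: measurable_powR.
- by move=> t _; rewrite lee_fin mulr_ge0 ?expR_ge0 ?powR_ge0.
apply: eq_integral => t; rewrite inE /D /= in_itv/= andbT => t0.
rewrite muleC EFinM -muleA -(hline_scale _ t0)//.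
have mBw : measurable_fun setT (fun x => B (t * x) * wt x).
  by apply: measurable_funM; [exact: measurable_comp_dilate|exact: measurable_wt].
rewrite -(hlineZ (expR_ge0 (- t)) mBw); last by move=> x _; rewrite mulr_ge0 ?wt_ge0.
rewrite /hline [RHS]integral_mkcond; apply: eq_integral => l _.
rewrite patchE /f/= indicE /D; case: (l \in _); last by rewrite mul0r.
by congr EFin; rewrite mul1r (mulrC l t); ring.
Qed.

Lemma moment_le (B : R -> R) : measurable_fun setT B -> (forall t, 0 <= B t) ->
  (forall t, 0 < t -> F t <= B t) ->
  (kernel_mass q * \int[P]_w neg_pow (q / 2) (X w ^+ 2 + Y w ^+ 2)%R <=
   exp_moment * hline (fun t => B t * wt t)%R)%E.
Proof.
move=> mB B0 FB; rewrite kernel_mass_moment -hline_dilate_exp//.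
apply: ge0_le_integral => //.
- move=> l _; rewrite mule_ge0 ?lee_fin ?wt_ge0// integral_ge0// => w _.
  by rewrite lee_fin circ_kernel_ge0.
- apply: measurable_funTS; apply: emeasurable_funM.
    by apply/measurable_EFinP; exact: measurable_wt.
  pose f (z : T * R) : \bar R := (circ_kernel (z.2 * N z.1))%:E.
  have mf : measurable_fun setT f.
    apply/measurable_EFinP; apply: (measurableT_comp (@measurable_circ_kernel R)).
    apply: measurable_funM; first exact: measurable_snd.
    exact: (measurableT_comp measurable_radius measurable_fst).
  have f0 z : (0 <= f z)%E by rewrite lee_fin circ_kernel_ge0.
  exact: (@measurable_fun_fubini_tonelli_G _ _ _ _ _ P f mf f0).
- apply: measurable_funTS; apply: emeasurable_funM.
    by apply/measurable_EFinP; exact: measurable_wt.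
  apply: (@measurable_integral_in _ _ _ _ (fun z : R * R => (expR (- z.2) * B (z.1 * z.2))%:E)) => //.
    apply/measurable_EFinP; apply: measurable_funM.
      exact: (measurableT_comp mexp measurable_snd).
    apply: (measurableT_comp mB); apply: measurable_funM; [exact: measurable_fst|exact: measurable_snd].
  by move=> z; rewrite lee_fin mulr_ge0 ?expR_ge0.
- move=> l /=; rewrite in_itv/= andbT => l0.
  by apply: lee_wpmul2l; [rewrite lee_fin wt_ge0|exact: mean_kernel_le].
Qed.

Lemma moment_eq (B : R -> R) : measurable_fun setT B -> (forall t, 0 <= B t) ->
  (forall t, 0 < t -> F t = B t) ->
  (kernel_mass q * \int[P]_w neg_pow (q / 2) (X w ^+ 2 + Y w ^+ 2)%R =
   exp_moment * hline (fun t => B t * wt t)%R)%E.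
Proof.
move=> mB B0 FB; rewrite kernel_mass_moment -hline_dilate_exp//.
apply: eq_integral => l /[!inE]/=; rewrite in_itv/= andbT => l0.
by rewrite (mean_kernel_eq mB).
Qed.

End fourier_moment.

(** * Independent Steinhaus variables *)

Section complex_coordinates.
Variable R : realType.
Local Open Scope complex_scope.

Lemma open_measurable_coord (f : R[i] -> R) :
  (forall z w : R[i], (`|f z - f w|%:C <= `|z - w|)) ->
  measurable_fun setT (f : borelC R -> R).
Proof.
move=> fle; apply: (measurability _ (RGenOpens.measurableE R)).
move=> _ [_ [x [y ->]]] <-; rewrite setTI.
apply: sub_sigma_algebra; rewrite openE => /= z; rewrite /= in_itv/= => /andP[xz zy].
rewrite /interior; apply/nbhs_ballP.
exists (Num.min (f z - x) (y - f z))%:C => /=.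
  by rewrite ltcR lt_min !subr_gt0 xz.
move=> w; rewrite /ball/= => zw; rewrite in_itv/=.
have := le_lt_trans (fle z w) zw; rewrite ltcR lt_min !ltr_norml.
by move=> /andP[/andP[h1 h2] /andP[h3 h4]]; apply/andP; split; lra.
Qed.

Lemma measurable_Re : measurable_fun setT (@complex.Re R : borelC R -> R).
Proof.
apply: open_measurable_coord => z w.
by rewrite -raddfB; exact: normc_ge_Re.
Qed.

Lemma measurable_Im : measurable_fun setT (@complex.Im R : borelC R -> R).
Proof.
apply: open_measurable_coord => -[a b] [c e] /=.
rewrite lecR -sqrtr_sqr ler_wsqrtr// lerDr; exact: sqr_ge0.
Qed.

End complex_coordinates.

Section independent_circle.
Context d (T : measurableType d) (R : realType) (P : probability T R).
Variable zeta : nat -> T -> R * R.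
Hypothesis mzeta : forall j, measurable_fun setT (zeta j).

(* Working in [R * R] rather than [borelC R] spares the measurability of [expi]. *)
Definition circ_point (t : measurableTypeR R) : R * R := (cos t, sin t).

Hypothesis zeta_law : forall j (C : set (R * R)), measurable C ->
  P (zeta j @^-1` C) = uniform_prob (@pi2_gt0 R) (circ_point @^-1` C).
Hypothesis zeta_indep : forall (J : {fset nat}) (C : nat -> set (R * R)),
  (forall i, i \in J -> measurable (C i)) ->
  P (\bigcap_(i in [set` J]) zeta i @^-1` C i) =
  (\prod_(i <- J) P (zeta i @^-1` C i))%E.

Lemma measurable_circ_point : measurable_fun setT circ_point.
Proof.
apply/measurable_fun_pairP; split.
  by apply: continuous_measurable_fun; exact: continuous_cos.
by apply: continuous_measurable_fun; exact: continuous_sin.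
Qed.

Let mpre j (C : set (R * R)) : measurable C -> measurable (zeta j @^-1` C).
Proof. by move=> mC; rewrite -[X in measurable X]setTI; exact: mzeta. Qed.

(* A pi-system generating the sigma-algebra of the [zeta i] with [i <> j]. *)
Definition others j : set (set T) := [set A | exists (J : {fset nat}) (C : nat -> set (R * R)),
  [/\ j \notin J, forall i, measurable (C i) & A = \bigcap_(i in [set` J]) zeta i @^-1` C i]].

Lemma others_measurable j : others j `<=` measurable.
Proof.
move=> _ [J [C [_ mC ->]]]; apply: bigcap_measurableType => i _; exact: mpre.
Qed.

Lemma others_setT j : others j setT.
Proof.
exists fset0, (fun=> setT); split => //.
by apply/seteqP; split => // x _ i /=; rewrite in_fset0.
Qed.

Lemma others_setI j : setI_closed (others j).
Proof.
move=> _ _ [J [C [jJ mC ->]]] [K [D [jK mD ->]]].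
exists (J `|` K)%fset, (fun i => (if i \in J then C i else setT) `&` (if i \in K then D i else setT)).
split.
- by rewrite in_fsetU negb_or jJ.
- by move=> i; apply: measurableI; case: ifP.
apply/seteqP; split => x /=.
  move=> [h1 h2] i /=; rewrite in_fsetU => _; split.
    by case: ifP => // iJ; exact: h1.
  by case: ifP => // iK; exact: h2.
move=> h; split => i /= iJ.
  by have := h i; rewrite /= in_fsetU iJ => /(_ isT) [].
by have := h i; rewrite /= in_fsetU iJ orbT => /(_ isT) [].
Qed.

Lemma others_indep0 j A C : others j A -> measurable C ->
  P (A `&` zeta j @^-1` C) = (P A * P (zeta j @^-1` C))%E.
Proof.
move=> [J [D [jJ mD ->]]] mC.
pose E i := if i == j then C else D i.
have EJ i : i \in J -> E i = D i.
  by move=> iJ; rewrite /E; case: eqP => // ij; rewrite -ij iJ in jJ.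
have mE i : measurable (E i) by rewrite /E; case: ifP.
have -> : \bigcap_(i in [set` J]) zeta i @^-1` D i `&` zeta j @^-1` C =
    \bigcap_(i in [set` (j |` J)%fset]) zeta i @^-1` E i.
  apply/seteqP; split => x /=.
    move=> [h1 h2] i /=; rewrite in_fset1U => /orP[/eqP ->|iJ]; first by rewrite /E eqxx.
    by rewrite EJ//; exact: h1.
  move=> h; split.
    by move=> i /= iJ; have := h i; rewrite /= in_fset1U iJ orbT EJ// => /(_ isT).
  by have := h j; rewrite /= in_fset1U eqxx /E eqxx => /(_ isT).
rewrite zeta_indep; last by move=> i _.
have Ej : E j = C by rewrite /E eqxx.
rewrite big_fsetU1//= muleC Ej; congr (_ * _)%E.
rewrite zeta_indep; last by move=> i _.
by apply: eq_big_seq => i iJ; rewrite EJ.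
Qed.

(** For fixed [C] both sides are finite measures in [A] that agree on the pi-system [others j]. *)
Lemma others_indep j A C : <<s others j >> A -> measurable C ->
  P (A `&` zeta j @^-1` C) = (P A * P (zeta j @^-1` C))%E.
Proof.
move=> sA mC; have mzC := mpre j mC.
have fz : P (zeta j @^-1` C) \is a fin_num by exact: fin_num_measure.
have p0 : 0 <= fine (P (zeta j @^-1` C)) by rewrite fine_ge0.
pose m1 : {measure set T -> \bar R} := mrestr P mzC.
pose m2 : {measure set T -> \bar R} := mscale (NngNum p0) P.
have := @g_sigma_algebra_measure_unique _ _ _ (others j) (@others_measurable j)
  (fun=> setT) (fun=> @others_setT j) _ m1 m2 (@others_setI j).
rewrite bigcup_const; last by exists 0%N.
move=> /(_ erefl) H.
have := H _ _ A sA; rewrite /m1 /m2 /= /mrestr /mscale /= fineK// [RHS]muleC; apply.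
- by move=> B oB; rewrite (others_indep0 oB mC) muleC.
- by move=> _; rewrite setTI; rewrite ltey_eq fz.
Qed.

Lemma measurable_of_others j (A : set T) : <<s others j >> A -> measurable A.
Proof.
by apply: smallest_sub; [exact: sigma_algebra_measurable|exact: others_measurable].
Qed.

Definition measurable_others j d' (U : measurableType d') (V : T -> U) :=
  forall A, measurable A -> <<s others j >> (V @^-1` A).

Lemma measurable_fun_of_others j d' (U : measurableType d') (V : T -> U) :
  measurable_others j V -> measurable_fun setT V.
Proof. by move=> mV _ A mA; rewrite setTI; apply: (@measurable_of_others j); exact: mV. Qed.

Lemma zeta_integral j (f : R * R -> \bar R) : measurable_fun setT f -> (forall z, 0 <= f z)%E ->
  (\int[P]_w f (zeta j w) = eavg (fun t => f (circ_point t)))%E.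
Proof.
move=> mf f0.
rewrite -(@ge0_integral_pushforward _ _ _ _ R (zeta j) (mzeta j) P setT f)//.
rewrite /eavg -(@ge0_integral_pushforward _ _ _ _ R circ_point measurable_circ_point (uniform_prob (@pi2_gt0 R)) setT f)//.
apply: eq_measure_integral => [|mcs A mA _]; [exact: measurable_circ_point|exact: zeta_law].
Qed.

(** The joint law of [V] and [zeta j] is a product, as it agrees with one on rectangles by
    [others_indep]; Tonelli then integrates [zeta j] out first. *)
Lemma peel j (V : T -> R * R) (g : (R * R) * (R * R) -> \bar R) :
  measurable_others j V -> measurable_fun setT g -> (forall z, 0 <= g z)%E ->
  (\int[P]_w g (V w, zeta j w) = \int[P]_w eavg (fun t => g (V w, circ_point t)))%E.
Proof.
move=> oV mg g0; have mV := measurable_fun_of_others oV.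
pose Vm : {mfun T >-> (R * R)%type} := HB.pack V (isMeasurableFun.Build _ _ _ _ V mV).
pose cm : {mfun measurableTypeR R >-> (R * R)%type} := HB.pack circ_point (isMeasurableFun.Build _ _ _ _ circ_point measurable_circ_point).
pose W w := (V w, zeta j w).
have mW : measurable_fun setT W by exact: measurable_fun_pair.
pose m1 := distribution P Vm; pose m2 := distribution (uniform_prob (@pi2_gt0 R)) cm.
pose mWP : {measure set ((R * R) * (R * R)) -> \bar R} :=
  measure_function_pushforward__canonical__measure_function_Measure P mW.
rewrite -[LHS](@ge0_integral_pushforward _ _ _ _ R W mW P setT g)//.
rewrite (@eq_measure_integral _ _ _ _ (m1 \x m2)%E); last first.
  move=> A mA _; apply/esym; apply: (@product_measure_unique _ _ _ _ R m1 m2 mWP) => // B C mB mC.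
  rewrite /mWP/= /pushforward.
  have -> : W @^-1` (B `*` C) = V @^-1` B `&` zeta j @^-1` C by [].
  by rewrite (others_indep (oV B mB) mC) zeta_law.
rewrite fubini_tonelli1//.
rewrite [LHS](@ge0_integral_pushforward _ _ _ _ R V mV P setT (fubini_F m2 g))//.
  apply: eq_integral => w _; rewrite /fubini_F/=.
  rewrite [LHS](@ge0_integral_pushforward _ _ _ _ R circ_point measurable_circ_point (uniform_prob (@pi2_gt0 R)) setT (fun z => g (V w, z)))//.
  exact: (measurableT_comp mg (pair1_measurable (V w))).
- exact: measurable_fun_fubini_tonelli_F.
- by move=> v _; apply: integral_ge0.
Qed.

End independent_circle.

Section measurable_sums.

Lemma measurable_sum_seq d (T : measurableType d) (R : realType) (I : eqType)
    (s : seq I) (h : I -> T -> R) :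
  (forall i, i \in s -> measurable_fun setT (h i)) ->
  measurable_fun setT (fun x => \sum_(i <- s) h i x).
Proof.
elim: s => [|i s IH] mh.
  by under eq_fun do rewrite big_nil; exact: measurable_cst.
under eq_fun do rewrite big_cons; apply: measurable_funD.
  by apply: mh; rewrite mem_head.
by apply: IH => k ks; apply: mh; rewrite in_cons ks orbT.
Qed.

(** Serves the induction on the characteristic function, where [c = J0 (t * b j)] may be negative,
    so that [Z] has to be treated as an integrable signed function. *)
Lemma integral_1DZ d (T : measurableType d) (R : realType) (P : probability T R)
    (Z : T -> R) (c z : R) : measurable_fun setT Z -> (forall w, `|Z w| <= 1) ->
  (\int[P]_w (1 + Z w)%:E = (1 + z)%:E)%E ->
  (\int[P]_w (1 + c * Z w)%:E = (1 + c * z)%:E)%E.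
Proof.
move=> mZ Z1.
have iZ : P.-integrable setT (EFin \o Z).
  apply: measurable_bounded_integrable => //; first by rewrite -ge0_fin_numE// fin_num_measure.
  by exists 1; split => // M M1 w _; apply: (le_trans (Z1 w)); exact: ltW.
have P1 : (\int[P]_w 1%:E = 1%:E)%E by rewrite integral_cst// mul1e; exact: probability_setT.
have i1 : P.-integrable setT (EFin \o (fun=> 1)).
  by apply: finite_measure_integrable_cst.
have E (k : R) : (\int[P]_w (1 + k * Z w)%:E = 1%:E + k%:E * \int[P]_w (Z w)%:E)%E.
  under eq_integral do rewrite EFinD EFinM.
  rewrite integralD//; last exact: integrableZl.
  by rewrite P1 integralZl.
have fZ : (\int[P]_w (Z w)%:E)%E \is a fin_num by exact: integrable_fin_num.
move=> H; rewrite E.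
have : (1%:E + 1%:E * \int[P]_w (Z w)%:E = (1 + z)%:E)%E.
  by rewrite -E -H; apply: eq_integral => w _; rewrite mul1r.
by rewrite -(fineK fZ) mul1e -EFinD => -[/addrI ->]; rewrite -EFinM -EFinD.
Qed.

Lemma measurable_translate_scale (R : realType) (b : R) :
  measurable_fun setT (fun z : (R * R) * (R * R) => z.1.1 + b * z.2.1) /\
  measurable_fun setT (fun z : (R * R) * (R * R) => z.1.2 + b * z.2.2).
Proof.
split; apply: measurable_funD.
- exact: (measurableT_comp measurable_fst measurable_fst).
- exact: (measurable_funM (measurable_cst b) (measurableT_comp measurable_fst measurable_snd)).
- exact: (measurableT_comp measurable_snd measurable_fst).
- exact: (measurable_funM (measurable_cst b) (measurableT_comp measurable_snd measurable_snd)).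
Qed.

End measurable_sums.

(** * Characteristic functions of Steinhaus sums *)

Section steinhaus_sums.
Context d (T : measurableType d) (R : realType) (P : probability T R).
Variable zeta : nat -> T -> R * R.
Hypothesis mzeta : forall j, measurable_fun setT (zeta j).
Hypothesis zeta_law : forall j (C : set (R * R)), measurable C ->
  P (zeta j @^-1` C) = uniform_prob (@pi2_gt0 R) (@circ_point R @^-1` C).
Hypothesis zeta_indep : forall (J : {fset nat}) (C : nat -> set (R * R)),
  (forall i, i \in J -> measurable (C i)) ->
  P (\bigcap_(i in [set` J]) zeta i @^-1` C i) =
  (\prod_(i <- J) P (zeta i @^-1` C i))%E.
Variable b : nat -> R.

Definition coord_sum (s : seq nat) (w : T) : R * R :=
  (\sum_(i <- s) b i * (zeta i w).1, \sum_(i <- s) b i * (zeta i w).2).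

Lemma measurable_others_coord_sum j s : j \notin s -> measurable_others zeta j (coord_sum s).
Proof.
move=> js.
have mz i : i \in s -> measurable_fun setT (zeta i : g_sigma_algebraType (others zeta j) -> R * R).
  move=> si _ A mA; rewrite setTI; apply: sub_sigma_algebra.
  exists [fset i]%fset, (fun=> A); split => //.
    by rewrite in_fset1; apply: contraNneq js => ->.
  apply/seteqP; split => [w wA k /=|w /(_ i)/=]; rewrite in_fset1; first by move=> /eqP ->.
  by rewrite eqxx => /(_ isT).
have ms : measurable_fun setT (coord_sum s : g_sigma_algebraType (others zeta j) -> R * R).
  apply: measurable_fun_pair; apply: measurable_sum_seq => i /mz mi;
    apply: measurable_funM; try exact: measurable_cst.
    exact: (measurableT_comp measurable_fst mi).
  exact: (measurableT_comp measurable_snd mi).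
by move=> A mA; have := ms measurableT A mA; rewrite setTI.
Qed.

Lemma measurable_coord_sum s : measurable_fun setT (coord_sum s).
Proof.
apply: measurable_fun_pair; apply: measurable_sum_seq => i _; apply: measurable_funM; try exact: measurable_cst.
  exact: (measurableT_comp measurable_fst (mzeta i)).
exact: (measurableT_comp measurable_snd (mzeta i)).
Qed.

Let mcos : measurable_fun setT (@cos R).
Proof. by apply: continuous_measurable_fun; exact: continuous_cos. Qed.

(** Induction on [s]: averaging [cos (Z + t b_j cos)] over the last variable gives
    [J0 (t b_j) cos Z], the sine part having mean zero. The result does not depend on [a], which is
    the rotation invariance used in the inversion. *)
Lemma coord_sum_cos s t a : uniq s ->
  (\int[P]_w (1 + cos (t * ((coord_sum s w).1 * cos a + (coord_sum s w).2 * sin a))%R)%:E =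
   (1 + \prod_(i <- s) J0 (t * b i))%:E)%E.
Proof.
elim: s => [_|j s IH /= /andP[js us]].
  under eq_integral do rewrite /coord_sum /= !big_nil !mul0r addr0 mulr0 cos0.
  rewrite big_nil integral_cst// -[RHS]mule1; congr (_ * _)%E; exact: probability_setT.
pose g (z : (R * R) * (R * R)) : \bar R :=
  (1 + cos (t * ((z.1.1 + b j * z.2.1) * cos a + (z.1.2 + b j * z.2.2) * sin a)))%:E.
have mg : measurable_fun setT g.
  apply/measurable_EFinP; apply: measurable_funD; first exact: measurable_cst.
  apply: (measurableT_comp mcos); apply: measurable_funM; first exact: measurable_cst.
  have [h1 h2] := measurable_translate_scale (b j).
  by apply: measurable_funD; apply: measurable_funM => //; exact: measurable_cst.
have g0 z : (0 <= g z)%E.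
  rewrite lee_fin /g; set u := cos _.
  have : -1 <= u by exact: cos_geN1.
  by lra.
transitivity (\int[P]_w g (coord_sum s w, zeta j w))%E.
  by apply: eq_integral => w _; rewrite /g /coord_sum /= !big_cons ![_ + \sum_(_ <- _) _]addrC.
rewrite (peel mzeta zeta_law zeta_indep (measurable_others_coord_sum js) mg g0).
pose Z w := t * ((coord_sum s w).1 * cos a + (coord_sum s w).2 * sin a).
transitivity (\int[P]_w (1 + J0 (t * b j) * cos (Z w))%:E)%E.
  apply: eq_integral => w _.
  rewrite mulrC -(@eavg_cos_circle R (Z w) (t * b j) (cos a) (sin a)); last exact: cos2Dsin2.
  apply: eq_integral => x _; rewrite /g /circ_point /Z /=; congr (1 + cos _)%:E; ring.
rewrite (@integral_1DZ _ _ _ _ _ _ (\prod_(i <- s) J0 (t * b i))).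
- by rewrite big_cons.
- apply: (measurableT_comp mcos); apply: measurable_funM; first exact: measurable_cst.
  apply: measurable_funD; apply: measurable_funM; try exact: measurable_cst.
    exact: (measurableT_comp measurable_fst (measurable_coord_sum s)).
  exact: (measurableT_comp measurable_snd (measurable_coord_sum s)).
- by move=> w; exact: norm_cos_le1.
- exact: IH.
Qed.

End steinhaus_sums.

Section measurable_averages.
Context d (T : measurableType d) (R : realType).

Lemma measurable_eavg (h : T * R -> \bar R) : measurable_fun setT h ->
  (forall z, 0 <= h z)%E -> measurable_fun setT (fun w => eavg (fun t => h (w, t))).
Proof.
move=> mh h0.
exact: (@measurable_fun_fubini_tonelli_F _ _ _ _ _ (uniform_prob (@pi2_gt0 R)) h mh h0).
Qed.

Lemma measurable_neg_pow_circle k (x y b : R) :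
  measurable_fun setT (fun t : R => neg_pow k ((x + b * cos t) ^+ 2 + (y + b * sin t) ^+ 2)).
Proof.
have c : continuous (fun t : R => (x + b * cos t) ^+ 2 + (y + b * sin t) ^+ 2) by cont.
exact: (measurableT_comp (measurable_neg_pow k) (continuous_measurable_fun c)).
Qed.

Lemma measurable_eavg_neg_pow k (X Y : T -> R) (b : R) : measurable_fun setT X -> measurable_fun setT Y ->
  measurable_fun setT (fun w => eavg (fun t =>
    neg_pow k ((X w + b * cos t) ^+ 2 + (Y w + b * sin t) ^+ 2))).
Proof.
move=> mX mY; apply: (@measurable_eavg (fun z : T * R =>
  neg_pow k ((X z.1 + b * cos z.2) ^+ 2 + (Y z.1 + b * sin z.2) ^+ 2))); last first.
  by move=> z; exact: neg_pow_ge0.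
have cb : continuous (fun t : R => b * cos t) by cont.
have sb : continuous (fun t : R => b * sin t) by cont.
apply: (measurableT_comp (measurable_neg_pow k)).
apply: measurable_funD; apply: measurable_funX; apply: measurable_funD.
- exact: (measurableT_comp mX measurable_fst).
- exact: (measurableT_comp (continuous_measurable_fun cb) measurable_snd).
- exact: (measurableT_comp mY measurable_fst).
- exact: (measurableT_comp (continuous_measurable_fun sb) measurable_snd).
Qed.

End measurable_averages.

(** * Extremality of the two-term sum *)

Section negative_moments.
Context d (T : measurableType d) (R : realType) (P : probability T R).
Variable zeta : nat -> T -> R * R.
Hypothesis mzeta : forall j, measurable_fun setT (zeta j).
Hypothesis zeta_law : forall j (C : set (R * R)), measurable C ->
  P (zeta j @^-1` C) = uniform_prob (@pi2_gt0 R) (@circ_point R @^-1` C).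
Hypothesis zeta_indep : forall (J : {fset nat}) (C : nat -> set (R * R)),
  (forall i, i \in J -> measurable (C i)) ->
  P (\bigcap_(i in [set` J]) zeta i @^-1` C i) =
  (\prod_(i <- J) P (zeta i @^-1` C i))%E.
Variable q : R.
Hypothesis q0 : 0 < q.
Hypothesis q1 : q < 1.
Local Notation wt := (wt q).
Local Notation k := (q / 2).
Local Notation r2 := ((Num.sqrt 2)^-1 : R).

Definition neg_moment (b : nat -> R) (s : seq nat) : \bar R :=
  (\int[P]_w neg_pow k (((coord_sum zeta b s w).1 ^+ 2 + (coord_sum zeta b s w).2 ^+ 2)%R))%E.

Let k0 : 0 < k. Proof. by rewrite divr_gt0. Qed.
Let k1 : k < 1. Proof. by have := q0; have := q1; lra. Qed.

Let r2_gt0 : 0 < r2. Proof. by rewrite invr_gt0 sqrtr_gt0. Qed.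
Let r2_sqr : r2 ^+ 2 = 1 / 2.
Proof. by rewrite exprVn sqr_sqrtr// mul1r. Qed.

Lemma hline_wsum_le (s : seq nat) (p : nat -> R) (f : nat -> R -> R) (Q : \bar R) :
  (0 <= Q)%E -> (forall i, i \in s -> [/\ 0 <= p i, measurable_fun setT (f i),
    forall x, 0 < x -> 0 <= f i x & (hline (f i) <= Q)%E]) ->
  (hline (fun x => \sum_(i <- s) p i * f i x)%R <= (\sum_(i <- s) p i)%:E * Q)%E.
Proof.
move=> Q0; elim: s => [|j s IH] H.
  rewrite big_nil mul0e (@eq_hline _ _ (fun=> 0)); last by move=> x _; rewrite big_nil.
  by rewrite /hline integral0.
have [pj mj fj hj] := H j (mem_head j s).
have Hs i : i \in s -> [/\ 0 <= p i, measurable_fun setT (f i),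
    forall x, 0 < x -> 0 <= f i x & (hline (f i) <= Q)%E].
  by move=> si; apply: H; rewrite in_cons si orbT.
rewrite (@eq_hline _ _ (fun x => p j * f j x + \sum_(i <- s) p i * f i x)); last first.
  by move=> x _; rewrite big_cons.
rewrite hlineD; last 4 first.
- by apply: measurable_funM => //; exact: measurable_cst.
- apply: measurable_sum_seq => i /Hs[_ mi _ _].
  by apply: measurable_funM => //; exact: measurable_cst.
- by move=> x x0; rewrite mulr_ge0// fj.
- by move=> x x0; rewrite big_seq sumr_ge0// => i /Hs[pi _ fi _]; rewrite mulr_ge0// fi.
rewrite big_cons EFinD ge0_muleDl ?lee_fin//; last first.
  by rewrite big_seq sumr_ge0// => i /Hs[].
apply: leeD; last exact: IH.
by rewrite hlineZ//; apply: lee_wpmul2l; rewrite ?lee_fin.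
Qed.

Lemma weighted_amgm_seq (s : seq nat) (p x : nat -> R) : (forall i, 0 <= p i) ->
  \sum_(i <- s) p i = 1 -> (forall i, 0 <= x i) ->
  \prod_(i <- s) x i `^ p i <= \sum_(i <- s) p i * x i.
Proof.
move=> p0 p1 x0; rewrite (big_nth 0%N) [leRHS](big_nth 0%N) !big_mkord.
by apply: weighted_amgm => //; rewrite -p1 [RHS](big_nth 0%N) big_mkord.
Qed.

Let F (b : nat -> R) (s : seq nat) (t : R) := \prod_(i <- s) J0 (t * b i).
Let measurable_J0l (c : R) : measurable_fun setT (fun t => J0 (c * t)).
Proof. exact: measurable_comp_dilate (@measurable_J0 R). Qed.

Let mF b s : measurable_fun setT (F b s).
Proof.
rewrite /F; elim: s => [|i s IH].
  by under eq_fun do rewrite big_nil; exact: measurable_cst.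
under eq_fun do rewrite big_cons; apply: measurable_funM => //.
by under eq_fun do rewrite mulrC; exact: measurable_J0l.
Qed.

Let m1 b s : measurable_fun setT (fun w => (coord_sum zeta b s w).1).
Proof. exact: (measurableT_comp measurable_fst (measurable_coord_sum mzeta b s)). Qed.
Let m2 b s : measurable_fun setT (fun w => (coord_sum zeta b s w).2).
Proof. exact: (measurableT_comp measurable_snd (measurable_coord_sum mzeta b s)). Qed.

Definition two_term_moment : \bar R := hline (fun x => J0 (r2 * x) ^+ 2 * wt x).

Lemma neg_moment_small b s : uniq s -> (forall i, 0 < b i) ->
  (forall i, i \in s -> b i ^+ 2 <= 1 / 2) -> \sum_(i <- s) b i ^+ 2 = 1 ->
  (kernel_mass q * neg_moment b s <= exp_moment q * two_term_moment)%E.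
Proof.
move=> us b0 bs b1.
pose f i (x : R) := `|J0 (b i * x)| `^ (b i ^- 2).
have mf i : measurable_fun setT (f i).
  apply: (measurableT_comp (measurable_powR _)).
  exact: (measurableT_comp (@normr_measurable R setT) (measurable_J0l (b i))).
have f0 i x : 0 <= f i x by exact: powR_ge0.
pose B x := \sum_(i <- s) b i ^+ 2 * f i x.
have mB : measurable_fun setT B.
  by apply: measurable_sum_seq => i _; apply: measurable_funM => //; exact: measurable_cst.
have B0 x : 0 <= B x by apply: sumr_ge0 => i _; rewrite mulr_ge0 ?sqr_ge0.
have FB t : 0 < t -> F b s t <= B t.
  move=> t0; rewrite /F /B; apply: (le_trans (ler_norm _)); rewrite normr_prod.
  rewrite (eq_bigr (fun i => f i t `^ (b i ^+ 2))); last first.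
    move=> i _; rewrite /f -powRrM mulVf ?powRr1// 1?mulrC//.
    by rewrite expf_neq0// gt_eqF.
  by apply: weighted_amgm_seq => // i; exact: sqr_ge0.
have H := @moment_le _ _ _ P _ _ (F b s) (m1 b s) (m2 b s) (mF b s)
  (fun t a => coord_sum_cos mzeta zeta_law zeta_indep b t a us) q q0 q1 B mB B0 FB.
apply: (le_trans H); apply: lee_wpmul2l.
  by apply: hline_ge0 => x _; apply: mulr_ge0; [exact: expR_ge0|exact: powR_ge0].
have mw := measurable_wt q.
have T0 : (0 <= two_term_moment)%E.
  by apply: hline_ge0 => x _; apply: mulr_ge0; [exact: sqr_ge0|exact: wt_ge0].
rewrite (_ : (fun t => _) = (fun t => \sum_(i <- s) b i ^+ 2 * (f i t * wt t))); last first.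
  by apply/funext => t; rewrite /B mulr_suml; apply: eq_bigr => i _; rewrite mulrA.
have := @hline_wsum_le s (fun i => b i ^+ 2) (fun i t => f i t * wt t) two_term_moment T0.
rewrite b1 mul1e; apply => i si; split.
- exact: sqr_ge0.
- exact: measurable_funM.
- by move=> x _; apply: mulr_ge0; [exact: f0|exact: wt_ge0].
- by apply: bessel_power_le => //; exact: bs.
Qed.

Definition half_coef : nat -> R := fun=> r2.

(** For two equal coefficients the product of [J0] is a square, hence nonnegative: it serves as its
    own majorant, and the inversion becomes an equality with the same two constants. *)
Lemma neg_moment_two : (kernel_mass q * neg_moment half_coef [:: 0; 1]%N = exp_moment q * two_term_moment)%E.
Proof.
pose B x := J0 (r2 * x) ^+ 2.
have mB : measurable_fun setT B by apply: measurable_funX; exact: measurable_J0l.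
have B0 x : 0 <= B x by exact: sqr_ge0.
have FB t : 0 < t -> F half_coef [:: 0; 1]%N t = B t.
  by move=> _; rewrite /F !big_cons big_nil mulr1 /B /half_coef expr2 (mulrC t).
exact: (@moment_eq _ _ _ P _ _ (F half_coef [:: 0; 1]%N) (m1 _ _) (m2 _ _)
  (fun t a => @coord_sum_cos _ _ _ _ _ mzeta zeta_law zeta_indep half_coef [:: 0; 1]%N t a isT) q q0 q1 B mB B0 FB).
Qed.

Lemma neg_moment_peel b s j : j \notin s ->
  neg_moment b (j :: s) = (\int[P]_w eavg (fun t =>
    neg_pow k (((coord_sum zeta b s w).1 + (b j * cos t)%R) ^+ 2 +
            ((coord_sum zeta b s w).2 + (b j * sin t)%R) ^+ 2)%R))%E.
Proof.
move=> js; pose g (z : (R * R) * (R * R)) : \bar R :=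
  neg_pow k ((z.1.1 + b j * z.2.1) ^+ 2 + (z.1.2 + b j * z.2.2) ^+ 2).
have mg : measurable_fun setT g.
  apply: (measurableT_comp (measurable_neg_pow _)).
  have [h1 h2] := measurable_translate_scale (b j).
  by apply: measurable_funD; apply: measurable_funX.
rewrite -[RHS](peel mzeta zeta_law zeta_indep (measurable_others_coord_sum b js) mg); last first.
  by move=> z; exact: neg_pow_ge0.
apply: eq_integral => w _; rewrite /g /coord_sum /= !big_cons.
by rewrite (addrC (b j * _)) (addrC (b j * (zeta j w).2)).
Qed.

Lemma neg_moment_large b s j : uniq s -> j \in s -> 0 < b j ->
  (neg_moment b s <= ((b j ^+ 2) `^ (- k))%:E * circ_moment k)%E.
Proof.
move=> us js b0.
have -> : neg_moment b s = neg_moment b (j :: rem j s).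
  apply: eq_integral => w _; congr neg_pow; rewrite /coord_sum /=.
  by rewrite !(perm_big _ (perm_to_rem js)).
rewrite neg_moment_peel ?mem_rem_uniqF//.
have G0 : (0 <= circ_moment k)%E by apply: integral_ge0 => t _; exact: neg_pow_ge0.
have C0 : (0 <= ((b j ^+ 2) `^ (- k))%:E * circ_moment k)%E.
  by rewrite mule_ge0// lee_fin powR_ge0.
rewrite -[leRHS]mule1 -(@probability_setT _ _ _ P) -integral_cst//.
apply: ge0_le_integral.
- exact: measurableT.
- by move=> w _; apply: integral_ge0 => t _; exact: neg_pow_ge0.
- exact: measurable_eavg_neg_pow (m1 _ _) (m2 _ _).
- exact: measurable_cst.
- by move=> w _; exact: eavg_neg_pow_le.
Qed.

(** Given [zeta 1], the circle described by [zeta 0] is shifted by a vector of the same length, the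
    case of equality in the bound behind [neg_moment_large]. *)
Lemma neg_moment_half : neg_moment half_coef [:: 0; 1]%N = (((1 / 2 : R) `^ (- k))%:E * circ_moment k)%E.
Proof.
rewrite neg_moment_peel//.
pose h (v : R * R) : \bar R := eavg (fun t => neg_pow k ((v.1 + 1 * cos t) ^+ 2 + (v.2 + 1 * sin t) ^+ 2)).
have mh : measurable_fun setT h.
  exact: (measurable_eavg_neg_pow k 1 measurable_fst measurable_snd).
have h0 v : (0 <= h v)%E by apply: integral_ge0 => t _; exact: neg_pow_ge0.
transitivity (\int[P]_w (((1 / 2 : R) `^ (- k))%:E * h (zeta 1%N w)))%E.
  apply: eq_integral => w _; rewrite /h -eavgZ; last 3 first.
  - exact: powR_ge0.
  - exact: measurable_neg_pow_circle.
  - by move=> t; exact: neg_pow_ge0.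
  apply: eq_integral => t _; rewrite -r2_sqr -neg_powM ?exprn_gt0//; last by rewrite addr_ge0 ?sqr_ge0.
  congr neg_pow; rewrite /coord_sum /= !big_seq1 /half_coef; ring.
rewrite ge0_integralZl_EFin; last 4 first.
- exact: measurableT.
- by move=> w _; exact: h0.
- exact: (measurableT_comp mh (mzeta 1%N)).
- exact: powR_ge0.
congr (_ * _)%E; rewrite (zeta_integral mzeta zeta_law)//.
transitivity (eavg (fun _ : R => circ_moment k)); last exact: eavg_cst.
apply: eq_integral => t _; apply: etrans (eavg_neg_pow_circle k (cos2Dsin2 t)).
by rewrite /h /circ_point; apply: eq_integral => x _; rewrite !mul1r.
Qed.

Lemma neg_moment_le b s : uniq s -> (forall i, 0 < b i) -> \sum_(i <- s) b i ^+ 2 = 1 ->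
  (neg_moment half_coef [:: 0; 1]%N >= neg_moment b s)%E.
Proof.
move=> us b0 b1; have [/hasP[j js bj]|/hasPn bs] := boolP (has (fun i => 1 / 2 <= b i ^+ 2) s).
  rewrite neg_moment_half; apply: (le_trans (neg_moment_large us js (b0 j))).
  apply: lee_wpmul2r; first by apply: integral_ge0 => t _; exact: neg_pow_ge0.
  by rewrite lee_fin; apply: powRN_le => //; exact: ltW.
have H : (kernel_mass q * neg_moment b s <= kernel_mass q * neg_moment half_coef [:: 0; 1]%N)%E.
  have bs' i : i \in s -> b i ^+ 2 <= 1 / 2 by move=> /bs; rewrite -ltNge => /ltW.
  by apply: le_trans (neg_moment_small us b0 bs' b1) _; rewrite neg_moment_two.
move: (neg_moment b s) (neg_moment half_coef _) H => x y.
by rewrite (lee_pmul2l (kernel_mass_fin q0 q1) (kernel_mass_gt0 q1)).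
Qed.

End negative_moments.

(** * The Khinchin constant *)

Local Open Scope complex_scope.

Section extended_powers.
Variable R : realType.

(** Passing to the squared modulus halves the exponent and avoids the square root; at [z = 0] both
    sides are [+oo]. *)
Lemma xpow_normc (p : R) (z : R[i]) : p < 0 ->
  xpow (ComplexField.Normc.normc z)%:E p =
  neg_pow (- p / 2) (complex.Re z ^+ 2 + complex.Im z ^+ 2).
Proof.
move=> p0; have q0 : 0 < - p by rewrite oppr_gt0.
rewrite /xpow p0 poweR_EFin inver; case: z => x y /=.
set u := _ + _; have u0 : 0 <= u by rewrite addr_ge0// sqr_ge0.
rewrite /neg_pow powR_eq0 sqrtr_eq0 (gt_eqF q0) andbT.
have -> : (u <= 0) = (u == 0) by rewrite eq_le u0 andbT.
case: eqVneq => // un; congr EFin.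
by rewrite -powRN -(powR12_sqrt u0) -powRrM; congr (_ `^ _); field.
Qed.

Lemma xpow_anti (p : R) (x y : \bar R) : p < 0 -> (0 <= x)%E -> (x <= y)%E ->
  (xpow y p <= xpow x p)%E.
Proof.
move=> p0 x0 xy; have y0 := le_trans x0 xy; rewrite /xpow p0.
rewrite lee_pV2 ?inE ?poweR_ge0//.
apply: gt0_ler_poweR => //; first by rewrite oppr_ge0 ltW.
  by rewrite in_itv/= x0 leey.
by rewrite in_itv/= y0 leey.
Qed.

End extended_powers.

Section steinhaus_coordinates.
Context (d : measure_display) (T : measurableType d) (R : realType) (P : probability T R).
Variable xi : nat -> {RV P >-> borelC R}.
Hypothesis xi_steinhaus : forall j, steinhaus (xi j).
Hypothesis xi_indep : mutually_independent xi.

Definition coord (z : borelC R) : R * R := (complex.Re (z : R[i]), complex.Im (z : R[i])).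

Definition zeta j (w : T) : R * R := coord (xi j w).

Lemma measurable_coord : measurable_fun setT coord.
Proof. exact: measurable_fun_pair (@measurable_Re R) (@measurable_Im R). Qed.

Let mpre (C : set (R * R)) : measurable C -> measurable (coord @^-1` C).
Proof. by move=> mC; rewrite -[X in measurable X]setTI; exact: measurable_coord. Qed.

Lemma measurable_zeta j : measurable_fun setT (zeta j).
Proof. exact: (measurableT_comp measurable_coord (@measurable_funPT _ _ _ _ (xi j))). Qed.

Lemma zeta_law j (C : set (R * R)) : measurable C ->
  P (zeta j @^-1` C) = uniform_prob (@pi2_gt0 R) (@circ_point R @^-1` C).
Proof. by move=> mC; exact: xi_steinhaus (mpre mC). Qed.

Lemma zeta_indep (J : {fset nat}) (C : nat -> set (R * R)) :
  (forall i, i \in J -> measurable (C i)) ->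
  P (\bigcap_(i in [set` J]) zeta i @^-1` C i) =
  (\prod_(i <- J) P (zeta i @^-1` C i))%E.
Proof. by move=> mC; apply: (xi_indep (B := fun i => coord @^-1` C i)) => i /mC; exact: mpre. Qed.

Lemma coord_wsum n (a : 'I_n -> R) (b : nat -> R) w : (forall j : 'I_n, b j = a j) ->
  coord (wsum (fun j => xi j) a w) = coord_sum zeta b (index_iota 0 n) w.
Proof.
move=> ba; rewrite /coord /wsum /coord_sum !big_mkord !raddf_sum/=.
by congr pair; apply: eq_bigr => j _; rewrite ba /zeta /coord; case: (xi j w) => x y /=; ring.
Qed.

Lemma pnorm_wsum n (a : 'I_n -> R) (b : nat -> R) (p : R) : (forall j : 'I_n, b j = a j) -> p < 0 ->
  pnorm P p (wsum (fun j => xi j) a) =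
  xpow (neg_moment P zeta (- p) b (index_iota 0 n)) p^-1.
Proof.
move=> ba p0; rewrite /pnorm /neg_moment; congr xpow; apply: eq_integral => w _.
by rewrite xpow_normc// -(coord_wsum w ba).
Qed.

End steinhaus_coordinates.

Theorem theorem1 (R : realType) (d : measure_display) (T : measurableType d)
    (P : probability T R) (xi : nat -> {RV P >-> borelC R}) (p : R)
    (hp1 : -1 < p) (hp0 : p < 0)
    (xi_steinhaus : forall j, steinhaus (xi j))
    (xi_indep : mutually_independent xi) :
  khinchin_const P xi p =
  pnorm P p (fun w => ((xi 0%N w : R[i]) + (xi 1%N w : R[i]))
                      / (Num.sqrt (2 : R))%:C).
Proof.
have q0 : 0 < - p by rewrite oppr_gt0.
have q1 : - p < 1 by rewrite ltrNl.
have r2_gt0 : 0 < (Num.sqrt 2)^-1 :> R by rewrite invr_gt0 sqrtr_gt0.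
pose a2 : 'I_2 -> R := fun=> (Num.sqrt 2)^-1.
have -> : (fun w => ((xi 0%N w : R[i]) + (xi 1%N w : R[i])) / (Num.sqrt (2 : R))%:C) =
    wsum (fun j => xi j) a2.
  apply/funext => w; rewrite /wsum !big_ord_recl big_ord0 addr0 /a2 fmorphV.
  by rewrite -mulrDr mulrC.
apply/eqP; rewrite eq_le; apply/andP; split.
  apply: ereal_inf_lbound; exists 2%N, a2; split => //.
  by rewrite !big_ord_recl big_ord0 addr0 /a2 exprVn sqr_sqrtr//; field.
apply/ereal_infP => _ [n [a [n1 a0 a1 ->]]].
(* Indices beyond [n] receive the coefficient 1, since positivity is required of every [b i]. *)
pose b (i : nat) : R := oapp a 1 (insub i).
have ba (j : 'I_n) : b j = a j by rewrite /b valK.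
rewrite (pnorm_wsum xi (fun j : 'I_2 => erefl : half_coef R j = a2 j) hp0).
rewrite (pnorm_wsum xi ba hp0).
(* The outer exponent [1 / p] is negative: the least norm corresponds to the largest negative
   moment. *)
apply: xpow_anti.
- by rewrite invr_lt0.
- by apply: integral_ge0 => w _; exact: neg_pow_ge0.
apply: (neg_moment_le (measurable_zeta xi) (zeta_law xi_steinhaus) (zeta_indep xi_indep) q0 q1).
- exact: iota_uniq.
- by move=> i; rewrite /b; case: insub => [j|]//=.
- by rewrite big_mkord -a1; apply: eq_bigr => j _; rewrite ba.
Qed.
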